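(* Let $\alpha$ be a real number with $0\le\alpha<1/2$. Then the equality $$\int_{0}^{\infty}\frac{\ln\bigl|\zeta(1/2+\alpha+it)\,(-1/2+\alpha+it)\bigr|}{\bigl((1/2-\alpha)^2+t^2\bigr)^{3/2}}\,dt=-\int_{1}^{\infty}\frac{\ln\bigl(\zeta(\sigma)(\sigma-1)\bigr)}{(\sigma-1)^{3/2}(\sigma-2\alpha)^{3/2}}\,d\sigma$$ holds if and only if the Riemann zeta function $\zeta$ has no zeros $\sigma+it$ with $\sigma>1/2+\alpha$. In particular, for $\alpha=0$ this equality is equivalent to the Riemann hypothesis.
   Context: $\zeta$ denotes the Riemann zeta function; for real $\sigma>1$, $\zeta(\sigma)(\sigma-1)>0$ and $\ln$ is the real logarithm. The Riemann hypothesis is the statement that $\zeta$ has no zeros with real part $>1/2$. *)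

(* Defs.v *)
From HB Require Import structures.
From mathcomp Require Import all_boot all_order all_algebra.
From mathcomp Require Import all_classical all_reals all_analysis.
Set Implicit Arguments. Unset Strict Implicit. Unset Printing Implicit Defensive.
Import Order.TTheory GRing.Theory Num.Theory.
Import numFieldNormedType.Exports.
Local Open Scope ring_scope.

Record cplx (R : realType) := Cplx { re : R ; im : R }.

Section Cplx.
Variable R : realType.
Definition cadd (z w : cplx R) : cplx R := Cplx (re z + re w) (im z + im w).
Definition csub (z w : cplx R) : cplx R := Cplx (re z - re w) (im z - im w).
Definition cmul (z w : cplx R) : cplx R :=
  Cplx (re z * re w - im z * im w) (re z * im w + im z * re w).
Definition cnorm2 (z : cplx R) : R := re z ^+ 2 + im z ^+ 2.
Definition cinv (z : cplx R) : cplx R :=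
  Cplx (re z / cnorm2 z) (- im z / cnorm2 z).
Definition cdiv (z w : cplx R) : cplx R := cmul z (cinv w).
Definition cabs (z : cplx R) : R := Num.sqrt (cnorm2 z).
Definition cone : cplx R := Cplx 1 0.

Definition cpowr (x : R) (s : cplx R) : cplx R :=
  Cplx (x `^ re s * cos (im s * ln x)) (x `^ re s * sin (im s * ln x)).

Definition copp (s : cplx R) : cplx R := Cplx (- re s) (- im s).

(* Partial approximants of the Riemann zeta function, valid for Re s > 0,
   s <> 1 (classical formula, e.g. Titchmarsh (2.1.x)):
   zeta(s) = lim_{N -> oo} ( sum_{n=1}^N n^{-s} - N^{1-s}/(1-s) ). *)
Definition zeta_approx (s : cplx R) (N : nat) : cplx R :=
  csub (\big[cadd/Cplx 0 0]_(1 <= n < N.+1) cpowr n%:R (copp s))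
       (cdiv (cpowr N%:R (csub cone s)) (csub cone s)).

(* The Riemann zeta function on the half-plane Re s > 0 (s <> 1), where
   it agrees with the analytic continuation of sum n^{-s}. *)
Definition zeta (s : cplx R) : cplx R :=
  Cplx (limn (fun N => re (zeta_approx s N)))
       (limn (fun N => im (zeta_approx s N))).
End Cplx.

(* Main.v *)
(** Let a = 1/2 - alpha and f = (s - 1) zeta(s) with s = 1/2 + alpha + a sin (x + iy). The strip
    0 < x < pi/2 is mapped conformally onto the half-plane Re s > 1/2 + alpha slit along [1, oo);
    the edge x = 0 is the line s = 1/2 + alpha + it, t = a sinh y, and the edge x = pi/2 is the
    slit, sigma = 1/2 + alpha + a cosh y. By Green's formula for ln |f| and the nonnegative
    harmonic function phi_c = Re tan (c (x + iy)), 0 < c < 1, which vanishes on x = 0,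
      int ln |f(0, y)| d_x phi_c(0, y) dy - int ln |f(pi/2, y)| d_x phi_c(pi/2, y) dy
    is the integral of phi_c against the Laplacian of ln |f|; the term with d_x ln |f| on
    x = pi/2 vanishes by symmetry. Hence it is nonnegative, and zero exactly when f has no zeros
    in the strip. As c tends to 1 the two weights tend to 1 / cosh^2 y and 1 / sinh^2 y, which in
    the variables t and sigma are the weights of the theorem, up to the factor a^2.

    Green's formula is applied to ln (|f|^2 + e^2 cosh^6 y) / 2, which is subharmonic and smooth
    also at the zeros of f, in place of ln |f|; monotone convergence as e tends to 0 then shows
    that ln |f| is integrable on the edge x = 0. *)
Require Import Defs.
From HB Require Import structures.
From mathcomp Require Import all_boot all_order all_algebra.
From mathcomp Require Import all_classical all_reals all_analysis.
From mathcomp Require Import measurable_realfun lebesgue_integral_under ring lra.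
Set Implicit Arguments.
Unset Strict Implicit.
Unset Printing Implicit Defensive.
Import Order.TTheory GRing.Theory Num.Theory.
Import numFieldNormedType.Exports.
Local Open Scope ring_scope.
Local Open Scope classical_set_scope.

(** The Laplacian of [ln |f|] is only a measure, and zeros are never counted: both directions are
    estimates of the integral of [laplacian (reglog e)] against [phi_c]. The truncation [Y] goes to
    infinity first, since the flux bounds depend on [e] and [c]; then [e] goes to 0, and [c] to 1
    last. Without zeros in the open half-plane this mass must tend to 0, although the strip is
    unbounded and zeros may lie on the edge [x = 0]. Its far part is compared with [phi_(c / 2)];
    near the edge [phi_c] is small against a harmonic function on a rectangle reaching slightly to
    the left, where [f] is still holomorphic. A zero must give a lower bound that does not
    deteriorate as [c] tends to 1. It comes from the Green function of the strip, regularised at the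
    scale of [e]: it is at most a constant, independent of [c], times [ln (1 / e) * phi_c], and the
    zero contributes a multiple of [ln (1 / e)] as well. Double integrals are avoided: a Wronskian
    over vertical segments is compared with simple functions of [x] through its derivative. *)

Section Derivatives.
Context {R : realType}.
Implicit Types (f g : R -> R) (x y l m c : R) (n : nat).

(** A relation with the value as an argument: the rules below compose by unification, and [der_eq]
    reconciles the value found with the expected one. *)
Definition der f x l := is_derive x (1 : R) f l.

Lemma der_eq f x l m : der f x l -> l = m -> der f x m.
Proof. by move=> ? <-. Qed.

Lemma derC c x : der (fun=> c) x 0.
Proof. exact: is_derive_cst. Qed.

Lemma der_id x : der (fun x => x) x 1.
Proof. exact: is_derive_id. Qed.

Lemma derD f g x l m : der f x l -> der g x m -> der (fun x => f x + g x) x (l + m).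
Proof. by move=> df dg; exact: is_deriveD. Qed.

Lemma derN f x l : der f x l -> der (fun x => - f x) x (- l).
Proof. by move=> df; exact: is_deriveN. Qed.

Lemma derM f g x l m : der f x l -> der g x m ->
  der (fun x => f x * g x) x (l * g x + f x * m).
Proof.
move=> df dg; rewrite addrC [l * _]mulrC; exact: (is_deriveM df dg).
Qed.

Lemma derX f x l n : der f x l -> der (fun x => f x ^+ n) x (n%:R * f x ^+ n.-1 * l).
Proof.
move=> df; have -> : (fun x => f x ^+ n) = f ^+ n by apply/funext => y; rewrite exprfctE.
apply: der_eq (is_deriveX n df) _; by rewrite /GRing.scale/=.
Qed.

Lemma derV f x l : f x != 0 -> der f x l -> der (fun x => (f x)^-1) x (- (f x) ^- 2 * l).
Proof. by move=> f0 df; exact: (is_deriveV f0 df). Qed.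

Lemma der_comp f g x l m : der f x l -> der g (f x) m -> der (fun x => g (f x)) x (l * m).
Proof. by move=> df dg; rewrite mulrC; exact: (is_derive1_comp dg df). Qed.

Lemma der_exp f x l : der f x l -> der (fun x => expR (f x)) x (l * expR (f x)).
Proof. by move=> df; apply: der_comp df (is_derive_expR _). Qed.

Lemma der_sin f x l : der f x l -> der (fun x => sin (f x)) x (l * cos (f x)).
Proof. by move=> df; apply: der_comp df (is_derive_sin _). Qed.

Lemma der_cos f x l : der f x l -> der (fun x => cos (f x)) x (l * - sin (f x)).
Proof. by move=> df; apply: der_comp df (is_derive_cos _). Qed.

Lemma der_ln f x l : 0 < f x -> der f x l -> der (fun x => ln (f x)) x (l * (f x)^-1).
Proof. by move=> f0 df; apply: der_comp df (is_derive1_ln f0). Qed.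

Lemma der_continuous f x l : der f x l -> {for x, continuous f}.
Proof.
by move=> df; apply: differentiable_continuous; apply/derivable1_diffP; case: df.
Qed.

Lemma der_derive1 f x l : der f x l -> f^`() x = l.
Proof. by case=> df e; rewrite derive1E e. Qed.

Lemma der_derivable f x l : der f x l -> derivable f x 1.
Proof. by case. Qed.

Lemma der_mvt f f' a b : a <= b -> (forall x, a <= x <= b -> der f x (f' x)) ->
  exists2 c, a <= c <= b & f b - f a = f' c * (b - a).
Proof.
move=> ab df; have [||c cab ->] := @MVT_segment _ f f' a b ab.
- by move=> x; rewrite in_itv/= => /andP[/ltW ax /ltW xb]; apply: df; rewrite ax.
- apply: continuous_in_subspaceT => x; rewrite inE/= in_itv/= => xab.
  exact: der_continuous (df _ xab).
- by exists c => //; move: cab; rewrite in_itv.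
Qed.

Lemma der_le f g f' g' a b : a <= b -> (forall x, a <= x <= b -> der f x (f' x)) ->
  (forall x, a <= x <= b -> der g x (g' x)) ->
  (forall x, a <= x <= b -> f' x <= g' x) -> f b - f a <= g b - g a.
Proof.
move=> ab df dg fg.
have [|c cab] := @der_mvt (fun x => g x + - f x) (fun x => g' x + - f' x) a b ab.
  by move=> x xab; apply: derD (dg _ xab) _; apply: derN; exact: df.
move=> e; have : 0 <= (g' c + - f' c) * (b - a).
  by apply: mulr_ge0; rewrite subr_ge0 //; exact: fg.
by rewrite -e; lra.
Qed.

Lemma der_homo f f' a b : a <= b -> (forall x, a <= x <= b -> der f x (f' x)) ->
  (forall x, a <= x <= b -> 0 <= f' x) -> f a <= f b.
Proof.
move=> ab df f0; have := @der_le (fun=> 0) f (fun=> 0) f' a b ab _ df f0.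
by move=> /(_ (fun x _ => derC 0 x)); lra.
Qed.

Lemma der_lipschitz f f' a b C : (forall x, Num.min a b <= x <= Num.max a b ->
    der f x (f' x) /\ `|f' x| <= C) -> `|f b - f a| <= C * `|b - a|.
Proof.
wlog ab : a b / a <= b.
  move=> H d; have [ab|/ltW ba] := leP a b; first exact: H.
  by rewrite distrC (distrC b); apply: H ba _; rewrite minC maxC.
move=> d; have [x xab|c cab ->] := @der_mvt f f' a b ab.
  by apply: (d x _).1; rewrite (min_idPl ab) (max_idPr ab).
by rewrite normrM ler_wpM2r//; apply: (d c _).2; rewrite (min_idPl ab) (max_idPr ab).
Qed.

End Derivatives.

(* Closes or reduces goals [der f x l] by the rules above; the side conditions of
   [derV] and [der_ln] are left, followed by the equation for [l]. *)
Ltac der_step := first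
  [ eassumption | apply: derC | apply: der_id | eapply derD | eapply derN | eapply derM
  | eapply derX | eapply der_exp | eapply der_sin | eapply der_cos
  | eapply derV | eapply der_ln ].
Ltac der_auto := eapply der_eq; [repeat der_step | cbv beta].

(** * Joint continuity of functions of two real variables *)

Section JointContinuity.
Context {R : realType}.
Implicit Types (f g : R -> R -> R) (h : R -> R) (x y : R).

Definition cont2 f x y := {for (x, y), continuous (fun z : R * R => f z.1 z.2)}.

Lemma cont2C c x y : cont2 (fun _ _ => c) x y.
Proof. by move=> ?; exact: cst_continuous. Qed.

Lemma cont2_fst h x y : {for x, continuous h} -> cont2 (fun x _ => h x) x y.
Proof. by move=> ch; exact: (@continuous_comp _ _ _ (@fst R R) h (x, y) cvg_fst ch). Qed.

Lemma cont2_snd h x y : {for y, continuous h} -> cont2 (fun _ y => h y) x y.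
Proof. by move=> ch; exact: (@continuous_comp _ _ _ (@snd R R) h (x, y) cvg_snd ch). Qed.

Lemma cont2D f g x y : cont2 f x y -> cont2 g x y -> cont2 (fun x y => f x y + g x y) x y.
Proof. by move=> cf cg; exact: continuousD. Qed.

Lemma cont2N f x y : cont2 f x y -> cont2 (fun x y => - f x y) x y.
Proof. by move=> cf; exact: continuousN. Qed.

Lemma cont2M f g x y : cont2 f x y -> cont2 g x y -> cont2 (fun x y => f x y * g x y) x y.
Proof. by move=> cf cg; exact: continuousM. Qed.

Lemma cont2_comp h f x y : {for f x y, continuous h} -> cont2 f x y ->
  cont2 (fun x y => h (f x y)) x y.
Proof. by move=> ch cf; apply: (continuous_comp (f := fun z : R * R => f z.1 z.2)). Qed.

Lemma cont2X f n x y : cont2 f x y -> cont2 (fun x y => f x y ^+ n) x y.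
Proof.
move=> cf; apply: (cont2_comp (h := fun x => x ^+ n)) => //.
exact: exprn_continuous.
Qed.

Lemma cont2V f x y : f x y != 0 -> cont2 f x y -> cont2 (fun x y => (f x y)^-1) x y.
Proof.
by move=> f0 cf; apply: (cont2_comp (h := fun x => x^-1)) => //; exact: inv_continuous.
Qed.

Lemma cont2_ln f x y : 0 < f x y -> cont2 f x y -> cont2 (fun x y => ln (f x y)) x y.
Proof. by move=> f0 cf; apply: cont2_comp => //; exact: continuous_ln. Qed.

Lemma cont2_secl f x y : cont2 f x y -> {for x, continuous (f ^~ y)}.
Proof.
move=> cf; apply: (continuous_comp (f := fun x => (x, y)) (g := fun z : R * R => f z.1 z.2)) => //.
exact: (@cvg_pair _ _ _ (nbhs x) (nbhs x) (nbhs y) _ _ _ id (fun=> y) cvg_id (cvg_cst y)).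
Qed.

Lemma cont2_secr f x y : cont2 f x y -> {for y, continuous (f x)}.
Proof.
move=> cf; apply: (continuous_comp (f := fun y => (x, y)) (g := fun z : R * R => f z.1 z.2)) => //.
exact: (@cvg_pair _ _ _ (nbhs y) (nbhs x) (nbhs y) _ _ _ (fun=> x) id (cvg_cst x) cvg_id).
Qed.

Lemma rect_bound f a b c d :
  (forall x y, a <= x <= b -> c <= y <= d -> cont2 f x y) ->
  exists2 M : R, 0 < M & forall x y, a <= x <= b -> c <= y <= d -> `|f x y| <= M.
Proof.
move=> cf; pose A := `[a, b] `*` `[c, d].
have cA : compact A by apply: compact_setX; exact: segment_compact.
have /compact_bounded : compact ((fun z : R * R => f z.1 z.2) @` A).
  apply: continuous_compact => //; apply: continuous_in_subspaceT => -[x y].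
  by rewrite inE /A/= !in_itv/= => -[? ?]; exact: cf.
rewrite /bounded_set/= => -[M [Mr HM]]; exists (`|M| + 1).
  by rewrite ltr_wpDl.
move=> x y xab ycd; apply: (HM (`|M| + 1)); first by rewrite (le_lt_trans (ler_norm _))// ltrDl.
by exists (x, y) => //; rewrite /A/= !in_itv/= xab ycd.
Qed.

End JointContinuity.

(** * Integrals of continuous functions over a segment, with parameters *)

Section SegmentIntegral.
Context {R : realType}.
Implicit Types (f g F : R -> R) (a b c d x y : R).
Local Notation mu := (@lebesgue_measure R).

Definition Int a b f : R := (\int[mu]_(y in `[a, b]) f y)%R.

Definition contI a b f := forall y, a <= y <= b -> {for y, continuous f}.

Lemma contI_within a b f : contI a b f -> {within `[a, b], continuous f}.
Proof.
by move=> cf; apply: continuous_in_subspaceT => x; rewrite inE/= in_itv/=; exact: cf.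
Qed.

Lemma contI_integrable a b f : contI a b f -> mu.-integrable `[a, b] (EFin \o f).
Proof.
by move=> /contI_within; apply: continuous_compact_integrable; exact: segment_compact.
Qed.

Lemma contIC a b c : contI a b (fun=> c).
Proof. by move=> y _; exact: cst_continuous. Qed.

Lemma contID a b f g : contI a b f -> contI a b g -> contI a b (fun y => f y + g y).
Proof. by move=> cf cg y yab; apply: continuousD; [exact: cf|exact: cg]. Qed.

Lemma contIN a b f : contI a b f -> contI a b (fun y => - f y).
Proof. by move=> cf y yab; apply: continuousN; exact: cf. Qed.

Lemma contIM a b f g : contI a b f -> contI a b g -> contI a b (fun y => f y * g y).
Proof. by move=> cf cg y yab; apply: continuousM; [exact: cf|exact: cg]. Qed.

Lemma eq_Int a b f g : (forall y, a <= y <= b -> f y = g y) -> Int a b f = Int a b g.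
Proof. by move=> fg; apply: eq_Rintegral => y; rewrite inE/= in_itv/=; exact: fg. Qed.

Lemma IntD a b f g : contI a b f -> contI a b g ->
  Int a b (fun y => f y + g y) = Int a b f + Int a b g.
Proof.
by move=> /contI_integrable fi /contI_integrable gi; apply: RintegralD => //.
Qed.

Lemma IntZ a b c f : contI a b f -> Int a b (fun y => c * f y) = c * Int a b f.
Proof. by move=> /contI_integrable fi; apply: RintegralZl. Qed.

Lemma IntN a b f : contI a b f -> Int a b (fun y => - f y) = - Int a b f.
Proof.
move=> cf; rewrite -[RHS]mulN1r -IntZ//; apply: eq_Int => y _; by rewrite mulN1r.
Qed.

Lemma IntB a b f g : contI a b f -> contI a b g ->
  Int a b (fun y => f y - g y) = Int a b f - Int a b g.
Proof. by move=> cf cg; rewrite IntD ?IntN//; exact: contIN. Qed.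

Lemma Int_ge0 a b f : (forall y, a <= y <= b -> 0 <= f y) -> 0 <= Int a b f.
Proof. by move=> f0; apply: Rintegral_ge0 => y; rewrite /= in_itv/=; exact: f0. Qed.

Lemma Int_le a b f g : contI a b f -> contI a b g ->
  (forall y, a <= y <= b -> f y <= g y) -> Int a b f <= Int a b g.
Proof.
move=> cf cg fg; rewrite -subr_ge0 -IntB//; apply: Int_ge0 => y yab.
by rewrite subr_ge0; exact: fg.
Qed.

Lemma Int_subset a b c d f : contI a b f -> a <= c -> d <= b ->
  (forall y, a <= y <= b -> 0 <= f y) -> Int c d f <= Int a b f.
Proof.
move=> cf ac db f0; have sub : `[c, d] `<=` `[a, b].
  by move=> y; rewrite /= !in_itv/= => /andP[cy yd]; rewrite (le_trans ac) ?(le_trans yd).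
have fi := contI_integrable cf.
have fi' : mu.-integrable `[c, d] (EFin \o f) by apply: integrableS fi.
rewrite /Int /Rintegral fine_le//.
- exact: integrable_fin_num.
- exact: integrable_fin_num.
- apply: ge0_subset_integral => //; last first.
    by case/integrableP : fi.
Qed.

Lemma Int_FTC a b f F : a <= b -> contI a b f ->
  (forall y, a <= y <= b -> der F y (f y)) -> Int a b f = F b - F a.
Proof.
rewrite le_eqVlt => /predU1P[<- _ _|ab cf dF].
  by rewrite /Int set_itv1 Rintegral_set1 subrr.
rewrite /Int /Rintegral (@continuous_FTC2 _ f F)//.
- exact: contI_within.
- have ca : {for a, continuous F} by apply: der_continuous (dF _ _); rewrite lexx ltW.
  have cb : {for b, continuous F} by apply: der_continuous (dF _ _); rewrite lexx ltW.
  split.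
  + move=> y; rewrite in_itv/= => /andP[/ltW ay /ltW yb].
    by apply: der_derivable; apply: dF; rewrite ay.
  + exact: cvg_at_right_filter.
  + exact: cvg_at_left_filter.
- move=> y; rewrite in_itv/= => /andP[/ltW ay /ltW yb].
  by apply: der_derive1; apply: dF; rewrite ay.
Qed.

Lemma Int_cst a b c : a <= b -> Int a b (fun=> c) = c * (b - a).
Proof.
move=> ab; rewrite (@Int_FTC _ _ _ (fun y => c * y)) ?mulrBr//; first exact: contIC.
by move=> y _; der_auto; ring.
Qed.

(** A constant serves as dominating function: between the midpoints [u'] and [v'], joint continuity
    bounds [g'] on a compact rectangle. *)
Lemma der_Int a b (g g' : R -> R -> R) u v x : u < x < v ->
  (forall z y, u < z < v -> a <= y <= b -> der (g ^~ y) z (g' z y)) ->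
  (forall z, u < z < v -> contI a b (g z)) ->
  (forall z y, u < z < v -> a <= y <= b -> cont2 g' z y) ->
  der (fun z => Int a b (g z)) x (Int a b (g' x)).
Proof.
move=> /andP[ux xv] dg cg cg'.
pose u' := (u + x) / 2; pose v' := (x + v) / 2.
have uu' : u < u' by rewrite /u'; lra.
have u'x : u' < x by rewrite /u'; lra.
have xv' : x < v' by rewrite /v'; lra.
have v'v : v' < v by rewrite /v'; lra.
have uv z : u' <= z <= v' -> u < z < v.
  by move=> /andP[u'z zv']; rewrite (lt_le_trans uu') ?(le_lt_trans zv').
have [M M0 HM] := @rect_bound _ g' u' v' a b (fun z y zuv yab => cg' z y (uv _ zuv) yab).
have Ix : `]u', v'[%classic x by rewrite /= in_itv/= u'x.
have Iuv z : `]u', v'[%classic z -> u < z < v.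
  by rewrite /= in_itv/= => /andP[/ltW ? /ltW ?]; apply: uv; apply/andP.
have intf z : `]u', v'[%classic z -> mu.-integrable `[a, b] (EFin \o g z).
  by move=> /Iuv zuv; apply: contI_integrable; exact: cg.
have drv z y : `]u', v'[%classic z -> `[a, b]%classic y -> derivable (g ^~ y) z 1.
  by move=> /Iuv zuv; rewrite /= in_itv/= => yab; apply: der_derivable (dg _ _ zuv yab).
have ig : mu.-integrable `[a, b] (EFin \o (fun=> M)) by apply: contI_integrable; exact: contIC.
have ub z y : `]u', v'[%classic z -> `[a, b]%classic y -> `|partial1of2 g z y| <= M.
  move=> zI; have zuv := Iuv _ zI; rewrite /= in_itv/= => yab.
  rewrite /partial1of2 (der_derive1 (dg _ _ zuv yab)); apply: HM => //.
  by move: zI; rewrite /= in_itv/= => /andP[/ltW -> /ltW ->].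
have D1 : derivable (fun z => Int a b (g z)) x 1.
  by apply: (derivable_under_integral _ Ix intf drv (fun=> ltW M0) ig ub); exact: measurable_itv.
have D2 : (fun z => Int a b (g z))^`() x = (\int[mu]_(y in `[a, b]) partial1of2 g x y)%R.
  by apply: (differentiation_under_integral _ Ix intf drv (fun=> ltW M0) ig ub); exact: measurable_itv.
split => //; rewrite -derive1E D2 /Int; apply: eq_Rintegral => y; rewrite inE/= in_itv/= => yab.
by rewrite /partial1of2 (der_derive1 (dg _ _ _ yab))// ux.
Qed.

Lemma Int_opp a b f : a <= b -> contI (- b) (- a) f ->
  Int (- b) (- a) f = Int a b (fun y => f (- y)).
Proof.
by move=> ab cf; rewrite /Int /Rintegral integration_by_substitution_oppr//; exact: contI_within.
Qed.

Lemma Int_split a b c f : a <= b <= c -> contI a c f -> Int a c f = Int a b f + Int b c f.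
Proof.
move=> /andP[ab bc] cf; rewrite /Int; have fi := contI_integrable cf.
have H := @Rintegral_itvB R f (BLeft a) (BRight c) b fi.
rewrite -(Rintegral_itv_obnd_cbnd (r := b)).
  by rewrite -H ?bnd_simp//; lra.
apply: integrableS fi => //; apply: subset_itvr; by rewrite bnd_simp.
Qed.

Lemma Int_even Y f : 0 <= Y -> contI (- Y) Y f -> (forall y, f (- y) = f y) ->
  Int (- Y) Y f = 2 * Int 0 Y f.
Proof.
move=> Y0 cf ef; rewrite (@Int_split _ 0)//; last by rewrite Y0 oppr_le0 Y0.
have := @Int_opp 0 Y f Y0; rewrite oppr0 => ->.
  by rewrite (@eq_Int _ _ _ f) ?mulr2n ?mulrDl ?mul1r.
by move=> y /andP[? ?]; apply: cf; apply/andP; split=> //; exact: le_trans Y0.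
Qed.

End SegmentIntegral.

(** * Laplace transform of the fractional part of [expR v] *)

Section LaplaceTransform.
Context {R : realType}.
Implicit Types (s t th v x : R) (k : nat).
Local Notation mu := (@lebesgue_measure R).

(** With [u = expR v], the classical integral of the fractional part of [u] against [u ^ (- s - 1)]
    over [u >= 1] becomes a Laplace transform, whose derivatives in [s] merely insert powers of
    [v]. *)
Definition fracexp v : R := expR v - (Num.floor (expR v))%:~R.

Lemma fracexp_ge0 v : 0 <= fracexp v.
Proof. by rewrite subr_ge0 floor_le_tmp. Qed.

Lemma fracexp_le1 v : fracexp v <= 1.
Proof.
have := floorD1_gt (expR v).
by rewrite /fracexp intrD => H; rewrite lerBlDr addrC ltW.
Qed.

Lemma measurable_fracexp (D : set R) : measurable D -> measurable_fun D fracexp.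
Proof.
move=> mD; apply: measurable_funB.
  apply: measurable_funTS; exact: measurable_expR.
apply: nondecreasing_measurable => // x y xy.
by rewrite ler_int; apply: le_floor; rewrite ler_expR.
Qed.

(** The phase makes one real kernel serve for both parts of the complex exponential: [th = 0] gives
    the cosine, [th = pi / 2] the sine, and differentiation in [t] shifts [th] by [- pi / 2]. *)
Definition lapker k th s t v := fracexp v * v ^+ k * expR (- (s * v)) * cos (t * v - th).

Definition lap k th s t : R := (\int[mu]_(v in `[0, +oo[) lapker k th s t v)%R.

Lemma measurable_lapker k th s t (D : set R) : measurable D ->
  measurable_fun D (lapker k th s t).
Proof.
move=> mD; apply: measurable_funM; [apply: measurable_funM; [apply: measurable_funM|]|].
- exact: measurable_fracexp.
- exact: measurable_funX.
- apply: (measurableT_comp (@measurable_expR R)); apply: measurable_funN.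
  by apply: measurable_funM.
- apply: continuous_measurable_fun_comp_cos || apply: (measurable_funTS (D := D)).
  apply: continuous_measurable_fun => v.
  by apply: (@der_continuous _ _ _ (t * - sin (t * v - th))); der_auto; [..|ring].
Qed.

Lemma exp_decay_integral s : 0 < s ->
  (\int[mu]_(v in `[0%R, +oo[) (expR (- (s * v)))%:E = (s^-1)%:E)%E.
Proof.
move=> s0; rewrite (@ge0_continuous_FTC2y _ _ (fun v => - (s^-1) * expR (- (s * v))) _ 0).
- by rewrite mulr0 oppr0 expR0 mulr1 sub0e EFinN oppeK.
- by move=> *; exact: expR_ge0.
- apply: continuous_subspaceT => v.
  by apply: (@der_continuous _ _ _ (- s * expR (- (s * v)))); der_auto; ring.
- rewrite -[X in _ --> X](mulr0 (- s^-1)); apply: cvgM; first exact: cvg_cst.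
  apply: (cvg_comp (G := +oo%R) (fun v => s * v) (fun x => expR (- x))).
    by apply: gt0_cvgMry => //; exact: cvg_id.
  exact: cvgr_expR.
- move=> v _; apply: der_derivable; apply: (der_eq (l := expR (- (s * v)))); last by [].
  by der_auto; field; lra.
- apply: cvg_at_right_filter.
  apply: (@der_continuous _ (fun v => - (s^-1) * expR (- (s * v))) 0 (expR (- (s * 0)))).
  by der_auto; field; lra.
- move=> v _; apply: der_derive1; by der_auto; field; lra.
Qed.

Lemma exp_decay_integrable s : 0 < s ->
  mu.-integrable `[0, +oo[ (EFin \o (fun v => expR (- (s * v)))).
Proof.
move=> s0; apply/integrableP; split.
  apply/measurable_EFinP; apply: (measurableT_comp (@measurable_expR R)).
  by apply: measurable_funN; apply: measurable_funM.
under eq_integral => v _ do rewrite /= ger0_norm ?expR_ge0//.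
by rewrite exp_decay_integral// ltry.
Qed.

Lemma expX_le k x : 0 <= x -> x ^+ k <= k`!%:R * expR x.
Proof.
move=> x0; case: k => [|k]; first by rewrite expr0 fact0 mul1r; have := expR_ge1Dx x; lra.
have := expR_ge1Dxn k x0.
have f0 : 0 < (k.+1)`!%:R :> R by rewrite ltr0n fact_gt0.
move=> H; rewrite mulrC -ler_pdivrMr//; apply: le_trans H; by rewrite lerDr ler01.
Qed.

(** Half of the exponential decay pays for [v ^+ k] through [expX_le]; the other half is left as a
    majorant uniform in the phase, in [t] and in [s >= s0]. *)
Lemma lapker_le k s0 : 0 < s0 -> exists2 C : R, 0 < C & forall th s t v,
  s0 <= s -> 0 <= v -> `|lapker k th s t v| <= C * expR (- (s0 / 2 * v)).
Proof.
move=> s0p; exists (k`!%:R * (2 / s0) ^+ k).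
  by rewrite mulr_gt0 ?exprn_gt0 ?divr_gt0// ltr0n fact_gt0.
move=> th s t v ss v0; rewrite /lapker !normrM.
rewrite (ger0_norm (fracexp_ge0 _)) (ger0_norm (expR_ge0 _)) normrX (ger0_norm v0).
have h1 : v ^+ k <= k`!%:R * (2 / s0) ^+ k * expR (s0 / 2 * v).
  have := @expX_le k (s0 / 2 * v) _; rewrite exprMn => /(_ _)/wrap[|H].
    by rewrite mulr_ge0// ltW// divr_gt0.
  rewrite mulrAC; rewrite -[X in _ <= X * _]mulr1.
  have e : v ^+ k = (s0 / 2) ^+ k * v ^+ k * (2 / s0) ^+ k.
    rewrite mulrAC -exprMn (_ : s0 / 2 * (2 / s0) = 1) ?expr1n ?mul1r//; field; lra.
  by rewrite e mulr1 ler_wpM2r// exprn_ge0// ltW// divr_gt0.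
have h2 : expR (- (s * v)) <= expR (- (s0 * v)).
  by rewrite ler_expR lerN2 ler_wpM2r.
have h3 : expR (- (s0 / 2 * v)) = expR (s0 / 2 * v) * expR (- (s0 * v)).
  by rewrite -expRD; congr expR; field.
rewrite h3 mulrA.
apply: (@le_trans _ _ (1 * (k`!%:R * (2 / s0) ^+ k * expR (s0 / 2 * v)) * expR (- (s0 * v)) * 1)).
  apply: ler_pM => //; [by rewrite !mulr_ge0 ?exprn_ge0 ?expR_ge0 ?fracexp_ge0| |exact: cos_max].
  apply: ler_pM => //; [by rewrite mulr_ge0 ?exprn_ge0 ?fracexp_ge0|].
  by apply: ler_pM; rewrite ?exprn_ge0 ?fracexp_ge0 ?fracexp_le1.
by rewrite mul1r mulr1.
Qed.

Lemma lapker_integrable k th s t : 0 < s ->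
  mu.-integrable `[0, +oo[ (EFin \o lapker k th s t).
Proof.
move=> s0; have [C C0 HC] := lapker_le k s0.
have ig : mu.-integrable `[0, +oo[ (EFin \o (fun v => C * expR (- (s / 2 * v)))).
  have := @exp_decay_integrable (s / 2) _; rewrite divr_gt0// => /(_ isT) ie.
  rewrite (_ : _ \o _ = (fun v => C%:E * (EFin \o (fun v => expR (- (s / 2 * v)))) v)%E).
    exact: integrableZl.
  by apply/funext => v; rewrite /= EFinM.
apply: le_integrable ig => //.
  by apply/measurable_EFinP; exact: measurable_lapker.
move=> v; rewrite /= in_itv/= andbT lee_fin => v0.
by rewrite (le_trans (HC th s t v _ _))// ler_norm.
Qed.

Lemma lap_le k s0 : 0 < s0 -> exists2 C : R, 0 < C & forall th s t, s0 <= s -> `|lap k th s t| <= C.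
Proof.
move=> s0p; have [C C0 HC] := lapker_le k s0p.
have s2 : 0 < s0 / 2 by rewrite divr_gt0.
exists (C * (s0 / 2)^-1); first by rewrite mulr_gt0// invr_gt0.
move=> th s t ss; have sp : 0 < s by lra.
have ki := lapker_integrable k th t sp.
have ei := exp_decay_integrable s2.
rewrite /lap (le_trans (le_normr_Rintegral _ ki))//.
have -> : C * (s0 / 2)^-1 = (\int[mu]_(v in `[0, +oo[) (C * expR (- (s0 / 2 * v))))%R.
  by rewrite RintegralZl// /Rintegral exp_decay_integral.
apply: le_Rintegral => //.
- exact: integrable_norm ki.
- rewrite (_ : _ \o _ = (fun v => C%:E * (EFin \o (fun v => expR (- (s0 / 2 * v)))) v)%E).
    exact: integrableZl.
  by apply/funext => v; rewrite /= EFinM.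
- by move=> v; rewrite /= in_itv/= andbT => v0; exact: HC.
Qed.

Lemma lap0_bounds s : 0 < s -> 0 <= lap 0 0 s 0 <= s^-1.
Proof.
move=> s0; have ki := lapker_integrable 0 0 0 s0; have ei := exp_decay_integrable s0.
have e v : lapker 0 0 s 0 v = fracexp v * expR (- (s * v)).
  by rewrite /lapker expr0 mulr1 mul0r subrr cos0 mulr1.
apply/andP; split.
  by apply: Rintegral_ge0 => v _; rewrite e mulr_ge0 ?expR_ge0 ?fracexp_ge0.
have -> : s^-1 = (\int[mu]_(v in `[0, +oo[) expR (- (s * v)))%R.
  by rewrite /Rintegral exp_decay_integral.
apply: le_Rintegral => // v _; rewrite e -[leRHS]mul1r.
by rewrite ler_wpM2r ?expR_ge0 ?fracexp_le1.
Qed.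

Lemma lapBpi k th s t : 0 < s -> lap k (th - pi) s t = - lap k th s t.
Proof.
move=> s0; rewrite /lap -[RHS]mulN1r -RintegralZl//; last exact: lapker_integrable.
apply: eq_Rintegral => v _; rewrite /lapker (_ : t * v - (th - pi) = t * v - th + pi); last by ring.
by rewrite cosDpi; ring.
Qed.

(** Stated along a curve [(s z, t z)], so that it applies to both coordinate directions of the
    strip. Continuity of [s'] and [t'] at the point bounds them nearby, which yields an integrable
    majorant. *)
Lemma der_lap k th (s s' t t' : R -> R) x :
  (forall z, der s z (s' z)) -> (forall z, der t z (t' z)) ->
  {for x, continuous s'} -> {for x, continuous t'} -> 0 < s x ->
  der (fun z => lap k th (s z) (t z)) x
      (- s' x * lap k.+1 th (s x) (t x) + t' x * lap k.+1 (th - pi / 2) (s x) (t x)).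
Proof.
move=> ds dt cs' ct' sx0.
pose M1 := `|s' x| + 1; pose M2 := `|t' x| + 1; pose s0 := s x / 2.
have s00 : 0 < s0 by rewrite divr_gt0.
have : \forall z \near x, s0 <= s z /\ `|s' z| <= M1 /\ `|t' z| <= M2.
  have cs := der_continuous (ds x).
  near=> z; split; [|split].
  - apply: ltW; near: z; apply: (cvgr_gt (s x)) => //; rewrite /s0; lra.
  - apply: ltW; near: z; apply: (cvgr_lt `|s' x|); [exact: cvg_norm cs'|rewrite /M1; lra].
  - apply: ltW; near: z; apply: (cvgr_lt `|t' x|); [exact: cvg_norm ct'|rewrite /M2; lra].
move=> /nbhs_ballP[e /= e0 He].
have Ix : `]x - e, x + e[%classic x by rewrite /= in_itv/=; lra.
have IH (z : R) : `]x - e, x + e[%classic z -> s0 <= s z /\ `|s' z| <= M1 /\ `|t' z| <= M2.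
  by rewrite /= in_itv/= => H; apply: He; rewrite /ball/= ltr_norml; lra.
pose f z v := lapker k th (s z) (t z) v.
pose f' z v := - s' z * lapker k.+1 th (s z) (t z) v + t' z * lapker k.+1 (th - pi / 2) (s z) (t z) v.
have df z v : der (f ^~ v) z (f' z v).
  have dsz := ds z; have dtz := dt z.
  rewrite /f /lapker; der_auto.
  rewrite /f' /lapker (_ : t z * v - (th - pi / 2) = t z * v - th + pi / 2); last by ring.
  by rewrite cosDpihalf exprS; ring.
have intf (z : R) : `]x - e, x + e[%classic z -> mu.-integrable `[0, +oo[ (EFin \o f z).
  by move=> /IH[s0z _]; apply: lapker_integrable; lra.
have drv (z v : R) : `]x - e, x + e[%classic z -> `[0, +oo[%classic v -> derivable (f ^~ v) z 1.
  by move=> _ _; apply: der_derivable (df z v).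
have [C C0 HC] := lapker_le k.+1 s00.
have ei := exp_decay_integrable (divr_gt0 s00 (ltr0Sn R 1)).
pose G v := (M1 + M2) * C * expR (- (s0 / 2 * v)).
have MC : 0 <= (M1 + M2) * C by rewrite mulr_ge0 ?ltW// ltr_wpDl// /M1 /M2 ?addr_ge0// ltr_wpDl.
have G0 v : 0 <= G v by rewrite /G mulr_ge0 ?expR_ge0.
have iG : mu.-integrable `[0, +oo[ (EFin \o G).
  rewrite (_ : _ \o _ = (fun v => ((M1 + M2) * C)%:E * (EFin \o (fun v => expR (- (s0 / 2 * v)))) v)%E).
    exact: integrableZl.
  by apply/funext => v; rewrite /= EFinM.
have ub (z v : R) : `]x - e, x + e[%classic z -> `[0, +oo[%classic v -> `|partial1of2 f z v| <= G v.
  move=> /IH[s0z [h1 h2]]; rewrite /= in_itv/= andbT => v0.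
  rewrite /partial1of2 (der_derive1 (df z v)) /f' /G (le_trans (ler_normD _ _))//.
  rewrite !normrM normrN -[leRHS]mulrA [leRHS]mulrDl lerD// ler_pM// -?normrM; exact: HC.
have D1 : derivable (fun z => lap k th (s z) (t z)) x 1.
  by apply: (derivable_under_integral _ Ix intf drv G0 iG ub); exact: measurable_itv.
have D2 : (fun z => lap k th (s z) (t z))^`() x = (\int[mu]_(v in `[0, +oo[) partial1of2 f x v)%R.
  by apply: (differentiation_under_integral _ Ix intf drv G0 iG ub); exact: measurable_itv.
split => //; rewrite -derive1E D2.
have ik th' := lapker_integrable k.+1 th' (t x) sx0.
rewrite /lap -!RintegralZl// -RintegralD//.
- by apply: eq_Rintegral => v _; rewrite /partial1of2 (der_derive1 (df x v)).
- rewrite (_ : _ \o _ = (fun v => (- s' x)%:E * (EFin \o lapker k.+1 th (s x) (t x)) v)%E).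
    exact: integrableZl.
  by apply/funext => v; rewrite /= EFinM.
- rewrite (_ : _ \o _ = (fun v => (t' x)%:E * (EFin \o lapker k.+1 (th - pi / 2) (s x) (t x)) v)%E).
    exact: integrableZl.
  by apply/funext => v; rewrite /= EFinM.
Unshelve. all: end_near. Qed.

(** The segment from [(s, t)] to [(s2, t2)] stays in the half-plane where [lap_le] bounds both
    partial derivatives uniformly; joint continuity of [lap] follows. *)
Lemma lap_lipschitz k th s0 : 0 < s0 -> exists2 C : R, 0 < C &
  forall s t s2 t2, s0 <= s -> s0 <= s2 ->
  `|lap k th s2 t2 - lap k th s t| <= C * (`|s2 - s| + `|t2 - t|).
Proof.
move=> s0p; have [C C0 HC] := lap_le k.+1 s0p; exists C => // s t s2 t2 hs hs2.
pose S z := s + z * (s2 - s); pose T z := t + z * (t2 - t).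
have dS z : der S z (s2 - s) by rewrite /S; der_auto; ring.
have dT z : der T z (t2 - t) by rewrite /T; der_auto; ring.
have S0 (z : R) : 0 <= z <= 1 -> s0 <= S z.
  by move=> /andP[z0 z1]; rewrite /S; nra.
have := @der_lipschitz _ (fun z => lap k th (S z) (T z))
  (fun z => - (s2 - s) * lap k.+1 th (S z) (T z) + (t2 - t) * lap k.+1 (th - pi / 2) (S z) (T z))
  0 1 (C * (`|s2 - s| + `|t2 - t|)).
rewrite (_ : S 1 = s2) 1?(_ : T 1 = t2) 1?(_ : S 0 = s) 1?(_ : T 0 = t) /S /T; try ring.
rewrite subr0 normr1 mulr1; apply.
rewrite minEle maxEle ler01 => z z01; split.
  apply: (@der_lap k th S (fun=> s2 - s) T (fun=> t2 - t) z) => //; try exact: cst_continuous.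
  by have := S0 z z01; lra.
apply: le_trans (ler_normD _ _) _; rewrite !normrM normrN [leRHS]mulrC [leRHS]mulrDl.
by apply: lerD; rewrite ler_wpM2l//; apply: HC; exact: S0.
Qed.

Lemma cont2_lap k th (s t : R -> R -> R) x y : cont2 s x y -> cont2 t x y -> 0 < s x y ->
  cont2 (fun x y => lap k th (s x y) (t x y)) x y.
Proof.
move=> cs ct s0; have [C C0 HC] := lap_lipschitz k th (divr_gt0 s0 (ltr0Sn R 1)).
rewrite /cont2 /prop_for /continuous_at/=; apply/cvgrPdist_le => /= e e0.
have e' : 0 < e / 2 / C by rewrite !divr_gt0.
near=> z; rewrite distrC.
apply: (@le_trans _ _ (C * (e / 2 / C + e / 2 / C))); last first.
  by rewrite le_eqVlt; apply/orP; left; apply/eqP; field; lra.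
apply: le_trans (HC _ _ _ _ _ _) _; [lra| |].
- apply: ltW; near: z; apply: (cvgr_gt (s x y)) => //; rewrite gtr_pMr//; lra.
- rewrite ler_pM2l// lerD//; rewrite distrC; near: z.
    by move/cvgrPdist_le : cs; exact.
  by move/cvgrPdist_le : ct; exact.
Unshelve. all: end_near. Qed.

End LaplaceTransform.

(** * The representation of [(s - 1) * zeta s] on [Re s > 0] *)

Section ZetaLaplace.
Context {R : realType}.
Implicit Types (s : cplx R) (th t v A B : R) (N : nat).
Local Notation mu := (@lebesgue_measure R).

Lemma sqrD_eq0 (a b : R) : a ^+ 2 + b ^+ 2 = 0 -> a = 0 /\ b = 0.
Proof.
by move/eqP; rewrite paddr_eq0 ?sqr_ge0// !sqrf_eq0 => /andP[/eqP -> /eqP ->].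
Qed.

Let caddA : associative (@Defs.cadd R).
Proof. by case=> ? ? [? ?] [? ?]; rewrite /Defs.cadd/=; congr Cplx; exact: addrA. Qed.

Let caddC : commutative (@Defs.cadd R).
Proof. by case=> ? ? [? ?]; rewrite /Defs.cadd/=; congr Cplx; exact: addrC. Qed.

Let cadd0 : left_id (Cplx 0 0) (@Defs.cadd R).
Proof. by case=> ? ?; rewrite /Defs.cadd/= !add0r. Qed.

HB.instance Definition _ := Monoid.isComLaw.Build (cplx R) (Cplx 0 0) (@Defs.cadd R)
  caddA caddC cadd0.

Definition claplace k s : cplx R :=
  Cplx (lap k 0 (re s) (im s)) (- lap k (pi / 2) (re s) (im s)).

(* [gfun s = (s - 1) * zeta s], see [zeta_gfun]. *)
Definition gfun s : cplx R :=
  csub s (cmul (cmul s (csub s (cone R))) (claplace 0 s)).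

Definition lap_trunc th s N : R :=
  (\int[mu]_(v in `[0%R, ln (N%:R : R)[) lapker 0 th (re s) (im s) v)%R.

Lemma lap_trunc1 th s : lap_trunc th s 1 = 0.
Proof. by rewrite /lap_trunc ln1 set_itv_ge ?Rintegral_set0// bnd_simp ltxx. Qed.

Lemma lapker_integrableS k th s (i : interval R) : 0 < re s -> [set` i] `<=` `[0, +oo[ ->
  mu.-integrable [set` i] (EFin \o lapker k th (re s) (im s)).
Proof.
by move=> s0 i0; apply: integrableS (lapker_integrable k th (im s) s0).
Qed.

(** The real part of [expR ((c + i t) v - i th) / (c + i t)]. *)
Let primitive (c : R) t th v := expR (c * v) * (c * cos (t * v - th) + t * sin (t * v - th))
  / (c ^+ 2 + t ^+ 2).

Let der_primitive c t th v : c ^+ 2 + t ^+ 2 != 0 ->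
  der (primitive c t th) v (expR (c * v) * cos (t * v - th)).
Proof. by move=> h; rewrite /primitive; der_auto; field. Qed.

Lemma floor_expR_ln N v : (0 < N)%N -> ln (N%:R : R) <= v < ln (N.+1%:R : R) ->
  Num.floor (expR v) = N%:Z.
Proof.
move=> N0 /andP[h1 h2]; apply: floor_def.
have n0 : 0 < N%:R :> R by rewrite ltr0n.
apply/andP; split.
  by move: h1; rewrite -ler_expR lnK ?posrE// => h1; rewrite pmulrn in h1.
by move: h2; rewrite -ltr_expR lnK ?posrE// intrD -pmulrn natr1.
Qed.

(** For [v] from [ln N] to [ln (N + 1)] the integer part of [expR v] is the constant [N], so the
    kernel splits into two elementary terms with exponents [1 - re s] and [- re s]. *)
Lemma lap_truncS th s N : (0 < N)%N -> 0 < re s -> ~ (re s = 1 /\ im s = 0) ->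
  lap_trunc th s N.+1 = lap_trunc th s N +
  (primitive (1 - re s) (im s) th (ln N.+1%:R) - N%:R * primitive (- re s) (im s) th (ln N.+1%:R)
   - (primitive (1 - re s) (im s) th (ln N%:R) - N%:R * primitive (- re s) (im s) th (ln N%:R))).
Proof.
move=> N0 s0 s1; have n0 : 0 < N%:R :> R by rewrite ltr0n.
have A0 : 0 <= ln (N%:R : R) by rewrite ln_ge0// ler1n.
have AB : ln (N%:R : R) <= ln (N.+1%:R : R) by rewrite ler_ln ?posrE ?ltr0n// ler_nat.
set A := ln _ in A0 AB *; set B := ln _ in AB *.
rewrite /lap_trunc (@itv_bndbnd_setU _ _ _ (BLeft A)) ?bnd_simp//.
rewrite Rintegral_setU//=; last 2 first.
- rewrite -itv_bndbnd_setU ?bnd_simp//; apply: lapker_integrableS => //.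
  by apply: subset_itvl; rewrite bnd_simp.
- apply/disj_set2P; rewrite -subset0 => v; rewrite /= !in_itv/= => -[/andP[_ h1] /andP[h2 _]].
  by move: h1; rewrite ltNge h2.
congr (_ + _).
pose h v := (expR v - N%:R) * expR (- (re s * v)) * cos (im s * v - th).
have ch : contI A B h.
  move=> v _; rewrite /h; apply: (@der_continuous _ _ _ _ _); der_auto; reflexivity.
transitivity (\int[mu]_(v in `[A, B[) h v)%R.
  apply: eq_Rintegral => v; rewrite inE/= in_itv/= => vAB.
  by rewrite /lapker /fracexp /h (floor_expR_ln N0)// expr0 mulr1.
rewrite Rintegral_itv_bndo_bndc; last first.
  apply: integrableS (contI_integrable ch) => //; apply: subset_itvl; by rewrite bnd_simp.
have d1 : (1 - re s) ^+ 2 + im s ^+ 2 != 0.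
  apply/eqP => /sqrD_eq0[]; lra.
have d2 : (- re s) ^+ 2 + im s ^+ 2 != 0.
  apply/eqP => /sqrD_eq0[]; lra.
rewrite -/(Int A B h) (@Int_FTC _ _ _ _ (fun v => primitive (1 - re s) (im s) th v
  - N%:R * primitive (- re s) (im s) th v))// => v _.
have e1 := @der_primitive _ (im s) th v d1; have e2 := @der_primitive _ (im s) th v d2.
der_auto; rewrite /h (mulNr (re s)) (_ : (1 - re s) * v = v + - (re s * v)); last by ring.
rewrite expRD; ring.
Qed.

(** Partial summation in exact form, by induction on [N]. At [N = 1] the truncated integral is empty
    and [1 - 1 / (1 - s) = s / (s - 1)]; each further term is matched by [lap_truncS]. *)
Lemma zeta_approx_lap s N : (0 < N)%N -> 0 < re s -> ~ (re s = 1 /\ im s = 0) ->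
  zeta_approx s N = csub (cdiv s (csub s (cone R)))
    (cmul s (Cplx (lap_trunc 0 s N) (- lap_trunc (pi / 2) s N))).
Proof.
move=> N0 s0 s1; case: s s0 s1 => σ t /= s0 s1.
have d1 : (σ - 1) ^+ 2 + t ^+ 2 != 0 by apply/eqP => /sqrD_eq0[]; lra.
have d2 : σ ^+ 2 + t ^+ 2 != 0 by apply/eqP => /sqrD_eq0[]; lra.
elim: N N0 => // -[_ _|N IH _].
  rewrite !lap_trunc1 /zeta_approx /index_iota/= big_cons big_nil /csub /cdiv /cmul /cinv /cpowr /Defs.cadd /Defs.copp /cone /cnorm2/=.
  rewrite ln1 !mulr0 cos0 sin0 !powR1 ?powR1r.
  have d3 : (1 - σ) ^+ 2 + (0 - t) ^+ 2 != 0 by rewrite -opprB sqrrN sub0r sqrrN.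
  have d4 : (σ - 1) ^+ 2 + (t - 0) ^+ 2 != 0 by rewrite subr0.
  congr Cplx; field; rewrite ?d3 ?d4//.
have {}IH := IH isT.
have n0 : 0 < N.+1%:R :> R by rewrite ltr0n.
have n1 : 0 < N.+2%:R :> R by rewrite ltr0n.
have st : zeta_approx (Cplx σ t) N.+2 = Defs.cadd (zeta_approx (Cplx σ t) N.+1)
   (csub (cpowr N.+2%:R (Defs.copp (Cplx σ t)))
     (cdiv (csub (cpowr N.+2%:R (csub (cone R) (Cplx σ t))) (cpowr N.+1%:R (csub (cone R) (Cplx σ t))))
       (csub (cone R) (Cplx σ t)))).
  rewrite /zeta_approx big_nat_recr//=; set S := \big[_/_]_(_ <= _ < _) _.
  rewrite /csub /cdiv /cmul /cinv /Defs.cadd/=; congr Cplx; ring.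
rewrite st IH !(@lap_truncS _ (Cplx σ t) N.+1)//.
set S1 := lap_trunc _ _ _; set S2 := lap_trunc _ _ _.
rewrite /primitive/= !subr0 !cosBpihalf !sinBpihalf.
rewrite /cpowr /csub /Defs.cadd /cdiv /cmul /cinv /Defs.copp /cone /cnorm2/=.
rewrite /powR !gt_eqF//.
rewrite !sub0r !mulNr !cosN !sinN.
set A := ln N.+1%:R; set B := ln N.+2%:R.
have eA : expR ((1 - σ) * A) = N.+1%:R * expR (- (σ * A)).
  by rewrite mulrBl mul1r expRD /A lnK ?posrE.
have eB : expR ((1 - σ) * B) = (N.+1%:R + 1) * expR (- (σ * B)).
  by rewrite mulrBl mul1r expRD /B lnK ?posrE// -natr1.
rewrite eA eB.
have d3 : (1 - σ) ^+ 2 + (- t) ^+ 2 != 0 by rewrite -opprB !sqrrN.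
have d4 : (1 - σ) ^+ 2 + t ^+ 2 != 0 by rewrite -opprB !sqrrN.
have d5 : (- σ) ^+ 2 + t ^+ 2 != 0 by rewrite !sqrrN.
have d6 : (σ - 1) ^+ 2 + (t - 0) ^+ 2 != 0 by rewrite subr0.
congr Cplx; field; rewrite ?d1 ?d2 ?d3 ?d4 ?d5 ?d6//.
Qed.

Lemma cvg_ln_natr : ln (N%:R : R) @[N --> \oo] --> +oo.
Proof.
apply/cvgryPge => A; near=> N.
have N0 : 0 < N%:R :> R by near: N; exact: nbhs_infty_gtr.
rewrite -ler_expR lnK ?posrE//; near: N; exact: nbhs_infty_ger.
Unshelve. all: end_near. Qed.

Lemma cvg_lap_trunc th s : 0 < re s -> lap_trunc th s N @[N --> \oo] --> lap 0 th (re s) (im s).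
Proof.
move=> s0; apply/cvgrPdist_le => e e0.
have c0 : 0 < re s / 2 by rewrite divr_gt0.
have ce : 0 < e * (re s / 2) by rewrite mulr_gt0.
near=> N.
have A0 : 0 <= ln (N%:R : R).
  by rewrite ln_ge0//; near: N; exact: nbhs_infty_ger.
have Ae : expR (- (re s / 2 * ln (N%:R : R))) <= e * (re s / 2).
  rewrite -[leRHS]lnK ?posrE// ler_expR lerNl -ler_pdivrMl//.
  near: N; move/cvgryPge : cvg_ln_natr; exact.
set A := ln (N%:R : R) in A0 Ae *.
have ki := lapker_integrable 0 th (im s) s0.
have e2i := exp_decay_integrable c0.
have sub : `[A, +oo[ `<=` `[0, +oo[ by apply: subset_itvr; rewrite bnd_simp.
have kiA : mu.-integrable `[A, +oo[ (EFin \o lapker 0 th (re s) (im s)).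
  exact: lapker_integrableS.
have e2iA : mu.-integrable `[A, +oo[ (EFin \o (fun v => expR (- (re s / 2 * v)))).
  exact: integrableS e2i.
rewrite /lap /lap_trunc (@itv_bndbnd_setU _ _ (BLeft 0) (BLeft A)) ?bnd_simp//.
rewrite Rintegral_setU//=; last 2 first.
- by rewrite -itv_bndbnd_setU ?bnd_simp//; exact: lapker_integrableS.
- apply/disj_set2P; rewrite -subset0 => v; rewrite /= !in_itv/= andbT => -[/andP[_ h1] h2].
  by move: h1; rewrite ltNge h2.
rewrite addrAC subrr add0r.
apply: le_trans (le_normr_Rintegral _ kiA) _ => //.
(* Beyond [A] one half of the decay is already small; the other half is integrated. *)
apply: (@le_trans _ _ (\int[mu]_(v in `[A, +oo[) (expR (- (re s / 2 * A)) * expR (- (re s / 2 * v))))%R).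
  apply: le_Rintegral => //.
  - exact: integrable_norm kiA.
  - rewrite (_ : _ \o _ = (fun v => (expR (- (re s / 2 * A)))%:E * (EFin \o (fun v => expR (- (re s / 2 * v)))) v)%E).
      exact: integrableZl.
    by apply/funext => v; rewrite /= EFinM.
  - move=> v; rewrite /= in_itv/= andbT => Av.
    rewrite /lapker expr0 mulr1 !normrM (ger0_norm (expR_ge0 _)) (ger0_norm (fracexp_ge0 _)).
    rewrite -[leRHS]mulr1 -[leRHS]mul1r mulrA; apply: ler_pM => //.
    + by rewrite mulr_ge0 ?fracexp_ge0 ?expR_ge0.
    + apply: ler_pM; rewrite ?fracexp_ge0 ?expR_ge0 ?fracexp_le1// -expRD ler_expR; nra.
    + exact: cos_max.
rewrite RintegralZl//.
have : (\int[mu]_(v in `[A, +oo[) expR (- (re s / 2 * v)))%R <= (re s / 2)^-1.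
  have -> : (re s / 2)^-1 = (\int[mu]_(v in `[0, +oo[) expR (- (re s / 2 * v)))%R.
    by rewrite /Rintegral exp_decay_integral.
  rewrite /Rintegral fine_le//; try exact: integrable_fin_num.
  apply: ge0_subset_integral => //; last by case/integrableP : e2i.
move=> h; apply: le_trans (ler_pM (expR_ge0 _) _ Ae h) _.
  by apply: Rintegral_ge0 => v _; exact: expR_ge0.
by rewrite -mulrA mulfV ?mulr1// gt_eqF.
Unshelve. all: end_near. Qed.

(** The limit of [zeta_approx_lap], multiplied by [s - 1]. The right-hand side is regular at
    [s = 1], so [gfun] extends the product across the pole. *)
Lemma zeta_gfun s : 0 < re s -> ~ (re s = 1 /\ im s = 0) ->
  cmul (zeta s) (csub s (cone R)) = gfun s.
Proof.
move=> s0 s1.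
have d : (re s - 1) ^+ 2 + im s ^+ 2 != 0 by apply/eqP => /sqrD_eq0[]; lra.
have c1 := @cvg_lap_trunc 0 s s0; have c2 := @cvg_lap_trunc (pi / 2) s s0.
pose q := cdiv s (csub s (cone R)).
have -> : zeta s = csub q (cmul s (claplace 0 s)).
  rewrite /zeta; congr Cplx; apply: cvg_lim => //.
  - have H : (fun N => re q - (re s * lap_trunc 0 s N - im s * - lap_trunc (pi / 2) s N)) @ \oo
        --> re q - (re s * lap 0 0 (re s) (im s) - im s * - lap 0 (pi / 2) (re s) (im s)).
      apply: cvgB; first exact: cvg_cst.
      by apply: cvgB; apply: cvgM => //; [exact: cvg_cst|exact: cvg_cst|exact: cvgN].
    apply: cvg_trans H; apply: near_eq_cvg; near=> N.
    rewrite zeta_approx_lap//; near: N; exact: nbhs_infty_gt.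
  - have H : (fun N => im q - (re s * - lap_trunc (pi / 2) s N + im s * lap_trunc 0 s N)) @ \oo
        --> im q - (re s * - lap 0 (pi / 2) (re s) (im s) + im s * lap 0 0 (re s) (im s)).
      apply: cvgB; first exact: cvg_cst.
      by apply: cvgD; apply: cvgM => //; [exact: cvg_cst|exact: cvgN|exact: cvg_cst].
    apply: cvg_trans H; apply: near_eq_cvg; near=> N.
    rewrite zeta_approx_lap//; near: N; exact: nbhs_infty_gt.
rewrite /gfun /q; case: s {s0 s1 c1 c2 q} d => σ t /= d.
set L := claplace _ _; have d6 : (σ - 1) ^+ 2 + (t - 0) ^+ 2 != 0 by rewrite subr0.
rewrite /csub /cdiv /cmul /cinv /cone /cnorm2/=; congr Cplx; field; rewrite ?d6 ?d//.
Unshelve. all: end_near. Qed.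

End ZetaLaplace.

(** * Hyperbolic functions *)

Section HyperbolicFunctions.
Context {R : realType}.
Implicit Types (x y c : R).

Definition ch y := (expR y + expR (- y)) / 2.
Definition sh y := (expR y - expR (- y)) / 2.

Lemma chE y : ch y ^+ 2 - sh y ^+ 2 = 1.
Proof.
have h : expR y * expR (- y) = 1 by rewrite -expRD subrr expR0.
have e (p q : R) : ((p + q) / 2) ^+ 2 - ((p - q) / 2) ^+ 2 = p * q by field.
by rewrite /ch /sh e.
Qed.

Lemma ch_gt0 y : 0 < ch y.
Proof. by rewrite /ch divr_gt0// addr_gt0// expR_gt0. Qed.

Lemma ch_ge1 y : 1 <= ch y.
Proof. have := chE y; have := ch_gt0 y; nra. Qed.

Lemma chN y : ch (- y) = ch y.
Proof. by rewrite /ch opprK addrC. Qed.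

Lemma shN y : sh (- y) = - sh y.
Proof. by rewrite /sh opprK; ring. Qed.

Lemma ch0 : ch 0 = 1.
Proof. by rewrite /ch oppr0 expR0; field. Qed.

Lemma sh0 : sh 0 = 0.
Proof. by rewrite /sh oppr0 expR0; field. Qed.

Lemma sh_le_ch y : `|sh y| <= ch y.
Proof. rewrite ler_norml; have := chE y; have := ch_gt0 y; nra. Qed.

Lemma ch_double y : ch (2 * y) = 2 * ch y ^+ 2 - 1.
Proof.
rewrite /ch; have h : expR y * expR (- y) = 1 by rewrite -expRD subrr expR0.
have e1 : expR (2 * y) = expR y ^+ 2 by rewrite expr2 -expRD; congr expR; ring.
have e2 : expR (- (2 * y)) = expR (- y) ^+ 2 by rewrite expr2 -expRD; congr expR; ring.
rewrite e1 e2; transitivity (2 * ((expR y + expR (- y)) / 2) ^+ 2 - expR y * expR (- y)).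
  by field.
by rewrite h.
Qed.

Lemma chD x y : ch (x + y) = ch x * ch y + sh x * sh y.
Proof. by rewrite /ch /sh opprD !expRD; field. Qed.

Lemma der_ch y : der ch y (sh y).
Proof. by rewrite /ch /sh; der_auto; field. Qed.

Lemma der_sh y : der sh y (ch y).
Proof. by rewrite /ch /sh; der_auto; field. Qed.

Lemma der_chcomp (f : R -> R) x l : der f x l -> der (fun x => ch (f x)) x (l * sh (f x)).
Proof. by move=> df; apply: der_comp df (der_ch _). Qed.

Lemma der_shcomp (f : R -> R) x l : der f x l -> der (fun x => sh (f x)) x (l * ch (f x)).
Proof. by move=> df; apply: der_comp df (der_sh _). Qed.

Lemma ch_homo x y : 0 <= x -> x <= y -> ch x <= ch y.
Proof.
move=> x0 xy; apply: (@der_homo _ ch sh) => // z /andP[xz _]; first exact: der_ch.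
by rewrite /sh divr_ge0// subr_ge0 ler_expR; lra.
Qed.

Lemma ch_norm y : ch `|y| = ch y.
Proof. by have [y0|y0] := ger0P y; rewrite ?chN. Qed.

Lemma ch_ge y : expR `|y| / 2 <= ch y.
Proof. by rewrite -ch_norm /ch ler_wpM2r// lerDl expR_ge0. Qed.

Lemma ch_le y : ch y <= expR `|y|.
Proof.
rewrite -ch_norm /ch; have : expR (- `|y|) <= expR `|y|.
  by rewrite ler_expR; have := normr_ge0 y; lra.
lra.
Qed.

Lemma lnch_ge0 y : 0 <= ln (ch y).
Proof. by rewrite ln_ge0// ch_ge1. Qed.

Lemma lnch_le y : ln (ch y) <= `|y|.
Proof. by rewrite -[leRHS]expRK ler_ln ?posrE ?expR_gt0 ?ch_gt0// ch_le. Qed.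

Lemma lnch_le_ch y : ln (ch y) <= ch y - 1.
Proof.
have := @le_ln1Dx R (ch y - 1); rewrite (_ : 1 + (ch y - 1) = ch y); last by ring.
by apply; have := ch_gt0 y; lra.
Qed.

Lemma ch_ln p : 0 < p -> ch (ln p) = (p + p^-1) / 2.
Proof. by move=> p0; rewrite /ch expRN lnK. Qed.

Lemma sh_ln p : 0 < p -> sh (ln p) = (p - p^-1) / 2.
Proof. by move=> p0; rewrite /sh expRN lnK. Qed.

Lemma chDsh y : ch y + sh y = expR y.
Proof. by rewrite /ch /sh; field. Qed.

End HyperbolicFunctions.

#[global] Opaque ch sh.

Ltac der_step ::= first
  [ eassumption | apply: derC | apply: der_id | apply: der_ch | apply: der_sh
  | match goal with
    | |- der (fun x => @?f x ^+ ?n) _ _ => eapply derX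
    | |- der (fun x => ch (@?f x)) _ _ => eapply der_chcomp
    | |- der (fun x => sh (@?f x)) _ _ => eapply der_shcomp
    | |- _ => fail
    end
  | eapply derD | eapply derN | eapply derM
  | eapply der_exp | eapply der_sin | eapply der_cos | eapply derV | eapply der_ln ].

(** * Cauchy-Riemann calculus for pairs of real functions *)

Section HolomorphicFunctions.
Context {R : realType}.
Implicit Types (f g : R -> R -> cplx R) (x y c : R).

(* [f1] is the complex derivative of [f] with respect to [x + iy]. *)
Definition holo f f1 x y :=
  [/\ der (fun x => re (f x y)) x (re (f1 x y)), der (fun x => im (f x y)) x (im (f1 x y)),
      der (fun y => re (f x y)) y (- im (f1 x y)) & der (fun y => im (f x y)) y (re (f1 x y))].

Definition ccont f x y := cont2 (fun x y => re (f x y)) x y /\ cont2 (fun x y => im (f x y)) x y.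

Lemma holo_eq f f1 f1' x y : f1 x y = f1' x y -> holo f f1 x y -> holo f f1' x y.
Proof. by rewrite /holo => ->. Qed.

Lemma holo_cst z x y : holo (fun _ _ => z) (fun _ _ => Cplx 0 0) x y.
Proof. by split; rewrite /= ?oppr0; exact: derC. Qed.

Lemma holo_sub f f1 g g1 x y : holo f f1 x y -> holo g g1 x y ->
  holo (fun x y => csub (f x y) (g x y)) (fun x y => csub (f1 x y) (g1 x y)) x y.
Proof.
by move=> [a1 a2 a3 a4] [b1 b2 b3 b4]; split; rewrite /csub/=; der_auto; ring.
Qed.

Lemma holo_mul f f1 g g1 x y : holo f f1 x y -> holo g g1 x y ->
  holo (fun x y => cmul (f x y) (g x y))
    (fun x y => Defs.cadd (cmul (f1 x y) (g x y)) (cmul (f x y) (g1 x y))) x y.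
Proof.
by move=> [a1 a2 a3 a4] [b1 b2 b3 b4]; split; rewrite /cmul /Defs.cadd/=; der_auto; ring.
Qed.

Lemma holo_lap k f f1 x y : (forall x y, holo f f1 x y) -> (forall x y, ccont f1 x y) ->
  0 < re (f x y) ->
  holo (fun x y => claplace k (f x y))
    (fun x y => cmul (Cplx (-1) 0) (cmul (claplace k.+1 (f x y)) (f1 x y))) x y.
Proof.
move=> hf cf f0.
have cx1 z : {for z, continuous (fun x => re (f1 x y))} by exact: cont2_secl (cf z y).1.
have cx2 z : {for z, continuous (fun x => im (f1 x y))} by exact: cont2_secl (cf z y).2.
have cy1 z : {for z, continuous (fun y => re (f1 x y))} by exact: cont2_secr (cf x z).1.
have cy2 z : {for z, continuous (fun y => - im (f1 x y))}.
  by apply: continuousN; exact: cont2_secr (cf x z).2.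
(* Differentiation moves the phases [0] and [pi / 2] of [claplace] to [- pi / 2] and [0]; the former
   is brought back by a shift of [pi], which changes the sign. *)
have lap0 : lap k.+1 (0 - pi / 2) (re (f x y)) (im (f x y)) =
    - lap k.+1 (pi / 2) (re (f x y)) (im (f x y)).
  by rewrite -lapBpi//; congr (lap _ _ _ _); field.
have lap1 : lap k.+1 (pi / 2 - pi / 2) (re (f x y)) (im (f x y)) =
    lap k.+1 0 (re (f x y)) (im (f x y)) by congr (lap _ _ _ _); field.
have Hx th := @der_lap R k th (fun x => re (f x y)) (fun x => re (f1 x y))
    (fun x => im (f x y)) (fun x => im (f1 x y)) x
    (fun z => let: And4 h _ _ _ := hf z y in h) (fun z => let: And4 _ h _ _ := hf z y in h)
    (cx1 x) (cx2 x) f0.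
have Hy th := @der_lap R k th (fun y => re (f x y)) (fun y => - im (f1 x y))
    (fun y => im (f x y)) (fun y => re (f1 x y)) y
    (fun z => let: And4 _ _ h _ := hf x z in h) (fun z => let: And4 _ _ _ h := hf x z in h)
    (cy2 y) (cy1 y) f0.
split; rewrite /claplace /cmul/=.
- by apply: der_eq (Hx 0) _; rewrite lap0; ring.
- by apply: der_eq (derN (Hx (pi / 2))) _; rewrite lap1; ring.
- by apply: der_eq (Hy 0) _; rewrite lap0; ring.
- by apply: der_eq (derN (Hy (pi / 2))) _; rewrite lap1; ring.
Qed.

Lemma ccont_sub f g x y : ccont f x y -> ccont g x y -> ccont (fun x y => csub (f x y) (g x y)) x y.
Proof.
by move=> [a1 a2] [b1 b2]; split; apply: cont2D => //; exact: cont2N.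
Qed.

Lemma ccont_add f g x y : ccont f x y -> ccont g x y ->
  ccont (fun x y => Defs.cadd (f x y) (g x y)) x y.
Proof. by move=> [a1 a2] [b1 b2]; split; apply: cont2D. Qed.

Lemma ccont_mul f g x y : ccont f x y -> ccont g x y -> ccont (fun x y => cmul (f x y) (g x y)) x y.
Proof.
by move=> [a1 a2] [b1 b2]; split; apply: cont2D; try apply: cont2N; exact: cont2M.
Qed.

Lemma ccont_cst z x y : ccont (fun _ _ => z) x y.
Proof. by split; exact: cont2C. Qed.

Lemma ccont_lap k f x y : ccont f x y -> 0 < re (f x y) -> ccont (fun x y => claplace k (f x y)) x y.
Proof.
by move=> [a1 a2] f0; split; [|apply: cont2N]; exact: cont2_lap.
Qed.

Lemma cnorm2M (z w : cplx R) : cnorm2 (cmul z w) = cnorm2 z * cnorm2 w.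
Proof. by rewrite /cnorm2 /cmul/=; ring. Qed.

Lemma cnorm2_ge0 (z : cplx R) : 0 <= cnorm2 z.
Proof. by rewrite addr_ge0// sqr_ge0. Qed.

Lemma cnorm2D (z w : cplx R) : cnorm2 (Defs.cadd z w) <= 2 * (cnorm2 z + cnorm2 w).
Proof.
rewrite /cnorm2 /Defs.cadd/=; have := sqr_ge0 (re z - re w); have := sqr_ge0 (im z - im w); lra.
Qed.

Lemma cnorm2B (z w : cplx R) : cnorm2 (csub z w) <= 2 * (cnorm2 z + cnorm2 w).
Proof.
rewrite /cnorm2 /csub/=; have := sqr_ge0 (re z + re w); have := sqr_ge0 (im z + im w); lra.
Qed.

Lemma claplace_le k s0 : 0 < s0 -> exists2 C : R, 0 < C & forall z : cplx R, s0 <= re z -> cnorm2 (claplace k z) <= C.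
Proof.
move=> s00; have [C C0 HC] := lap_le k s00; exists (2 * C ^+ 2); first by rewrite mulr_gt0// exprn_gt0.
move=> z hz; rewrite /cnorm2 /claplace/= sqrrN.
have h th : lap k th (re z) (im z) ^+ 2 <= C ^+ 2.
  by have := HC th _ (im z) hz; rewrite ler_norml => H; nra.
by have := h 0; have := h (pi / 2); lra.
Qed.

End HolomorphicFunctions.

(** * The function [(s - 1) * zeta s] in the coordinates of the strip *)

Section StripFunction.
Context {R : realType}.
Implicit Types (f g : R -> R -> cplx R) (x y : R).

(* The properties of [f x y = (s - 1) * zeta s], [s = 1 / 2 + alpha + a sin (x + iy)], on the strip
   [0 <= x <= pi / 2] that the argument uses; [x = 0] is the line [Re s = 1 / 2 + alpha] and
   [x = pi / 2] is the half-line [[1, +oo[] described twice. *)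
Record strip_fun (D : R -> R -> Prop) f f1 f2 : Prop := StripFun {
  sf_holo : forall x y, D x y -> holo f f1 x y;
  sf_holo1 : forall x y, D x y -> holo f1 f2 x y;
  sf_cont : forall x y, D x y -> ccont f x y;
  sf_cont1 : forall x y, D x y -> ccont f1 x y;
  sf_cont2 : forall x y, D x y -> ccont f2 x y;
  sf_dom : forall x y, 0 <= x <= pi -> D x y;
  sf_dom_left : forall Y, exists2 k : R, 0 < k & forall x y, - k <= x <= 0 -> `|y| <= Y -> D x y;
  sf_growth : exists2 C : R, 0 < C & forall x y, 0 <= x <= pi ->
    cnorm2 (f x y) <= C * ch y ^+ 6 /\ cnorm2 (f1 x y) <= C * ch y ^+ 6;
  sf_axis : forall y, im (f (pi / 2) y) = 0 /\ re (f1 (pi / 2) y) = 0;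
  sf_axis_bounds : forall y, 1 <= re (f (pi / 2) y) <= ch y;
  sf_even : forall x y, 0 <= x <= pi -> re (f x (- y)) = re (f x y) /\ im (f x (- y)) = - im (f x y) }.

Variable a : R.
Let b := 1 - a.

Definition strip_pt x y : cplx R := Cplx (b + a * sin x * ch y) (a * cos x * sh y).
Definition strip_pt1 x y : cplx R := Cplx (a * cos x * ch y) (- (a * sin x * sh y)).
Definition strip_pt2 x y : cplx R := Cplx (- (a * sin x * ch y)) (- (a * cos x * sh y)).

Lemma holo_strip_pt x y : holo strip_pt strip_pt1 x y.
Proof. by split; rewrite /strip_pt/=; der_auto; ring. Qed.

Lemma holo_strip_pt1 x y : holo strip_pt1 strip_pt2 x y.
Proof. by split; rewrite /strip_pt1/=; der_auto; ring. Qed.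

Let c_ch y : {for y, continuous (@ch R)}. Proof. exact: der_continuous (der_ch y). Qed.
Let c_sh y : {for y, continuous (@sh R)}. Proof. exact: der_continuous (der_sh y). Qed.
Let c_sin y : {for y, continuous (@sin R)}. Proof. exact: der_continuous (is_derive_sin y). Qed.
Let c_cos y : {for y, continuous (@cos R)}. Proof. exact: der_continuous (is_derive_cos y). Qed.

Lemma ccont_strip_pt x y : ccont strip_pt x y.
Proof.
split; rewrite /strip_pt/=; [apply: cont2D; first exact: cont2C|]; apply: cont2M.
- by apply: (cont2_fst (h := fun x => a * sin x)); apply: continuousM; [exact: cst_continuous|].
- exact: cont2_snd.
- by apply: (cont2_fst (h := fun x => a * cos x)); apply: continuousM; [exact: cst_continuous|].
- exact: cont2_snd.
Qed.

Lemma ccont_strip_pt1 x y : ccont strip_pt1 x y.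
Proof.
split; rewrite /strip_pt1/=; [|apply: cont2N]; apply: cont2M.
- by apply: (cont2_fst (h := fun x => a * cos x)); apply: continuousM; [exact: cst_continuous|].
- exact: cont2_snd.
- by apply: (cont2_fst (h := fun x => a * sin x)); apply: continuousM; [exact: cst_continuous|].
- exact: cont2_snd.
Qed.

Lemma ccont_strip_pt2 x y : ccont strip_pt2 x y.
Proof.
split; rewrite /strip_pt2/=; apply: cont2N; apply: cont2M.
- by apply: (cont2_fst (h := fun x => a * sin x)); apply: continuousM; [exact: cst_continuous|].
- exact: cont2_snd.
- by apply: (cont2_fst (h := fun x => a * cos x)); apply: continuousM; [exact: cst_continuous|].
- exact: cont2_snd.
Qed.

Definition zstrip x y : cplx R := gfun (strip_pt x y).

Local Notation S := strip_pt.
Local Notation S1 := strip_pt1.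
Local Notation S2 := strip_pt2.
Local Notation one := (cone R).
Local Notation cst c := (Cplx (c : R) 0).

(** The derivative of [gfun] in [s] at [strip_pt]; [gder2] is the second one. The chain rule turns
    them into [zstrip1] and [zstrip2]. *)
Let gder1 x y : cplx R := Defs.cadd
  (csub one (cmul (csub (cmul (cst 2) (S x y)) one) (claplace 0 (S x y))))
  (cmul (cmul (S x y) (csub (S x y) one)) (claplace 1 (S x y))).

Let gder2 x y : cplx R := csub
  (Defs.cadd (cmul (cst (-2)) (claplace 0 (S x y)))
    (cmul (cst 2) (cmul (csub (cmul (cst 2) (S x y)) one) (claplace 1 (S x y)))))
  (cmul (cmul (S x y) (csub (S x y) one)) (claplace 2 (S x y))).

Definition zstrip1 x y : cplx R := cmul (gder1 x y) (S1 x y).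
Definition zstrip2 x y : cplx R :=
  Defs.cadd (cmul (gder2 x y) (cmul (S1 x y) (S1 x y))) (cmul (gder1 x y) (S2 x y)).

Definition strip_dom x y : Prop := 0 < re (S x y).

Let hL k x y : strip_dom x y -> holo (fun x y => claplace k (S x y))
    (fun x y => cmul (Cplx (-1) 0) (cmul (claplace k.+1 (S x y)) (S1 x y))) x y.
Proof. exact: (@holo_lap R k S S1 x y holo_strip_pt ccont_strip_pt1). Qed.

Let hadd f f1 g g1 x y : holo f f1 x y -> holo g g1 x y ->
  holo (fun x y => Defs.cadd (f x y) (g x y)) (fun x y => Defs.cadd (f1 x y) (g1 x y)) x y.
Proof.
by move=> [a1 a2 a3 a4] [b1 b2 b3 b4]; split; rewrite /Defs.cadd/=; der_auto; ring.
Qed.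

Lemma holo_zstrip x y : strip_dom x y -> holo zstrip zstrip1 x y.
Proof.
move=> d; have hS := holo_strip_pt x y; have h1 := holo_cst one x y.
have := holo_sub hS (holo_mul (holo_mul hS (holo_sub hS h1)) (hL 0 d)).
apply: holo_eq; rewrite /zstrip1 /gder1.
move: (S x y) (S1 x y) => s s1; move: (claplace 0 s) (claplace 1 s) => l0 l1.
by rewrite /cmul /csub /Defs.cadd /cone/=; congr Cplx; ring.
Qed.

Lemma holo_zstrip1 x y : strip_dom x y -> holo zstrip1 zstrip2 x y.
Proof.
move=> d; have hS := holo_strip_pt x y; have h1 := holo_cst one x y.
have h2 := holo_cst (cst 2) x y.
have := holo_mul (hadd (holo_sub h1 (holo_mul (holo_sub (holo_mul h2 hS) h1) (hL 0 d)))
  (holo_mul (holo_mul hS (holo_sub hS h1)) (hL 1 d))) (holo_strip_pt1 x y).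
apply: holo_eq; rewrite /zstrip2 /gder1 /gder2.
move: (S x y) (S1 x y) (S2 x y) => s s1 s2.
move: (claplace 0 s) (claplace 1 s) (claplace 2 s) => l0 l1 l2.
by rewrite /cmul /csub /Defs.cadd /cone/=; congr Cplx; ring.
Qed.

Let cL k x y : strip_dom x y -> ccont (fun x y => claplace k (S x y)) x y.
Proof. by move=> d; apply: ccont_lap => //; exact: ccont_strip_pt. Qed.

Lemma ccont_zstrip x y : strip_dom x y -> ccont zstrip x y.
Proof.
move=> d; have hS := ccont_strip_pt x y.
by apply: ccont_sub => //; apply: ccont_mul; [|exact: cL]; apply: ccont_mul => //;
  apply: ccont_sub => //; exact: ccont_cst.
Qed.

Let c_gder1 x y : strip_dom x y -> ccont gder1 x y.
Proof.
move=> d; have hS := ccont_strip_pt x y; have h c := ccont_cst (cst c) x y; have h1 := ccont_cst one x y.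
apply: ccont_add; [apply: ccont_sub => //; apply: ccont_mul; last exact: cL|].
  by apply: ccont_sub => //; apply: ccont_mul.
by apply: ccont_mul; last exact: cL; apply: ccont_mul => //; apply: ccont_sub.
Qed.

Lemma ccont_zstrip1 x y : strip_dom x y -> ccont zstrip1 x y.
Proof. by move=> d; apply: ccont_mul; [exact: c_gder1|exact: ccont_strip_pt1]. Qed.

Lemma ccont_zstrip2 x y : strip_dom x y -> ccont zstrip2 x y.
Proof.
move=> d; have hS := ccont_strip_pt x y; have h c := ccont_cst (cst c) x y; have h1 := ccont_cst one x y.
have hS1 := ccont_strip_pt1 x y.
apply: ccont_add; last by apply: ccont_mul; [exact: c_gder1|exact: ccont_strip_pt2].
apply: ccont_mul; last exact: ccont_mul.
apply: ccont_sub; last by apply: ccont_mul; last exact: cL; apply: ccont_mul => //; exact: ccont_sub.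
apply: ccont_add; first by apply: ccont_mul; last exact: cL.
apply: ccont_mul => //; apply: ccont_mul; last exact: cL.
by apply: ccont_sub => //; exact: ccont_mul.
Qed.

Hypothesis a0 : 0 < a.
Hypothesis a1 : a <= 1 / 2.

Lemma strip_pt_ge x y : 0 <= x <= pi -> 1 / 2 <= re (S x y).
Proof.
move=> xpi; rewrite /S /= /b; have := sin_ge0_pi xpi; have := ch_gt0 y; have := a0; have := a1.
move=> h1 h2 h3 h4; have : 0 <= a * sin x * ch y by rewrite !mulr_ge0// ltW.
lra.
Qed.

(** To the left of the edge [re s] falls below [1 - a >= 1 / 2] by at most [a * ch Y * |x|], so the
    width [1 / (2 * ch Y)] keeps it positive. The width shrinks with [Y]: only bounded rectangles
    can extend beyond the edge. *)
Lemma strip_dom_left Y : exists2 k : R, 0 < k &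
  forall x y, - k <= x <= 0 -> `|y| <= Y -> strip_dom x y.
Proof.
exists ((2 * ch Y)^-1); first by rewrite invr_gt0 mulr_gt0// ch_gt0.
move=> x y xk yY; rewrite /strip_dom /S/= /b.
have cY : ch y <= ch Y by rewrite -ch_norm ch_homo.
have c0 := ch_gt0 y; have cY0 := ch_gt0 Y.
have sx : - sin x <= - x.
  have x0 : x <= 0 by case/andP : xk.
  have := @der_le _ (@sin R) (fun z => z) (@cos R) (fun=> 1) x 0 x0.
  rewrite sin0 sub0r sub0r; apply.
  - by move=> z _; exact: is_derive_sin.
  - by move=> z _; exact: der_id.
  - by move=> z _; exact: cos_le1.
have h3 : (2 * ch Y)^-1 * ch y <= 1 / 2.
  have c2 : 0 < 2 * ch Y by lra.
  rewrite ler_pdivrMl//; lra.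
have h4 : - (sin x * ch y) <= 1 / 2.
  rewrite -mulNr; apply: le_trans h3; rewrite ler_pM2r//; case/andP : xk; lra.
have := a0; have := a1 => h5 h6.
have : a * (- (sin x * ch y)) <= a * (1 / 2) by rewrite ler_pM2l.
nra.
Qed.

(** The exponent 6 is imposed by the derivative: that of [gfun] has squared modulus of order
    [ch y ^+ 4], and [strip_pt1] contributes another [ch y ^+ 2]. *)
Lemma zstrip_growth : exists2 C : R, 0 < C & forall x y, 0 <= x <= pi ->
  cnorm2 (zstrip x y) <= C * ch y ^+ 6 /\ cnorm2 (zstrip1 x y) <= C * ch y ^+ 6.
Proof.
have h2 : 0 < 1 / 2 :> R by lra.
have [C0 C00 H0] := claplace_le 0 h2; have [C1 C10 H1] := claplace_le 1 h2.
have := a0; have := a1 => ha1 ha0.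
have sS x y : 0 <= x <= pi -> cnorm2 (S x y) <= 2 * ch y ^+ 2.
  move=> xpi; have := ch_ge1 y; have := chE y; rewrite /cnorm2 /S /= /b.
  have s0 := sin_ge0_pi xpi; have s1 := sin_le1 x; have sc := cos2Dsin2 x.
  move=> h c1.
  have e1 : (1 - a + a * sin x * ch y) <= ch y.
    have p1 : 0 <= a * (1 - sin x) * ch y by rewrite !mulr_ge0//; lra.
    have p2 : 0 <= (1 - a) * (ch y - 1) by rewrite mulr_ge0//; lra.
    lra.
  have e2 : 0 <= (1 - a + a * sin x * ch y).
    by have : 0 <= a * sin x * ch y; [rewrite !mulr_ge0// ltW//; lra|lra].
  have e3 : (1 - a + a * sin x * ch y) ^+ 2 <= ch y ^+ 2 by nra.
  have e4 : (a * cos x * sh y) ^+ 2 <= ch y ^+ 2.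
    have f1 : a ^+ 2 * cos x ^+ 2 <= 1 by apply: mulr_ile1; rewrite ?sqr_ge0//; nra.
    have f2 : sh y ^+ 2 <= ch y ^+ 2 by lra.
    have -> : (a * cos x * sh y) ^+ 2 = a ^+ 2 * cos x ^+ 2 * sh y ^+ 2 by ring.
    by apply: (le_trans _ f2); apply: ler_piMl => //; exact: sqr_ge0.
  lra.
have sS1 x y : cnorm2 (S1 x y) <= 2 * ch y ^+ 2.
  have := ch_ge1 y; have := chE y; rewrite /cnorm2 /S1 /= sqrrN.
  have sc := cos2Dsin2 x => h c1.
  have e0 : a ^+ 2 <= 1 by nra.
  have -> : (a * cos x * ch y) ^+ 2 + (a * sin x * sh y) ^+ 2
    = a ^+ 2 * (cos x ^+ 2 * ch y ^+ 2 + sin x ^+ 2 * sh y ^+ 2) by ring.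
  have -> : cos x ^+ 2 * ch y ^+ 2 + sin x ^+ 2 * sh y ^+ 2
    = (cos x ^+ 2 + sin x ^+ 2) * ch y ^+ 2 - sin x ^+ 2 * (ch y ^+ 2 - sh y ^+ 2) by ring.
  rewrite sc h mul1r mulr1; have t0 : 0 <= ch y ^+ 2 - sin x ^+ 2.
    by have := sqr_ge0 (cos x); nra.
  by have := ler_piMl t0 e0; have := sqr_ge0 (sin x); have := sqr_ge0 (ch y); lra.
have pow4 y (k : nat) : (k <= 6)%N -> ch y ^+ k <= ch y ^+ 6.
  by move=> k6; apply: ler_weXn2l => //; exact: ch_ge1.
have n1 : cnorm2 one = 1 by rewrite /cnorm2 /cone/= expr1n expr0n addr0.
have n2 : cnorm2 (cst 2) = 4 by rewrite /cnorm2 /=; ring.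
have ch2 y : 1 <= ch y ^+ 2 by have := ch_ge1 y; nra.
have ch4 y : ch y ^+ 2 <= ch y ^+ 4 by have := ch2 y; nra.
have ch6 y : ch y ^+ 4 <= ch y ^+ 6 by exact: pow4.
have sS' x y : 0 <= x <= pi -> cnorm2 (csub (S x y) one) <= 6 * ch y ^+ 2.
  by move=> xpi; have := cnorm2B (S x y) one; have := sS x y xpi; have := ch2 y; rewrite n1; lra.
have sQ x y : 0 <= x <= pi -> cnorm2 (cmul (S x y) (csub (S x y) one)) <= 12 * ch y ^+ 4.
  move=> xpi; rewrite cnorm2M (_ : 12 * ch y ^+ 4 = (2 * ch y ^+ 2) * (6 * ch y ^+ 2)); last by ring.
  by apply: ler_pM; rewrite ?cnorm2_ge0//; [exact: sS|exact: sS'].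
exists (4 + 24 * C0 + 2 * (4 + 80 * C0 + 24 * C1) * 2); first by lra.
move=> x y xpi; have s12 := strip_pt_ge y xpi; split.
- apply: le_trans (cnorm2B _ _) _; rewrite cnorm2M.
  have : cnorm2 (cmul (S x y) (csub (S x y) one)) * cnorm2 (claplace 0 (S x y)) <=
      12 * ch y ^+ 4 * C0.
    by apply: ler_pM; rewrite ?cnorm2_ge0//; [exact: sQ|exact: H0].
  have := sS x y xpi; have := ch4 y; have := ch6 y; have := ch2 y.
  have h := mulr_ge0 (ltW C00) (sqr_ge0 (ch y ^+ 3)).
  have h' := mulr_ge0 (ltW C10) (sqr_ge0 (ch y ^+ 3)).
  rewrite -!exprM/= in h h'; nra.
- rewrite cnorm2M.
  have hg : cnorm2 (gder1 x y) <= (4 + 80 * C0 + 24 * C1) * ch y ^+ 4.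
    apply: le_trans (cnorm2D _ _) _.
    have g1 := cnorm2B one (cmul (csub (cmul (cst 2) (S x y)) one) (claplace 0 (S x y))).
    have g2 : cnorm2 (cmul (csub (cmul (cst 2) (S x y)) one) (claplace 0 (S x y))) <= 18 * ch y ^+ 2 * C0.
      rewrite cnorm2M; apply: ler_pM; rewrite ?cnorm2_ge0//; last exact: H0.
      apply: le_trans (cnorm2B _ _) _; rewrite cnorm2M n1 n2; have := sS x y xpi; have := ch2 y; lra.
    have g3 : cnorm2 (cmul (cmul (S x y) (csub (S x y) one)) (claplace 1 (S x y))) <= 12 * ch y ^+ 4 * C1.
      by rewrite cnorm2M; apply: ler_pM; rewrite ?cnorm2_ge0//; [exact: sQ|exact: H1].
    rewrite n1 in g1; have := ch4 y; have := ch2 y; nra.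
  have := ler_pM (cnorm2_ge0 _) (cnorm2_ge0 _) hg (sS1 x y).
  have -> : (4 + 80 * C0 + 24 * C1) * ch y ^+ 4 * (2 * ch y ^+ 2) =
    (4 + 80 * C0 + 24 * C1) * 2 * ch y ^+ 6 by ring.
  move=> H; apply: le_trans H _; rewrite ler_wpM2r ?exprn_ge0 ?ltW ?ch_gt0//; lra.
Qed.

(** On this edge [s] is real, its derivative in [x + iy] is imaginary, and the sine transform
    vanishes at [t = 0]. This is what kills the [x]-derivative of the logarithm there. *)
Lemma zstrip_axis y : im (zstrip (pi / 2) y) = 0 /\ re (zstrip1 (pi / 2) y) = 0.
Proof.
have [s e] : exists s, S (pi / 2) y = Cplx s 0.
  by eexists; rewrite /S/= cos_pihalf mulr0 mul0r.
have [s1 e1] : exists s, S1 (pi / 2) y = Cplx 0 s.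
  by eexists; rewrite /S1/= cos_pihalf mulr0 mul0r.
have l k : lap k (pi / 2) s 0 = 0.
  rewrite /lap (@eq_Rintegral _ _ _ _ _ (fun=> 0)); last first.
    move=> v _; rewrite /lapker (_ : 0 * v - pi / 2 = - (pi / 2)); last by ring.
    by rewrite cosN cos_pihalf mulr0.
  by rewrite Rintegral_cst// mul0r.
by split; rewrite /zstrip /zstrip1 /gder1 /gfun e ?e1 /claplace /cmul /csub /Defs.cadd/= !l; ring.
Qed.

(** By [lap0_bounds] the product [s * lap] lies in [[0, 1]], so [s - s * lap * (s - 1)] lies between
    [1] and [s]. The lower bound excludes zeros on the slit; the upper bound later offsets the
    singularity of the weight at [y = 0]. *)
Lemma zstrip_axis_bounds y : 1 <= re (zstrip (pi / 2) y) <= ch y.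
Proof.
have := ch_ge1 y; have := a0; have := a1 => h1 h2 h3.
pose s := 1 - a + a * ch y.
have es : S (pi / 2) y = Cplx s 0 by rewrite /S cos_pihalf sin_pihalf mulr0 mul0r mulr1.
have : 1 <= s <= ch y by rewrite /s; apply/andP; split; nra.
rewrite /zstrip /gfun es /claplace /cmul /csub /cone/=.
move: s {es} => s /andP[s1 s2]; have := @lap0_bounds _ s; set l := lap _ _ _ _.
move=> /(_ _)/andP[|l0 ls]; first by lra.
have sl : s * l <= 1 by rewrite mulrC -ler_pdivlMr// ?div1r//; lra.
set X := (X in 1 <= X <= _); have -> : X = s - s * l * (s - 1) by rewrite /X; ring.
have sl0 : 0 <= s * l by apply: mulr_ge0 => //; lra.
by apply/andP; split; nra.
Qed.

(** Reflection in the real axis; it turns integrals over [[- Y, Y]] into the half-line integrals of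
    the theorem. *)
Lemma zstrip_even x y : 0 <= x <= pi -> re (zstrip x (- y)) = re (zstrip x y) /\ im (zstrip x (- y)) = - im (zstrip x y).
Proof.
move=> xpi; have e1 : re (S x (- y)) = re (S x y) by rewrite /S/= chN.
have e2 : im (S x (- y)) = - im (S x y) by rewrite /S/= shN mulrN.
have l0 k (s t : R) : lap k 0 s (- t) = lap k 0 s t.
  by apply: eq_Rintegral => v _; rewrite /lapker !subr0 mulNr cosN.
have l1 k (s t : R) : 0 < s -> lap k (pi / 2) s (- t) = - lap k (pi / 2) s t.
  move=> s0; rewrite -lapBpi//; apply: eq_Rintegral => v _; rewrite /lapker; congr (_ * _).
  by rewrite -cosN; congr cos; field.
have spos : 0 < re (S x y) by have := strip_pt_ge y xpi; lra.
have eS : S x (- y) = Cplx (re (S x y)) (- im (S x y)) by rewrite -e1 -e2.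
rewrite /zstrip /gfun eS; move: (S x y) spos => [s t]/= spos.
rewrite /claplace /cmul /csub/= l0 l1//.
by split; ring.
Qed.

Lemma strip_fun_zeta : strip_fun strip_dom zstrip zstrip1 zstrip2.
Proof.
split.
- exact: holo_zstrip.
- exact: holo_zstrip1.
- exact: ccont_zstrip.
- exact: ccont_zstrip1.
- exact: ccont_zstrip2.
- by move=> x y /(strip_pt_ge y); rewrite /strip_dom; lra.
- exact: strip_dom_left.
- exact: zstrip_growth.
- exact: zstrip_axis.
- exact: zstrip_axis_bounds.
- exact: zstrip_even.
Qed.

End StripFunction.

(** * Green's identity on vertical segments *)

Section Jets.
Context {R : realType}.
Implicit Types (x y Y e : R).

(** Explicit candidates for the partial derivatives travel with the function and are certified by
    [C2]; Laplacians then become identities for [ring] and [field]. *)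
Record jet := Jet {
  j0 : R -> R -> R; jx : R -> R -> R; jy : R -> R -> R; jxx : R -> R -> R; jyy : R -> R -> R }.
Implicit Types (u v w : jet).

Record C2 u x y : Prop := C2_ {
  C2x : der (fun x => j0 u x y) x (jx u x y);
  C2y : der (fun y => j0 u x y) y (jy u x y);
  C2xx : der (fun x => jx u x y) x (jxx u x y);
  C2yy : der (fun y => jy u x y) y (jyy u x y);
  C2_0 : cont2 (j0 u) x y; C2_1 : cont2 (jx u) x y; C2_2 : cont2 (jy u) x y;
  C2_3 : cont2 (jxx u) x y; C2_4 : cont2 (jyy u) x y }.

Definition laplacian u x y := jxx u x y + jyy u x y.

(** The horizontal flux in Green's identity through a vertical segment of half-length [Y]; [yflux]
    is the flux through its ends. *)
Definition wronskian u v Y x :=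
  Int (- Y) Y (fun y => jx u x y * j0 v x y - j0 u x y * jx v x y).

Definition yflux u v x y := jy u x y * j0 v x y - j0 u x y * jy v x y.

Lemma cont2_laplacian u x y : C2 u x y -> cont2 (laplacian u) x y.
Proof. by case=> ? ? ? ? ? ? ? ? ?; exact: cont2D. Qed.

(* Green's identity, with the integration over [x] left undone. *)
Lemma der_wronskian u v Y x k : 0 <= Y -> 0 < k ->
  (forall z y, x - k < z < x + k -> - Y <= y <= Y -> C2 u z y /\ C2 v z y) ->
  der (wronskian u v Y) x
    (Int (- Y) Y (fun y => laplacian u x y * j0 v x y - j0 u x y * laplacian v x y)
     - (yflux u v x Y - yflux u v x (- Y))).
Proof.
move=> Y0 k0 H.
have YY : - Y <= Y by lra.
have xI : x - k < x < x + k by lra.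
have cs (g : R -> R -> R) : (forall y, - Y <= y <= Y -> cont2 g x y) -> contI (- Y) Y (g x).
  by move=> cg y /cg; exact: cont2_secr.
have cu y : - Y <= y <= Y -> C2 u x y by move=> /(H _ _ xI)[].
have cv y : - Y <= y <= Y -> C2 v x y by move=> /(H _ _ xI)[].
pose h (z y : R) := jxx u z y * j0 v z y - j0 u z y * jxx v z y.
pose p (z y : R) := laplacian u z y * j0 v z y - j0 u z y * laplacian v z y.
pose q (z y : R) := jyy u z y * j0 v z y - j0 u z y * jyy v z y.
have ch_ z y : x - k < z < x + k -> - Y <= y <= Y -> cont2 h z y.
  move=> zx yY; have [[] ? ? ? ? ? ? ? ? ? [] ? ? ? ? ? ? ? ? ?] := H _ _ zx yY.
  by apply: cont2D; [|apply: cont2N]; exact: cont2M.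
have cp : contI (- Y) Y (p x).
  apply: cs => y yY; have [[] ? ? ? ? ? ? ? ? ? [] ? ? ? ? ? ? ? ? ?] := H _ _ xI yY.
  by apply: cont2D; [|apply: cont2N]; apply: cont2M => //; exact: cont2D.
have cq : contI (- Y) Y (q x).
  apply: cs => y yY; have [[] ? ? ? ? ? ? ? ? ? [] ? ? ? ? ? ? ? ? ?] := H _ _ xI yY.
  by apply: cont2D; [|apply: cont2N]; exact: cont2M.
have dI := @der_Int R (- Y) Y (fun z y => jx u z y * j0 v z y - j0 u z y * jx v z y) h (x - k) (x + k) x xI.
apply: der_eq (dI _ _ ch_) _.
- move=> z y zx yY; have [[] ? ? ? ? ? ? ? ? ? [] ? ? ? ? ? ? ? ? ?] := H _ _ zx yY.
  by rewrite /h; der_auto; ring.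
- move=> z zx y yY; have [[] ? ? ? ? ? ? ? ? ? [] ? ? ? ? ? ? ? ? ?] := H _ _ zx yY.
  by apply: (@cont2_secr _ (fun z y => jx u z y * j0 v z y - j0 u z y * jx v z y)); apply: cont2D; [|apply: cont2N]; exact: cont2M.
have <- : Int (- Y) Y (q x) = yflux u v x Y - yflux u v x (- Y).
  apply: Int_FTC => // y yY; have [[] ? ? ? ? ? ? ? ? ? [] ? ? ? ? ? ? ? ? ?] := H _ _ xI yY.
  by rewrite /q /yflux; der_auto; ring.
by rewrite -IntB//; apply: eq_Int => y _; rewrite /h /p /q /laplacian; ring.
Qed.

Definition jet_sub u v := Jet (fun x y => j0 u x y - j0 v x y) (fun x y => jx u x y - jx v x y)
  (fun x y => jy u x y - jy v x y) (fun x y => jxx u x y - jxx v x y)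
  (fun x y => jyy u x y - jyy v x y).

Lemma C2_sub u v x y : C2 u x y -> C2 v x y -> C2 (jet_sub u v) x y.
Proof.
case=> ? ? ? ? ? ? ? ? ? []; split => /=.
- by der_auto.
- by der_auto.
- by der_auto.
- by der_auto.
- by apply: cont2D => //; exact: cont2N.
- by apply: cont2D => //; exact: cont2N.
- by apply: cont2D => //; exact: cont2N.
- by apply: cont2D => //; exact: cont2N.
- by apply: cont2D => //; exact: cont2N.
Qed.

Lemma laplacian_sub u v x y : laplacian (jet_sub u v) x y = laplacian u x y - laplacian v x y.
Proof. by rewrite /laplacian/=; ring. Qed.

Definition jet_ln u := Jet (fun x y => 2^-1 * ln (j0 u x y)) (fun x y => jx u x y / (2 * j0 u x y))
  (fun x y => jy u x y / (2 * j0 u x y))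
  (fun x y => (jxx u x y * j0 u x y - jx u x y ^+ 2) / (2 * j0 u x y ^+ 2))
  (fun x y => (jyy u x y * j0 u x y - jy u x y ^+ 2) / (2 * j0 u x y ^+ 2)).

Lemma C2_ln u x y : 0 < j0 u x y -> C2 u x y -> C2 (jet_ln u) x y.
Proof.
move=> u0 [? ? ? ? ? ? ? ? ?].
have u1 : j0 u x y != 0 by lra.
have u2 : 2 * j0 u x y != 0 by lra.
have u3 : 2 * j0 u x y ^+ 2 != 0 by rewrite mulf_neq0// expf_neq0.
split => /=.
- by der_auto => //; field.
- by der_auto => //; field.
- by der_auto => //; field.
- by der_auto => //; field.
- by apply: cont2M; [exact: cont2C|exact: cont2_ln].
- by apply: cont2M => //; apply: cont2V => //; apply: cont2M => //; exact: cont2C.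
- by apply: cont2M => //; apply: cont2V => //; apply: cont2M => //; exact: cont2C.
- apply: cont2M; last by apply: cont2V => //; apply: cont2M; [exact: cont2C|exact: cont2X].
  by apply: cont2D; [exact: cont2M|apply: cont2N; exact: cont2X].
- apply: cont2M; last by apply: cont2V => //; apply: cont2M; [exact: cont2C|exact: cont2X].
  by apply: cont2D; [exact: cont2M|apply: cont2N; exact: cont2X].
Qed.

Lemma laplacian_ln u x y : j0 u x y != 0 ->
  laplacian (jet_ln u) x y =
  (j0 u x y * laplacian u x y - jx u x y ^+ 2 - jy u x y ^+ 2) / (2 * j0 u x y ^+ 2).
Proof. by move=> u0; rewrite /laplacian/=; field. Qed.

Lemma cont2_ch x y : cont2 (fun _ y : R => ch y) x y.
Proof. by apply: cont2_snd; exact: der_continuous (der_ch y). Qed.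

Lemma cont2_sh x y : cont2 (fun _ y : R => sh y) x y.
Proof. by apply: cont2_snd; exact: der_continuous (der_sh y). Qed.

End Jets.

(** * The regularised logarithm and its subharmonicity *)

Section RegularisedLogarithm.
Context {R : realType}.
Variables (f f1 f2 : R -> R -> cplx R).
Implicit Types (x y e : R).

Definition regn e := Jet (fun x y => cnorm2 (f x y) + e ^+ 2 * ch y ^+ 6)
  (fun x y => 2 * (re (f x y) * re (f1 x y) + im (f x y) * im (f1 x y)))
  (fun x y => 2 * (im (f x y) * re (f1 x y) - re (f x y) * im (f1 x y))
    + e ^+ 2 * (6 * ch y ^+ 5 * sh y))
  (fun x y => 2 * (cnorm2 (f1 x y) + re (f x y) * re (f2 x y) + im (f x y) * im (f2 x y)))
  (fun x y => 2 * (cnorm2 (f1 x y) - re (f x y) * re (f2 x y) - im (f x y) * im (f2 x y))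
    + e ^+ 2 * (6 * ch y ^+ 6 + 30 * ch y ^+ 4 * sh y ^+ 2)).

(* Unlike [ln |f|] it is smooth across the zeros of [f]; it is still subharmonic. The weight
   [ch y ^ 6] dominates [|f| ^ 2], which keeps the boundary terms at [y = Y] bounded. *)
Definition reglog e := jet_ln (regn e).

Lemma regn_gt0 e x y : 0 < e -> 0 < j0 (regn e) x y.
Proof.
move=> e0; rewrite /= ltr_wpDl ?cnorm2_ge0//; apply: mulr_gt0; apply: exprn_gt0 => //.
exact: ch_gt0.
Qed.

Lemma C2_regn e x y : holo f f1 x y -> holo f1 f2 x y ->
  ccont f x y -> ccont f1 x y -> ccont f2 x y -> C2 (regn e) x y.
Proof.
move=> [? ? ? ?] [? ? ? ?] [? ?] [? ?] [? ?].
have cc := @cont2_ch R x y; have cs := @cont2_sh R x y.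
have ck k : cont2 (fun _ y : R => ch y ^+ k) x y by exact: cont2X.
have cC c : cont2 (fun _ _ => c) x y by exact: cont2C.
split; rewrite /regn/= /cnorm2.
- by der_auto; ring.
- by der_auto; ring.
- by der_auto; ring.
- by der_auto; ring.
- apply: cont2D; last exact: cont2M.
  by apply: cont2D; exact: cont2X.
- by apply: cont2M => //; apply: cont2D; exact: cont2M.
- apply: cont2D.
    by apply: cont2M => //; apply: cont2D; [|apply: cont2N]; exact: cont2M.
  by apply: cont2M => //; apply: cont2M => //; exact: cont2M.
- apply: cont2M => //; apply: cont2D; last exact: cont2M.
  by apply: cont2D; [apply: cont2D; exact: cont2X|exact: cont2M].
- apply: cont2D.
    apply: cont2M => //; apply: cont2D; last by apply: cont2N; exact: cont2M.
    by apply: cont2D; [apply: cont2D; exact: cont2X|apply: cont2N; exact: cont2M].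
  apply: cont2M => //; apply: cont2D; first exact: cont2M.
  by apply: cont2M; [exact: cont2M|exact: cont2X].
Qed.

Lemma C2_reglog e x y : 0 < e -> holo f f1 x y -> holo f1 f2 x y ->
  ccont f x y -> ccont f1 x y -> ccont f2 x y -> C2 (reglog e) x y.
Proof. by move=> e0 ? ? ? ? ?; apply: C2_ln; [exact: regn_gt0|exact: C2_regn]. Qed.

(** In complex terms the sum is [|2 ch y f1 + 6 i sh y f| ^ 2 + 6 N] with
    [N = |f| ^ 2 + e ^ 2 ch y ^ 6], so the sign is manifest. The factor [e ^+ 2] matters too: away
    from the zeros of [f] it makes the Laplacian small. *)
Lemma laplacian_reglogE e x y : 0 < e ->
  laplacian (reglog e) x y = e ^+ 2 * ch y ^+ 4 *
    ((2 * ch y * im (f1 x y) + 6 * sh y * re (f x y)) ^+ 2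
     + (2 * ch y * re (f1 x y) - 6 * sh y * im (f x y)) ^+ 2
     + 6 * j0 (regn e) x y) / (2 * j0 (regn e) x y ^+ 2).
Proof.
move=> e0; have N0 := regn_gt0 x y e0.
rewrite laplacian_ln ?gt_eqF//; congr (_ / _).
rewrite /laplacian /regn /= /cnorm2.
have s2 : sh y ^+ 2 = ch y ^+ 2 - 1 by have := chE y; lra.
transitivity (e ^+ 2 * (4 * ch y ^+ 6 * (re (f1 x y) ^+ 2 + im (f1 x y) ^+ 2)
  + (6 * ch y ^+ 6 + 30 * ch y ^+ 4 * sh y ^+ 2) * (re (f x y) ^+ 2 + im (f x y) ^+ 2)
  - 24 * (im (f x y) * re (f1 x y) - re (f x y) * im (f1 x y)) * ch y ^+ 5 * sh y
  + e ^+ 2 * ch y ^+ 10 * (6 * ch y ^+ 2 - 6 * sh y ^+ 2))); first by ring.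
transitivity (e ^+ 2 * ch y ^+ 4 * (4 * ch y ^+ 2 * (re (f1 x y) ^+ 2 + im (f1 x y) ^+ 2)
  + 36 * sh y ^+ 2 * (re (f x y) ^+ 2 + im (f x y) ^+ 2)
  - 24 * (im (f x y) * re (f1 x y) - re (f x y) * im (f1 x y)) * ch y * sh y
  + 6 * (re (f x y) ^+ 2 + im (f x y) ^+ 2 + e ^+ 2 * ch y ^+ 6))); last by ring.
rewrite s2; ring.
Qed.

Lemma laplacian_reglog_ge0 e x y : 0 < e -> 0 <= laplacian (reglog e) x y.
Proof.
move=> e0; rewrite laplacian_reglogE//; have N0 := regn_gt0 x y e0.
apply: mulr_ge0; last by rewrite invr_ge0 mulr_ge0// sqr_ge0.
apply: mulr_ge0.
  by apply: mulr_ge0; [exact: sqr_ge0|apply: exprn_ge0; exact: ltW (ch_gt0 y)].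
by rewrite addr_ge0 ?addr_ge0 ?sqr_ge0// mulr_ge0// ltW.
Qed.

End RegularisedLogarithm.

(** * Integrable majorants in [y] *)

Section Decay.
Context {R : realType}.
Implicit Types (x y Y k : R).

(** One majorant serves all boundary integrals; its primitive is [atan] and its integral over the
    line is [pi < 4], the source of the factors 4 below. *)
Definition lorentz y : R := (1 + y ^+ 2)^-1.

Lemma lorentz_den_gt0 y : 0 < 1 + y ^+ 2.
Proof. by have := sqr_ge0 y; lra. Qed.

Lemma lorentz_gt0 y : 0 < lorentz y.
Proof. by rewrite invr_gt0 lorentz_den_gt0. Qed.

Lemma contI_lorentz a b : contI a b lorentz.
Proof.
move=> y _; apply: (@der_continuous _ _ _ (- (1 + y ^+ 2) ^- 2 * (0 + 2%:R * y ^+ 1 * 1))).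
rewrite /lorentz; apply: derV; first by rewrite gt_eqF ?lorentz_den_gt0.
by der_auto.
Qed.

Lemma Int_lorentz Y : 0 <= Y -> Int (- Y) Y lorentz <= 4.
Proof.
move=> Y0; rewrite (@Int_FTC _ _ _ _ atan); [|lra|exact: contI_lorentz|].
  have := atan_ltpi2 Y; have := atan_gtNpi2 (- Y); have := @pihalf_lt2 R; have := @pi_gt0 R; lra.
by move=> y _; exact: is_derive1_atan.
Qed.

Lemma Int_le_lorentz Y (g : R -> R) C : 0 <= Y -> 0 <= C -> contI (- Y) Y g ->
  (forall y, - Y <= y <= Y -> g y <= C * lorentz y) -> Int (- Y) Y g <= 4 * C.
Proof.
move=> Y0 C0 cg gC.
have cl : contI (- Y) Y (fun y => C * lorentz y) by apply: contIM; [exact: contIC|exact: contI_lorentz].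
apply: le_trans (Int_le cg cl gC) _; rewrite IntZ; last exact: contI_lorentz.
by rewrite mulrC ler_wpM2r// Int_lorentz.
Qed.

Lemma Int_ge_lorentz Y (g : R -> R) C : 0 <= Y -> 0 <= C -> contI (- Y) Y g ->
  (forall y, - Y <= y <= Y -> - (C * lorentz y) <= g y) -> - (4 * C) <= Int (- Y) Y g.
Proof.
move=> Y0 C0 cg gC; rewrite lerNl -IntN//; apply: Int_le_lorentz => //; first exact: contIN.
by move=> y yY; rewrite lerNl; exact: gC.
Qed.

Lemma ch_cube k y : 0 < k -> (1 + (k * `|y|) ^+ 3 / 6) / 2 <= ch (k * y).
Proof.
move=> k0; apply: le_trans (ch_ge _); rewrite ler_wpM2r ?invr_ge0//.
rewrite normrM (gtr0_norm k0).
have := @expR_ge1Dxn R (k * `|y|) 2; rewrite (_ : 3`!%:R = 6 :> R)//; apply.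
by rewrite mulr_ge0// ltW.
Qed.

(** The form [A + 3 * ln (ch y)] is the size of the regularised logarithm, [3 * ln (ch y)] being
    half the logarithm of [ch y ^ 6]. It grows linearly, and the cubic term of the exponential
    series beats that growth times [1 + y ^+ 2]. *)
Lemma ch_decay k A : 0 < k -> 0 <= A -> exists2 C : R, 0 < C &
  forall y, (A + 3 * ln (ch y)) / ch (k * y) <= C * lorentz y.
Proof.
move=> k0 A0; have k3 : 0 < k ^+ 3 by rewrite exprn_gt0.
pose B := 1 + 6 / k ^+ 3; have B0 : 0 < 6 / k ^+ 3 by rewrite divr_gt0.
exists (2 * (2 * A + 6) * B); first by rewrite !mulr_gt0// /B; lra.
move=> y; rewrite ler_pdivrMr ?ch_gt0// /lorentz mulrAC ler_pdivlMr ?lorentz_den_gt0//.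
have y0 := normr_ge0 y; set z := `|y| in y0.
have z2 : y ^+ 2 = z ^+ 2 by rewrite real_normK ?num_real.
rewrite z2.
have l := lnch_le y; rewrite -/z in l.
have h1 : (A + 3 * ln (ch y)) * (1 + z ^+ 2) <= (A + 3 * z) * (1 + z ^+ 2).
  by rewrite ler_wpM2r//; [have := sqr_ge0 z; lra|lra].
apply: le_trans h1 _.
have h2 : (A + 3 * z) * (1 + z ^+ 2) <= (2 * A + 6) * (1 + z ^+ 3).
  have p1 : 0 <= z * (z - 1) ^+ 2 by rewrite mulr_ge0// sqr_ge0.
  have p2 : 0 <= (z - 1) ^+ 2 * (z + 1) by rewrite mulr_ge0 ?sqr_ge0//; lra.
  have p3 : z ^+ 2 <= 1 + z ^+ 3 by nra.
  have p4 : z <= 1 + z ^+ 3 by nra.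
  nra.
apply: le_trans h2 _.
have h3 : 1 + z ^+ 3 <= B * (1 + (k * z) ^+ 3 / 6).
  rewrite /B exprMn (_ : _ * _ = 1 + z ^+ 3 + 6 / k ^+ 3 + k ^+ 3 * z ^+ 3 / 6); last first.
    by field; lra.
  have : 0 <= k ^+ 3 * z ^+ 3 by rewrite mulr_ge0 ?exprn_ge0// ltW.
  lra.
have h4 := ch_cube y k0; rewrite -/z in h4.
have h5 : 1 + z ^+ 3 <= 2 * B * ch (k * y).
  have hB : 0 <= B by rewrite /B; lra.
  have := ler_wpM2l hB h4; move: h3; clear; lra.
have : (2 * A + 6) * (1 + z ^+ 3) <= (2 * A + 6) * (2 * B * ch (k * y)) by rewrite ler_wpM2l//; lra.
lra.
Qed.

Lemma ch_decay_small k A eta : 0 < k -> 0 <= A -> 0 < eta -> exists2 Y0 : R, 1 <= Y0 &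
  forall y, Y0 <= `|y| -> (A + 3 * ln (ch y)) / ch (k * y) <= eta.
Proof.
move=> k0 A0 e0; have [C C0 HC] := ch_decay k0 A0.
have Ce : 0 < C / eta by rewrite divr_gt0.
exists (1 + C / eta); first lra.
move=> y hy; apply: le_trans (HC y) _; rewrite /lorentz ler_pdivrMr ?lorentz_den_gt0//.
have -> : y ^+ 2 = `|y| ^+ 2 by rewrite real_normK ?num_real.
rewrite -ler_pdivrMl//.
have : eta^-1 * C = C / eta by rewrite mulrC.
nra.
Qed.

End Decay.

(** * The harmonic kernel [phi_c] and its bounds *)

Section PoissonKernel.
Context {R : realType}.
Implicit Types (x y c : R).

Definition pden c x y := cos (2 * c * x) + ch (2 * c * y).

(* The real part of [tan (c (x + iy))]; at [c = 1] it has a pole at [x + iy = pi / 2], which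
   corresponds to the pole [s = 1] of zeta. *)
Definition poisson c := Jet (fun x y => sin (2 * c * x) / pden c x y)
  (fun x y => 2 * c * (1 + cos (2 * c * x) * ch (2 * c * y)) / pden c x y ^+ 2)
  (fun x y => - (2 * c * sin (2 * c * x) * sh (2 * c * y)) / pden c x y ^+ 2)
  (fun x y => (2 * c) ^+ 2 * sin (2 * c * x) *
     (2 + cos (2 * c * x) * ch (2 * c * y) - ch (2 * c * y) ^+ 2) / pden c x y ^+ 3)
  (fun x y => (2 * c) ^+ 2 * sin (2 * c * x) *
     (ch (2 * c * y) ^+ 2 - cos (2 * c * x) * ch (2 * c * y) - 2) / pden c x y ^+ 3).

Lemma laplacian_poisson c x y : laplacian (poisson c) x y = 0.
Proof. by rewrite /laplacian/=; ring. Qed.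

Lemma C2_poisson c x y : pden c x y != 0 -> C2 (poisson c) x y.
Proof.
move=> d; have s2 : sin (2 * c * x) ^+ 2 = 1 - cos (2 * c * x) ^+ 2.
  by have := cos2Dsin2 (2 * c * x); lra.
have h2 : sh (2 * c * y) ^+ 2 = ch (2 * c * y) ^+ 2 - 1 by have := chE (2 * c * y); lra.
have d2 : pden c x y ^+ 2 != 0 by rewrite expf_neq0.
have d3 : pden c x y ^+ 3 != 0 by rewrite expf_neq0.
have dx : der (fun x => pden c x y) x (- (2 * c * sin (2 * c * x))) by rewrite /pden; der_auto; ring.
have dy : der (fun y => pden c x y) y (2 * c * sh (2 * c * y)) by rewrite /pden; der_auto; ring.
have csin : cont2 (fun x _ => sin (2 * c * x)) x y.
  apply: (cont2_fst (h := fun x => sin (2 * c * x))).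
  by apply: (@der_continuous _ _ _ (2 * c * cos (2 * c * x))); der_auto; ring.
have ccos : cont2 (fun x _ => cos (2 * c * x)) x y.
  apply: (cont2_fst (h := fun x => cos (2 * c * x))).
  by apply: (@der_continuous _ _ _ (- (2 * c * sin (2 * c * x)))); der_auto; ring.
have cch : cont2 (fun _ y => ch (2 * c * y)) x y.
  apply: (cont2_snd (h := fun y => ch (2 * c * y))).
  by apply: (@der_continuous _ _ _ (2 * c * sh (2 * c * y))); der_auto; ring.
have csh : cont2 (fun _ y => sh (2 * c * y)) x y.
  apply: (cont2_snd (h := fun y => sh (2 * c * y))).
  by apply: (@der_continuous _ _ _ (2 * c * ch (2 * c * y))); der_auto; ring.
have cd : cont2 (pden c) x y by exact: cont2D.
have cC r : cont2 (fun _ _ => r) x y by exact: cont2C.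
have cdV n : cont2 (fun x y => (pden c x y ^+ n)^-1) x y.
  by apply: cont2V; [rewrite expf_neq0|exact: cont2X].
split => /=.
- der_auto => //; rewrite -[X in _ = 2 * c * (X + _) / _](cos2Dsin2 (2 * c * x)).
  by rewrite /pden in d *; field.
- by der_auto => //; field.
- by der_auto => //; rewrite /pden in d *; field.
- have e : ch (2 * c * y) ^+ 2 - cos (2 * c * x) * ch (2 * c * y) - 2 =
      2 * sh (2 * c * y) ^+ 2 - ch (2 * c * y) ^+ 2 - cos (2 * c * x) * ch (2 * c * y).
    by rewrite h2; ring.
  by rewrite e; der_auto => //; rewrite /pden in d *; field.
- by apply: cont2M => //; exact: cont2V.
- by apply: cont2M => //; apply: cont2M => //; apply: cont2D => //; exact: cont2M.
- by apply: cont2M => //; apply: cont2N; apply: cont2M => //; exact: cont2M.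
- apply: cont2M => //; apply: cont2M; first exact: cont2M.
  by apply: cont2D; [apply: cont2D => //; exact: cont2M|apply: cont2N; exact: cont2X].
- apply: cont2M => //; apply: cont2M; first exact: cont2M.
  apply: cont2D; last exact: cont2C.
  by apply: cont2D; [exact: cont2X|apply: cont2N; exact: cont2M].
Qed.

End PoissonKernel.

Section PoissonBounds.
Context {R : realType}.
Implicit Types (x y c : R).

(** Bounds the ratio of [pden] to [ch (2 * c * y)] from below. It tends to 0 as [c] tends to 1, so
    estimates through it are for fixed [c]. *)
Definition pmin c : R := (1 + cos (pi * c)) / 2.

Lemma pmin_gt0 c : 0 < c < 1 -> 0 < pmin c.
Proof.
move=> /andP[c0 c1]; rewrite /pmin divr_gt0//.
have p := @pi_gt0 R; have : -1 < cos (pi * c); last by lra.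
rewrite -cospi ltr_cos ?in_itv/= ?lexx ?andbT ?pi_ge0//; last by apply/andP; split; nra.
nra.
Qed.

Lemma cos_ge_pi c x : 0 < c < 1 -> 0 <= x <= pi / 2 -> cos (pi * c) <= cos (2 * c * x).
Proof.
move=> /andP[c0 c1] /andP[x0 x1]; have p := @pi_gt0 R.
rewrite leNgt ltr_cos ?in_itv/= -?leNgt; [nra|apply/andP; split; nra|apply/andP; split; nra].
Qed.

Lemma pden_ge c x y : 0 < c < 1 -> 0 <= x <= pi / 2 -> pmin c * ch (2 * c * y) <= pden c x y.
Proof.
move=> c01 xpi; have := cos_ge_pi c01 xpi; have := pmin_gt0 c01; have := ch_ge1 (2 * c * y).
have := cos_le1 (pi * c); rewrite /pden /pmin; nra.
Qed.

Lemma pden_gt0 c x y : 0 < c < 1 -> 0 <= x <= pi / 2 -> 0 < pden c x y.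
Proof.
move=> c01 xpi; apply: lt_le_trans (pden_ge y c01 xpi).
by have m := pmin_gt0 c01; have h := ch_gt0 (2 * c * y); nra.
Qed.

Lemma sin_poisson_ge0 c x : 0 < c < 1 -> 0 <= x <= pi / 2 -> 0 <= sin (2 * c * x).
Proof.
move=> /andP[c0 c1] /andP[x0 x1]; have p := @pi_gt0 R.
by apply: sin_ge0_pi; apply/andP; split; nra.
Qed.

Lemma poisson_ge0 c x y : 0 < c < 1 -> 0 <= x <= pi / 2 -> 0 <= j0 (poisson c) x y.
Proof.
by move=> c01 xpi; rewrite /= divr_ge0 ?sin_poisson_ge0// ltW// pden_gt0.
Qed.

Lemma poisson_le_sin c x y : 0 < c < 1 -> 0 <= x <= pi / 2 ->
  j0 (poisson c) x y <= sin (2 * c * x) / (pmin c * ch (2 * c * y)).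
Proof.
move=> c01 xpi; rewrite /= ler_wpM2l ?sin_poisson_ge0// lef_pV2 ?posrE ?pden_gt0 ?pden_ge//.
by have m := pmin_gt0 c01; have h := ch_gt0 (2 * c * y); nra.
Qed.

Lemma poisson_le c x y : 0 < c < 1 -> 0 <= x <= pi / 2 ->
  j0 (poisson c) x y <= (pmin c)^-1 / ch (2 * c * y).
Proof.
move=> c01 xpi; apply: le_trans (poisson_le_sin y c01 xpi) _.
have m := pmin_gt0 c01; have h := ch_gt0 (2 * c * y).
rewrite invfM -[leRHS]mul1r; apply: ler_wpM2r; last exact: sin_le1.
by rewrite mulr_ge0// invr_ge0 ltW.
Qed.

Lemma poisson_y_le c x y : 0 < c < 1 -> 0 <= x <= pi / 2 ->
  `|jy (poisson c) x y| <= 2 / pmin c ^+ 2 / ch (2 * c * y).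
Proof.
move=> c01 xpi; have m := pmin_gt0 c01; have h := ch_gt0 (2 * c * y).
have d := pden_ge y c01 xpi; have d0 := pden_gt0 y c01 xpi.
have [c0 c1] : 0 < c /\ c < 1 by apply/andP.
have mh : 0 < pmin c * ch (2 * c * y) by apply: mulr_gt0.
have d2 : 0 < pden c x y ^+ 2 by rewrite exprn_gt0.
rewrite /= normrM normfV (gtr0_norm d2) normrN (normrM (2 * c * _)) (normrM (2 * c)) (normrM 2) (ger0_norm (sin_poisson_ge0 c01 xpi)).
rewrite (gtr0_norm c0) normr_nat.
apply: (@le_trans _ _ (2 * ch (2 * c * y) / (pmin c * ch (2 * c * y)) ^+ 2)).
  apply: ler_pM.
  - by rewrite !mulr_ge0// ?sin_poisson_ge0// ltW.
  - by rewrite invr_ge0 exprn_ge0// ltW.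
  - apply: ler_pM => //; last exact: sh_le_ch.
      by rewrite !mulr_ge0// ?sin_poisson_ge0// ltW.
    rewrite -[leRHS]mulr1; apply: ler_pM; rewrite ?sin_poisson_ge0 ?sin_le1//; lra.
  - rewrite lef_pV2 ?posrE ?exprn_gt0//; apply: lerXn2r => //; by rewrite nnegrE ltW.
by rewrite le_eqVlt; apply/orP; left; apply/eqP; field; lra.
Qed.

Lemma poisson_x0 c y : jx (poisson c) 0 y = 2 * c / (1 + ch (2 * c * y)).
Proof.
rewrite /= /pden mulr0 cos0 mul1r; have h := ch_gt0 (2 * c * y).
by field; lra.
Qed.

Lemma poisson_0 c y : j0 (poisson c) 0 y = 0.
Proof. by rewrite /= mulr0 sin0 mul0r. Qed.

(** The weight on the slit. For [1 / 2 < c < 1] it is negative at [y = 0] and positive for large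
    [y]; hence the bounds on its absolute value. *)
Definition axis_weight c y := - jx (poisson c) (pi / 2) y.

Lemma axis_weightE c y : axis_weight c y =
  - (2 * c * (1 + cos (pi * c) * ch (2 * c * y)) / (cos (pi * c) + ch (2 * c * y)) ^+ 2).
Proof. by rewrite /axis_weight /= /pden (_ : 2 * c * (pi / 2) = pi * c)//; field. Qed.

Lemma axis_weight_le c y : 0 < c < 1 -> `|axis_weight c y| <= 2 / (cos (pi * c) + ch (2 * c * y)).
Proof.
move=> c01; have [c0 c1] : 0 < c /\ c < 1 by apply/andP.
have : 0 < 1 + cos (pi * c) by have := pmin_gt0 c01; rewrite /pmin; lra.
rewrite axis_weightE normrN; set k := cos _; have := cos_le1 (pi * c); rewrite -/k => k1 k2.
have := ch_ge1 (2 * c * y); set C := ch _ => C1.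
have kC : 0 < k + C by lra.
have kC2 : 0 < (k + C) ^+ 2 by rewrite exprn_gt0.
rewrite normrM normfV (gtr0_norm kC2) !normrM (gtr0_norm c0) normr_nat.
(* The two inequalities are [(C - 1) * (1 - k) >= 0] and [(C + 1) * (1 + k) >= 0]. *)
have h : `|1 + k * C| <= k + C by rewrite ler_norml; apply/andP; split; nra.
rewrite ler_pdivrMr// (_ : 2 / (k + C) * (k + C) ^+ 2 = 2 * (k + C)); last by field; lra.
by apply: ler_pM; rewrite ?mulr_ge0// ?ltW//; lra.
Qed.

End PoissonBounds.

(** * Size of the regularised logarithm, and the lower bound of the boundary functional *)

Section ReglogBounds.
Context {R : realType}.
Variables (D : R -> R -> Prop) (f f1 f2 : R -> R -> cplx R).
Hypothesis F : strip_fun D f f1 f2.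
Implicit Types (x y Y c e : R).
Local Notation U e := (reglog f f1 f2 e).

Lemma lnM6 (x y : R) : 0 < x -> 0 < y -> ln (x * y ^+ 6) = ln x + 6 * ln y.
Proof.
move=> x0 y0; rewrite lnM ?posrE ?exprn_gt0// (lnXn 6 y0); by ring.
Qed.

Lemma C2_reglog_dom e x y : 0 < e -> D x y -> C2 (U e) x y.
Proof.
move=> e0 Dxy; apply: C2_reglog => //; [exact: sf_holo F _ _ Dxy|exact: sf_holo1 F _ _ Dxy|..].
- exact: sf_cont F _ _ Dxy.
- exact: sf_cont1 F _ _ Dxy.
- exact: sf_cont2 F _ _ Dxy.
Qed.

Lemma strip_nbhd x Y : 0 <= x <= pi / 2 -> exists2 k : R, 0 < k &
  forall z y, x - k < z < x + k -> - Y <= y <= Y -> D z y.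
Proof.
move=> /andP[x0 x1]; have [k k0 Hk] := sf_dom_left F Y; have p := @pi_gt0 R.
exists (Num.min k (pi / 2)); first by rewrite lt_min k0; lra.
move=> z y; set m := Num.min _ _; have m1 : m <= k by rewrite ge_min lexx.
have m2 : m <= pi / 2 by rewrite ge_min lexx orbT.
move=> /andP[z1 z2] yY; have [z0|z0] := lerP z 0.
  by apply: Hk; [lra|rewrite ler_norml].
by apply: (sf_dom F); lra.
Qed.

Lemma reglog_ge e x y : 0 < e -> ln e + 3 * ln (ch y) <= j0 (U e) x y.
Proof.
move=> e0; have c0 := ch_gt0 y.
have c6 : 0 < ch y ^+ 6 by rewrite exprn_gt0.
have e2 : 0 < e ^+ 2 by rewrite exprn_gt0.
have -> : ln e + 3 * ln (ch y) = 2^-1 * ln (e ^+ 2 * ch y ^+ 6).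
  by rewrite lnM6// (lnXn 2 e0) -[ln e *+ 2]mulr_natl; field.
rewrite /= ler_wpM2l// ler_ln ?posrE; [|exact: mulr_gt0|exact: regn_gt0].
by rewrite lerDr cnorm2_ge0.
Qed.

Lemma reglog_le : exists2 A : R, 0 <= A & forall e x y, 0 < e <= 1 -> 0 <= x <= pi / 2 ->
  j0 (U e) x y <= A + 3 * ln (ch y).
Proof.
have [C C0 HC] := sf_growth F; have p := @pi_gt0 R.
exists (2^-1 * ln (C + 1)); first by rewrite mulr_ge0// ln_ge0//; lra.
move=> e x y /andP[e0 e1] xpi; have c0 := ch_gt0 y.
have c6 : 0 < ch y ^+ 6 by rewrite exprn_gt0.
have -> : 2^-1 * ln (C + 1) + 3 * ln (ch y) = 2^-1 * ln ((C + 1) * ch y ^+ 6).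
  by rewrite lnM6//; [field|lra].
rewrite /= ler_wpM2l// ler_ln ?posrE; [|exact: regn_gt0|apply: mulr_gt0; lra].
rewrite mulrDl mul1r; apply: lerD; first by apply: (HC x y _).1; lra.
by rewrite ler_piMl// ?exprn_ge0 ?expr_le1// ltW.
Qed.

(** The regularising term has the growth allowed to [|f| ^ 2] and [|f1| ^ 2], so the quotient is
    bounded on the strip. The bound blows up as [e] tends to 0, which is harmless in flux terms that
    vanish for large [Y]. *)
Lemma reglog_y_le : exists2 A : R, 0 <= A & forall e x y, 0 < e <= 1 -> 0 <= x <= pi / 2 ->
  `|jy (U e) x y| <= A / e ^+ 2 + 3.
Proof.
have [C C0 HC] := sf_growth F; have p := @pi_gt0 R.
exists C; first exact: ltW.
move=> e x y /andP[e0 e1] xpi; have c0 := ch_gt0 y.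
have c6 : 0 < ch y ^+ 6 by rewrite exprn_gt0.
have e2 : 0 < e ^+ 2 by rewrite exprn_gt0.
have N0 := regn_gt0 f f1 f2 x y e0.
have [h1 h2] : cnorm2 (f x y) <= C * ch y ^+ 6 /\ cnorm2 (f1 x y) <= C * ch y ^+ 6 by apply: HC; lra.
rewrite [jy _ _ _]/= normrM normfV (gtr0_norm (mulr_gt0 (ltr0Sn R 1) N0)).
rewrite ler_pdivrMr ?mulr_gt0//; apply: le_trans (ler_normD _ _) _.
have NE : e ^+ 2 * ch y ^+ 6 <= j0 (regn f f1 f2 e) x y by rewrite /= lerDr cnorm2_ge0.
have k1 : `|2 * (im (f x y) * re (f1 x y) - re (f x y) * im (f1 x y))| <= 2 * C * ch y ^+ 6.
  rewrite normrM normr_nat -mulrA ler_pM2l//; apply: (@le_trans _ _ ((cnorm2 (f x y) + cnorm2 (f1 x y)) / 2)).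
    rewrite /cnorm2 ler_norml; move: (re _) (im _) (re _) (im _) => a1 a2 b1 b2.
    have := sqr_ge0 (a1 - b2); have := sqr_ge0 (a1 + b2); have := sqr_ge0 (a2 - b1); have := sqr_ge0 (a2 + b1).
    by move=> *; apply/andP; split; lra.
  lra.
have k2 : `|e ^+ 2 * (6 * ch y ^+ 5 * sh y)| <= 6 * (e ^+ 2 * ch y ^+ 6).
  rewrite normrM (gtr0_norm e2) [leRHS]mulrCA ler_pM2l// (normrM (6 * _)) (normrM 6) normr_nat normrX (gtr0_norm c0).
  have := ler_wpM2l (ltW (exprn_gt0 5 c0)) (sh_le_ch y); rewrite -exprSr; lra.
apply: le_trans (lerD k1 k2) _.
have k3 : C * ch y ^+ 6 <= C / e ^+ 2 * j0 (regn f f1 f2 e) x y.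
  by rewrite -mulrA ler_pM2l// ler_pdivlMl.
lra.
Qed.

Lemma reglog_axis e y : 0 < e -> jx (U e) (pi / 2) y = 0 /\ 0 <= j0 (U e) (pi / 2) y.
Proof.
move=> e0; have [h1 h2] := sf_axis F y; have /andP[h3 _] := sf_axis_bounds F y.
split; first by rewrite /= h1 h2 mulr0 mul0r addr0 mulr0 mul0r.
rewrite /= mulr_ge0// ln_ge0// /cnorm2 h1.
have : 0 <= e ^+ 2 * ch y ^+ 6 by rewrite mulr_ge0 ?sqr_ge0// exprn_ge0// ltW// ch_gt0.
nra.
Qed.

(** The logarithm and its [y]-derivative grow at most linearly in [y], the kernel and its
    [y]-derivative decay exponentially. The threshold depends on [e] and [c], so [Y] must be the
    first parameter to pass to the limit. *)
Lemma poisson_flux e c eta : 0 < e <= 1 -> 0 < c < 1 -> 0 < eta -> exists2 Y0 : R, 1 <= Y0 &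
  forall x y, 0 <= x <= pi / 2 -> Y0 <= `|y| -> `|yflux (U e) (poisson c) x y| <= eta.
Proof.
move=> e01 c01 eta0; have [e0 e1] : 0 < e /\ e <= 1 by apply/andP.
have [c0 c1] : 0 < c /\ c < 1 by apply/andP.
have m := pmin_gt0 c01; set M := pmin c in m.
have [A A0 HA] := reglog_le; have [B B0 HB] := reglog_y_le.
have le0 : ln e <= 0 by rewrite ln_le0.
have Be : 0 <= B / e ^+ 2 by rewrite divr_ge0// sqr_ge0.
have kap : 0 < 2 / M ^+ 2 + M^-1 by rewrite addr_gt0// ?divr_gt0 ?exprn_gt0// invr_gt0.
have A1 : 0 <= B / e ^+ 2 + 3 + (A - ln e) by lra.
have [Y0 Y01 HY] := @ch_decay_small R (2 * c) _ (eta / (2 / M ^+ 2 + M^-1)) (mulr_gt0 (ltr0Sn R 1) c0) A1 (divr_gt0 eta0 kap).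
exists Y0; first exact: Y01.
move=> x y xpi yY; rewrite /yflux.
have h0 := ch_gt0 (2 * c * y); have l0 := lnch_ge0 y.
have u1 := HA e x y e01 xpi; have u2 := reglog_ge x y e0; have u3 := HB e x y e01 xpi.
have p1 := poisson_le y c01 xpi; have p2 := poisson_y_le y c01 xpi; have p3 := poisson_ge0 y c01 xpi.
rewrite -/M in p1 p2.
apply: le_trans (ler_normB _ _) _; rewrite (normrM (jy _ _ _)) (normrM (j0 _ _ _)) (ger0_norm p3).
set V := B / e ^+ 2 + 3 + (A - ln e) in A1 HY *.
have q1 : `|jy (U e) x y| <= V + 3 * ln (ch y) by apply: le_trans u3 _; rewrite /V; lra.
have q2 : `|j0 (U e) x y| <= V + 3 * ln (ch y) by rewrite ler_norml /V; apply/andP; split; lra.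
have V0 : 0 <= V + 3 * ln (ch y) by lra.
have r1 := ler_pM (normr_ge0 _) p3 q1 p1.
have r2 := ler_pM (normr_ge0 _) (normr_ge0 _) q2 p2.
apply: le_trans (lerD r1 r2) _.
have := HY y yY; rewrite ler_pdivlMr// => hy; apply: le_trans hy.
by rewrite le_eqVlt; apply/orP; left; apply/eqP; field; rewrite !gt_eqF.
Qed.

Definition bdry e c Y := Int (- Y) Y (fun y => j0 (U e) 0 y * (2 * c / (1 + ch (2 * c * y)))
  + j0 (U e) (pi / 2) y * axis_weight c y).

Lemma C2_poisson_strip c x y : 0 < c < 1 -> 0 <= x <= pi / 2 -> C2 (poisson c) x y.
Proof. by move=> c01 xpi; apply: C2_poisson; rewrite gt_eqF// pden_gt0. Qed.

Lemma poisson_nbhd c x : 0 < c < 1 -> 0 <= x <= pi / 2 -> exists2 k : R, 0 < k &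
  forall z y, x - k < z < x + k -> C2 (poisson c) z y.
Proof.
move=> /andP[c0 c1] /andP[x0 x1]; have p := @pi_gt0 R.
have k0 : 0 < pi / 2 * (1 - c) by rewrite mulr_gt0//; lra.
exists (pi / 2 * (1 - c)); first exact: k0.
move=> z y /andP[z1 z2]; apply: C2_poisson; rewrite gt_eqF//.
rewrite /pden; have h := ch_ge1 (2 * c * y); suff : -1 < cos (2 * c * z) by lra.
have h3 : `|2 * c * z| < pi by rewrite ltr_norml; apply/andP; split; nra.
rewrite -(cos_norm (2 * c * z)) -cospi ltr_cos ?in_itv/= ?normr_ge0 ?lexx ?andbT ?pi_ge0//= ltW//.
Qed.

Lemma der_wronskian_poisson e c Y x : 0 < e -> 0 < c < 1 -> 0 <= Y -> 0 <= x <= pi / 2 ->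
  der (wronskian (U e) (poisson c) Y) x
    (Int (- Y) Y (fun y => laplacian (U e) x y * j0 (poisson c) x y)
     - (yflux (U e) (poisson c) x Y - yflux (U e) (poisson c) x (- Y))).
Proof.
move=> e0 c01 Y0 xpi; have [k1 k10 H1] := strip_nbhd Y xpi.
have [k2 k20 H2] := poisson_nbhd c01 xpi.
have k0 : 0 < Num.min k1 k2 by rewrite lt_min k10.
apply: der_eq (der_wronskian Y0 k0 _) _.
  move=> z y; set k := Num.min _ _; have : k <= k1 by rewrite ge_min lexx.
  have : k <= k2 by rewrite ge_min lexx orbT.
  move=> h1 h2 zk yY; split; first by apply: C2_reglog_dom => //; apply: H1 => //; lra.
  by apply: H2; lra.
by congr (_ - _); apply: eq_Int => y _; rewrite laplacian_poisson mulr0 subr0.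
Qed.

Lemma contI_reglog e x a b : 0 < e -> 0 <= x <= pi -> contI a b (j0 (U e) x).
Proof.
move=> e0 xpi y _; apply: cont2_secr; apply: C2_0; apply: C2_reglog_dom => //; exact: sf_dom F _ _ xpi.
Qed.

Lemma contI_poisson_x c x a b : 0 < c < 1 -> 0 <= x <= pi / 2 -> contI a b (jx (poisson c) x).
Proof.
by move=> c01 xpi y _; apply: cont2_secr; apply: C2_1; exact: C2_poisson_strip.
Qed.

(** On either edge one term of the Wronskian drops out: the [x]-derivative of the logarithm at
    [x = pi / 2], the kernel itself at [x = 0]. *)
Lemma bdry_wronskian e c Y : 0 < e -> 0 < c < 1 ->
  bdry e c Y = wronskian (U e) (poisson c) Y (pi / 2) - wronskian (U e) (poisson c) Y 0.
Proof.
move=> e0 c01; have p := @pi_gt0 R.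
have i0 : 0 <= (0 : R) <= pi / 2 by apply/andP; split; lra.
have i1 : 0 <= (pi / 2 : R) <= pi / 2 by apply/andP; split; lra.
have i2 : 0 <= (0 : R) <= pi by apply/andP; split; lra.
have i3 : 0 <= (pi / 2 : R) <= pi by apply/andP; split; lra.
have cU x : 0 <= x <= pi -> contI (- Y) Y (j0 (U e) x) by exact: contI_reglog.
have cP x : 0 <= x <= pi / 2 -> contI (- Y) Y (jx (poisson c) x) by exact: contI_poisson_x.
have -> : wronskian (U e) (poisson c) Y (pi / 2) =
    Int (- Y) Y (fun y => - (j0 (U e) (pi / 2) y * jx (poisson c) (pi / 2) y)).
  by apply: eq_Int => y _; rewrite (reglog_axis y e0).1 mul0r sub0r.
have -> : wronskian (U e) (poisson c) Y 0 =
    Int (- Y) Y (fun y => - (j0 (U e) 0 y * jx (poisson c) 0 y)).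
  by apply: eq_Int => y _; rewrite poisson_0 mulr0 sub0r.
rewrite -IntB; [|by apply: contIN; apply: contIM; [exact: cU|exact: cP]..].
by apply: eq_Int => y _; rewrite poisson_x0 /axis_weight; ring.
Qed.

(** The Wronskian has derivative at least [- eta / 2]: the mass term is nonnegative and each of the
    two fluxes is at most [eta / 4]. The strip has width [pi / 2 < 2]. *)
Lemma bdry_ge e c eta : 0 < e <= 1 -> 0 < c < 1 -> 0 < eta -> exists2 Y0 : R, 1 <= Y0 &
  forall Y, Y0 <= Y -> - eta <= bdry e c Y.
Proof.
move=> e01 c01 eta0; have [e0 e1] : 0 < e /\ e <= 1 by apply/andP.
have eta4 : 0 < eta / 4 by rewrite divr_gt0.
have [Y0 Y01 HY] := poisson_flux e01 c01 eta4; exists Y0; first exact: Y01.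
move=> Y YY.
have p := @pi_gt0 R; have p2 := @pihalf_lt2 R.
have Yp : 0 <= Y by lra.
rewrite bdry_wronskian//.
have := @der_le _ (fun x => - (eta / 2) * x) (wronskian (U e) (poisson c) Y)
  (fun=> - (eta / 2)) _ 0 (pi / 2) _ _ (fun x xpi => der_wronskian_poisson e0 c01 Yp xpi).
move=> /(_ _ _ _) H; suff : - (eta / 2) * (pi / 2) - - (eta / 2) * 0 <=
  wronskian (U e) (poisson c) Y (pi / 2) - wronskian (U e) (poisson c) Y 0 by nra.
apply: H; first lra.
- by move=> x _; der_auto; ring.
- move=> x xpi; have yY : Y0 <= `|Y| by rewrite ger0_norm.
  have yY' : Y0 <= `|- Y| by rewrite normrN.
  have := HY x _ xpi yY; have := HY x _ xpi yY'; rewrite !ler_norml => /andP[a1 a2] /andP[a3 a4].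
  have : 0 <= Int (- Y) Y (fun y => laplacian (U e) x y * j0 (poisson c) x y).
    by apply: Int_ge0 => y _; rewrite mulr_ge0 ?poisson_ge0// laplacian_reglog_ge0.
  lra.
Qed.

End ReglogBounds.

(** * Control of the Laplacian near the edge [x = 0] *)

Section SinhCos.
Context {R : realType}.
Implicit Types (x y k r : R).

(** Harmonic, and for [k = pi / (2 T)] positive on [x > - r], [|y| < T] with zero boundary values: a
    test function that confines Green's identity to a bounded rectangle. *)
Definition sinhcos k r := Jet (fun x y => sh (k * (x + r)) * cos (k * y))
  (fun x y => k * ch (k * (x + r)) * cos (k * y))
  (fun x y => - (k * sh (k * (x + r)) * sin (k * y)))
  (fun x y => k ^+ 2 * sh (k * (x + r)) * cos (k * y))
  (fun x y => - (k ^+ 2 * sh (k * (x + r)) * cos (k * y))).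

Lemma laplacian_sinhcos k r x y : laplacian (sinhcos k r) x y = 0.
Proof. by rewrite /laplacian/=; ring. Qed.

Lemma C2_sinhcos k r x y : C2 (sinhcos k r) x y.
Proof.
have cs : cont2 (fun x _ => sh (k * (x + r))) x y.
  apply: (cont2_fst (h := fun x => sh (k * (x + r)))).
  by apply: (@der_continuous _ _ _ (k * ch (k * (x + r)))); der_auto; ring.
have cc : cont2 (fun x _ => ch (k * (x + r))) x y.
  apply: (cont2_fst (h := fun x => ch (k * (x + r)))).
  by apply: (@der_continuous _ _ _ (k * sh (k * (x + r)))); der_auto; ring.
have cS : cont2 (fun _ y => sin (k * y)) x y.
  apply: (cont2_snd (h := fun y => sin (k * y))).
  by apply: (@der_continuous _ _ _ (k * cos (k * y))); der_auto; ring.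
have cC : cont2 (fun _ y => cos (k * y)) x y.
  apply: (cont2_snd (h := fun y => cos (k * y))).
  by apply: (@der_continuous _ _ _ (- (k * sin (k * y)))); der_auto; ring.
have ck z : cont2 (fun _ _ => z) x y by exact: cont2C.
split => /=.
- by der_auto; ring.
- by der_auto; ring.
- by der_auto; ring.
- by der_auto; ring.
- exact: cont2M.
- by apply: cont2M => //; exact: cont2M.
- by apply: cont2N; apply: cont2M => //; exact: cont2M.
- by apply: cont2M => //; exact: cont2M.
- by apply: cont2N; apply: cont2M => //; exact: cont2M.
Qed.

Lemma Int_tail (r Y : R) (g h : R -> R) : 0 <= r <= Y -> contI (- Y) Y g -> contI (- Y) Y h ->
  (forall y, - Y <= y <= Y -> 0 <= h y) -> (forall y, - Y <= y <= Y -> r <= `|y| -> g y <= h y) ->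
  Int (- Y) Y g <= Int (- Y) Y h + Int (- r) r g.
Proof.
move=> /andP[r0 rY] cg ch_ h0 gh.
have sub (u : R -> R) a b : - Y <= a -> b <= Y -> contI (- Y) Y u -> contI a b u.
  by move=> aY bY cu y yab; apply: cu; lra.
have sp (u : R -> R) : contI (- Y) Y u -> Int (- Y) Y u = Int (- Y) (- r) u + Int (- r) r u + Int r Y u.
  move=> cu; rewrite (@Int_split _ (- Y) (- r) Y)//; last by apply/andP; split; lra.
  by rewrite (@Int_split _ (- r) r Y) ?addrA//; [apply/andP; split; lra|apply: sub cu; lra].
rewrite !sp//; have h1 : Int (- Y) (- r) g <= Int (- Y) (- r) h.
  apply: Int_le; [apply: sub cg; lra|apply: sub ch_; lra|].
  by move=> y yI; apply: gh; [lra|rewrite ler0_norm; lra].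
have h2 : Int r Y g <= Int r Y h.
  apply: Int_le; [apply: sub cg; lra|apply: sub ch_; lra|].
  by move=> y yI; apply: gh; [lra|rewrite ger0_norm; lra].
have h3 : 0 <= Int (- r) r h by apply: Int_ge0 => y yI; apply: h0; lra.
lra.
Qed.

End SinhCos.

Section MassBounds.
Context {R : realType}.
Variables (D : R -> R -> Prop) (f f1 f2 : R -> R -> cplx R).
Hypothesis F : strip_fun D f f1 f2.
Implicit Types (x y Y c e k r : R).
Local Notation U e := (reglog f f1 f2 e).

Lemma contI_laplacian e x a b (v : jet) : 0 < e ->
  (forall y, a <= y <= b -> D x y) -> (forall y, a <= y <= b -> C2 v x y) ->
  contI a b (fun y => laplacian (U e) x y * j0 v x y).
Proof.
move=> e0 Dx Cv y yab; apply: (@cont2_secr _ (fun x y => laplacian (U e) x y * j0 v x y)).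
apply: cont2M; last exact: C2_0 (Cv y yab).
by apply: cont2_laplacian; apply: (C2_reglog_dom F) => //; exact: Dx.
Qed.

(** The weight at [x = 0] is positive and the logarithm on the slit is nonnegative, so the upper
    bound [reglog_le], uniform in [e], is enough. *)
Lemma bdry_le c : 0 < c < 1 -> exists2 C : R, 0 < C & forall e Y, 0 < e <= 1 -> 0 <= Y ->
  bdry f f1 f2 e c Y <= C.
Proof.
move=> c01; have [c0 c1] : 0 < c /\ c < 1 by apply/andP.
have m := pmin_gt0 c01; set M := pmin c in m; have M0 : 0 < M^-1 by rewrite invr_gt0.
have p := @pi_gt0 R; have [A A0 HA] := reglog_le F.
have c20 : 0 < 2 * c by lra.
have [C C0 HC] := ch_decay c20 A0.
have K0 : 0 < 2 + 2 * M^-1 by lra.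
exists (4 * ((2 + 2 * M^-1) * C)); first by rewrite !mulr_gt0.
move=> e Y e01 Y0; have [e0 e1] : 0 < e /\ e <= 1 by apply/andP.
have i1 : 0 <= (pi / 2 : R) <= pi / 2 by apply/andP; split; lra.
have i0 : 0 <= (0 : R) <= pi / 2 by apply/andP; split; lra.
have i3 : 0 <= (pi / 2 : R) <= pi by apply/andP; split; lra.
have i2 : 0 <= (0 : R) <= pi by apply/andP; split; lra.
apply: Int_le_lorentz => //; first by rewrite mulr_ge0// ltW.
  apply: contID; apply: contIM; try exact: (contI_reglog F).
    by move=> y _; have := contI_poisson_x c01 i0 (a := y) (b := y) (y := y); rewrite lexx => /(_ isT);
      rewrite (_ : jx (poisson c) 0 = fun y => 2 * c / (1 + ch (2 * c * y)))//; apply/funext => z; exact: poisson_x0.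
  by apply: contIN; exact: contI_poisson_x.
move=> y _; have h0 := ch_gt0 (2 * c * y); have h1 := ch_ge1 (2 * c * y); have l0 := lnch_ge0 y.
have u0 := HA e 0 y e01 i0; have u1 := HA e (pi / 2) y e01 i1.
have [_ u2] := reglog_axis F y e0.
have hw : 2 * c / (1 + ch (2 * c * y)) <= 2 / ch (2 * c * y).
  by rewrite ler_pdivrMr ?ler_pdivlMr//; [|lra]; rewrite mulrAC ler_pdivlMr//; nra.
have hw0 : 0 <= 2 * c / (1 + ch (2 * c * y)) by rewrite divr_ge0//; lra.
have hk : axis_weight c y <= 2 * M^-1 / ch (2 * c * y).
  apply: le_trans (ler_norm _) _; apply: le_trans (axis_weight_le y c01) _.
  have d := pden_ge y c01 i1; rewrite /pden (_ : 2 * c * (pi / 2) = pi * c) in d; last by field.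
  have Mh : 0 < M * ch (2 * c * y) by apply: mulr_gt0.
  have -> : 2 * M^-1 / ch (2 * c * y) = 2 / (M * ch (2 * c * y)) by field; lra.
  rewrite ler_pM2l// lef_pV2 ?posrE//; exact: lt_le_trans d.
have hh : 0 <= 2 * M^-1 / ch (2 * c * y) by rewrite divr_ge0 ?ltW// mulr_gt0.
set T := A + 3 * ln (ch y); have T0 : 0 <= T by rewrite /T; lra.
have t1 : j0 (U e) 0 y * (2 * c / (1 + ch (2 * c * y))) <= T * (2 / ch (2 * c * y)).
  apply: le_trans (ler_wpM2r hw0 u0) _; exact: ler_wpM2l.
have t2 : j0 (U e) (pi / 2) y * axis_weight c y <= T * (2 * M^-1 / ch (2 * c * y)).
  apply: le_trans (ler_wpM2l u2 hk) _; exact: ler_wpM2r.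
apply: le_trans (lerD t1 t2) _; have := HC y; rewrite -/T => hC.
rewrite (_ : _ + _ = (2 + 2 * M^-1) * (T / ch (2 * c * y))); last by ring.
rewrite -[leRHS]mulrA; apply: ler_wpM2l => //; exact: ltW.
Qed.

(* Near [x = 0], where the weight of [poisson] degenerates, the mass of [laplacian (U e)] is
   controlled by extending the strip slightly to the left. *)
Lemma mass_near_left_edge T : 0 < T -> exists r C : R, [/\ 0 < r, 0 < C & forall e, 0 < e <= 1 ->
  exists M M' : R -> R, [/\ (forall x, - r <= x <= pi / 2 -> der M x (M' x)),
    (forall x, - r <= x <= pi / 2 ->
      Int (- T) T (fun y => laplacian (U e) x y * j0 (sinhcos (pi / 2 / T) r) x y) <= M' x) &
    M (pi / 2) - M (- r) <= C]].
Proof.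
move=> T0; have [k0 k00 Hk] := sf_dom_left F T; have p := @pi_gt0 R.
(* Half the admissible width, so that [x = - r] still has a neighbourhood in the domain. *)
pose r := k0 / 2; have r0 : 0 < r by rewrite divr_gt0.
set k := pi / 2 / T; have kp : 0 < k by rewrite !divr_gt0.
have DT x y : - k0 <= x <= pi -> - T <= y <= T -> D x y.
  move=> xI yI; have [x0|x0] := lerP x 0; last by apply: (sf_dom F); lra.
  by apply: Hk; [lra|rewrite ler_norml].
have [B B0 HB] : exists2 B : R, 0 < B & forall x y, - r <= x <= pi / 2 -> - T <= y <= T ->
    `|cnorm2 (f x y)| <= B.
  apply: rect_bound => x y xI yI; have xk : - k0 <= x <= pi by rewrite /r in xI; lra.
  by have [a1 a2] := sf_cont F (DT x y xk yI); apply: cont2D; exact: cont2X.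
pose V := 2^-1 * ln (B + ch T ^+ 6).
have cT := ch_ge1 T; have cT6 : 1 <= ch T ^+ 6 by rewrite exprn_ege1.
have V0 : 0 <= V by rewrite mulr_ge0// ln_ge0//; lra.
have UV e x y : 0 < e <= 1 -> - r <= x <= pi / 2 -> - T <= y <= T -> j0 (U e) x y <= V.
  move=> /andP[e0 e1] xI yI; rewrite /V /= ler_wpM2l// ler_ln ?posrE; [|exact: regn_gt0|lra].
  have c0 := ch_gt0 y; have cy : ch y <= ch T by rewrite -ch_norm ch_homo// ler_norml.
  apply: lerD; first by apply: le_trans (ler_norm _) (HB _ _ xI yI).
  apply: (@le_trans _ _ (ch y ^+ 6)); first by rewrite ler_piMl// ?exprn_ge0 ?expr_le1// ltW.
  by apply: lerXn2r => //; rewrite nnegrE ltW// ch_gt0.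
pose S1 := ch (k * (pi / 2 + r)); have S10 : 0 < S1 by exact: ch_gt0.
have kT : k * T = pi / 2 by rewrite /k; field; lra.
exists r, (V * (k * (T - - T)) + 2 * k * V * S1 * (pi / 2 + r) + 1); split => //.
  have : 0 <= V * (k * (T - - T)) by rewrite mulr_ge0// mulr_ge0 ?ltW//; lra.
  have : 0 <= 2 * k * V * S1 * (pi / 2 + r) by apply: mulr_ge0; [apply: mulr_ge0; [apply: mulr_ge0 => //; lra|exact: ltW]|lra].
  lra.
move=> e e01; have [e0 e1] : 0 < e /\ e <= 1 by apply/andP.
set th := sinhcos k r.
(* Uniformly in [e] the logarithm is bounded above by [V] but not below. This suffices: on [y = - T]
   and [y = T] the test function vanishes and its normal derivative has a known sign, and the linear
   term makes up for the resulting fluxes. *)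
exists (fun x => wronskian (U e) th T x + 2 * k * V * S1 * x).
exists (fun x => Int (- T) T (fun y => laplacian (U e) x y * j0 th x y)
   - (yflux (U e) th x T - yflux (U e) th x (- T)) + 2 * k * V * S1).
have CU x y : - k0 <= x <= pi -> - T <= y <= T -> C2 (U e) x y.
  by move=> xI yI; apply: (C2_reglog_dom F) => //; exact: DT.
split.
- move=> x xI; apply: derD; last by der_auto; ring.
  have rp : 0 < Num.min r (pi / 2) by rewrite lt_min r0 divr_gt0.
  apply: der_eq (der_wronskian (ltW T0) rp _) _.
    move=> z y; set q := Num.min _ _; have q1 : q <= r by rewrite ge_min lexx.
    have q2 : q <= pi / 2 by rewrite ge_min lexx orbT.
    move=> zI yI; split; last exact: C2_sinhcos.
    by apply: CU => //; rewrite /r in q1 xI; lra.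
  by congr (_ - _); apply: eq_Int => y _; rewrite laplacian_sinhcos mulr0 subr0.
- move=> x xI; have TT : - T <= T <= T by lra.
  have TT' : - T <= - T <= T by lra.
  have u1 := UV e x T e01 xI TT; have u2 := UV e x (- T) e01 xI TT'.
  have -> : yflux (U e) th x T = j0 (U e) x T * (k * sh (k * (x + r))).
    have j1 : j0 th x T = 0 by rewrite /th /= kT cos_pihalf mulr0.
    have j2 : jy th x T = - (k * sh (k * (x + r))) by rewrite /th /= kT sin_pihalf mulr1.
    by rewrite /yflux j1 j2; ring.
  have -> : yflux (U e) th x (- T) = - (j0 (U e) x (- T) * (k * sh (k * (x + r)))).
    have j1 : j0 th x (- T) = 0 by rewrite /th /= mulrN cosN kT cos_pihalf mulr0.
    have j2 : jy th x (- T) = k * sh (k * (x + r)).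
      by rewrite /th /= mulrN sinN kT sin_pihalf mulrN1 opprK.
    by rewrite /yflux j1 j2; ring.
  have xr : 0 <= k * (x + r) by apply: mulr_ge0; [exact: ltW|lra].
  have s0 : 0 <= sh (k * (x + r)).
    rewrite -sh0; apply: (@der_homo _ _ (@ch R)) => // z _; [exact: der_sh|exact: ltW (ch_gt0 z)].
  have s1 : sh (k * (x + r)) <= S1.
    apply: le_trans (ler_norm _) _; apply: le_trans (sh_le_ch _) _; apply: ch_homo => //.
    by rewrite ler_pM2l//; lra.
  move: (j0 _ _ _) u1 (j0 _ _ _) u2 => a1 u1 a2 u2.
  set s := sh _ in s0 s1 *; set I := Int _ _ _.
  have w1 : a1 * (k * s) <= V * (k * S1).
    apply: (@le_trans _ _ (V * (k * s))); first by rewrite ler_wpM2r// mulr_ge0// ltW.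
    by rewrite ler_wpM2l// ler_wpM2l// ltW.
  have w2 : a2 * (k * s) <= V * (k * S1).
    apply: (@le_trans _ _ (V * (k * s))); first by rewrite ler_wpM2r// mulr_ge0// ltW.
    by rewrite ler_wpM2l// ler_wpM2l// ltW.
  lra.
- have TT : - T <= T by lra.
  have cosk y : - T <= y <= T -> 0 <= cos (k * y).
    move=> /andP[y1 y2]; apply: cos_ge0_pihalf; rewrite -kT.
    have := ler_wpM2l (ltW kp) y1; have := ler_wpM2l (ltW kp) y2; lra.
  have cthx x : contI (- T) T (jx th x) by move=> y _; apply: cont2_secr; exact: C2_1 (C2_sinhcos _ _ _ _).
  have cUx x : - k0 <= x <= pi -> contI (- T) T (j0 (U e) x).
    by move=> xI y yI; apply: cont2_secr; exact: C2_0 (CU _ _ xI yI).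
  (* At [x = pi / 2] the logarithm is nonnegative; at [x = - r] the upper bound [V] is again
     enough. *)
  have w1 : wronskian (U e) th T (pi / 2) <= 0.
    have -> : wronskian (U e) th T (pi / 2) = Int (- T) T (fun y => - (j0 (U e) (pi / 2) y * jx th (pi / 2) y)).
      by apply: eq_Int => y _; rewrite (reglog_axis F y e0).1 mul0r sub0r.
    rewrite IntN; last by apply: contIM => //; apply: cUx; lra.
    rewrite oppr_le0; apply: Int_ge0 => y yI; apply: mulr_ge0; first exact: (reglog_axis F y e0).2.
    by apply: mulr_ge0; [apply: mulr_ge0; [exact: ltW|exact: ltW (ch_gt0 _)]|exact: cosk].
  have w2 : - (V * (k * (T - - T))) <= wronskian (U e) th T (- r).
    have -> : wronskian (U e) th T (- r) = Int (- T) T (fun y => - (j0 (U e) (- r) y * jx th (- r) y)).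
      by apply: eq_Int => y _; rewrite /th /= addNr mulr0 sh0 mul0r mulr0 sub0r.
    rewrite IntN; last by apply: contIM => //; apply: cUx; rewrite /r; lra.
    rewrite lerN2 mulrA -(@Int_cst _ (- T) T (V * k))//.
    apply: Int_le; [by apply: contIM => //; apply: cUx; rewrite /r; lra|exact: contIC|].
    move=> y yI; have rI : - r <= - r <= pi / 2 by lra.
    have u := UV e (- r) y e01 rI yI; have ck := cosk y yI.
    rewrite [jx _ _ _]/= addNr mulr0 ch0 mulr1; apply: le_trans (ler_wpM2r _ u) _.
      by rewrite mulr_ge0// ltW.
    by rewrite ler_wpM2l//; rewrite ler_piMr ?cos_le1// ltW.
  by move: w1 w2; clear; lra.
Qed.

End MassBounds.

(** * Without zeros the boundary functional tends to 0 *)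

Section NoZeros.
Context {R : realType}.
Variables (D : R -> R -> Prop) (f f1 f2 : R -> R -> cplx R).
Hypothesis F : strip_fun D f f1 f2.
Implicit Types (x y Y c e k r t K del S E eta kap : R).
Local Notation U e := (reglog f f1 f2 e).

(** [phi_c] decays like [expR (- 2 c |y|)], [phi_(c / 2)] only like [expR (- c |y|)]. Both vanish to
    first order at [x = 0], and [sin (2 c x) <= 2 * sin (c x)] keeps the comparison uniform up to
    that edge. *)
Lemma poisson_half_tail c t : 0 < c < 1 -> 0 < t -> exists2 r : R, 0 < r &
  forall x y, 0 <= x <= pi / 2 -> r <= `|y| ->
  j0 (poisson c) x y <= t * j0 (poisson (c / 2)) x y.
Proof.
move=> c01 t0; have [c0 c1] : 0 < c /\ c < 1 by apply/andP.
have m := pmin_gt0 c01; set M := pmin c in m.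
have p := @pi_gt0 R; have c201 : 0 < c / 2 < 1 by apply/andP; split; lra.
have c20 : 0 < c by [].
have A0 : 0 <= 1 :> R by [].
have tM : 0 < t * M / 4 by rewrite !divr_gt0// mulr_gt0.
have [Y0 Y01 HY] := ch_decay_small c20 A0 tM.
exists Y0; first lra.
move=> x y xpi yY; have h := HY y yY; have l0 := lnch_ge0 y.
have s1 := poisson_le_sin y c01 xpi; apply: le_trans s1 _; rewrite -/M.
have d0 := pden_gt0 y c201 xpi.
have e1 : 2 * (c / 2) * x = c * x by field.
have e2 : 2 * (c / 2) * y = c * y by field.
have xpi' : 0 <= x /\ x <= pi / 2 by apply/andP.
have s0 : 0 <= sin (c * x) by have := sin_poisson_ge0 c201 xpi; rewrite e1.
have sd : sin (2 * c * x) <= 2 * sin (c * x).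
  rewrite (_ : 2 * c * x = c * x + c * x); last by ring.
  by rewrite sinD; have := cos_le1 (c * x); nra.
have hh := ch_ge1 (c * y); have hd : ch (c * y) ^+ 2 <= ch (2 * c * y).
  rewrite (_ : 2 * c * y = 2 * (c * y)); last by ring.
  by rewrite ch_double; nra.
rewrite /= e1; rewrite /pden e1 e2 in d0 *.
have D1 : cos (c * x) + ch (c * y) <= 2 * ch (c * y) by have := cos_le1 (c * x); lra.
set C := ch (c * y) in h hh hd d0 D1 *; set E := ch (2 * c * y) in hd *.
have h' : 1 <= t * M / 4 * C by rewrite -ler_pdivrMr; [apply: le_trans h; rewrite ler_wpM2r ?invr_ge0; lra|lra].
set s := sin (c * x) in s0 sd *; set dd := _ + _ in d0 D1 *.
have ME : 0 < M * E by apply: mulr_gt0 => //; nra.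
rewrite ler_pdivrMr//; apply: le_trans sd _.
have q : 2 <= t * (M * E) / dd.
  rewrite ler_pdivlMr//; apply: (@le_trans _ _ (2 * (2 * C))); first by rewrite ler_pM2l.
  apply: (@le_trans _ _ (t * (M * C ^+ 2))); first by nra.
  by rewrite ler_pM2l// ler_pM2l.
rewrite (_ : t * (s / dd) * (M * E) = t * (M * E) / dd * s); last by ring.
by rewrite ler_wpM2r.
Qed.

(** On the compact rectangle [|f|] is bounded away from 0, so everything in [laplacian_reglogE]
    besides the factor [e ^+ 2] stays bounded. *)
Lemma laplacian_reglog_compact r del : 0 < del ->
  (forall x y, 0 < x <= pi / 2 -> cnorm2 (f x y) != 0) ->
  exists2 C : R, 0 < C & forall e x y, 0 < e <= 1 -> del <= x <= pi / 2 -> - r <= y <= r ->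
  laplacian (U e) x y <= C * e ^+ 2.
Proof.
move=> d0 nz; have p := @pi_gt0 R.
have Dx x y : del <= x <= pi / 2 -> D x y by move=> xI; apply: (sf_dom F); lra.
have [K K0 HK] : exists2 K : R, 0 < K & forall x y, del <= x <= pi / 2 -> - r <= y <= r ->
    `|(cnorm2 (f x y))^-1| <= K.
  apply: rect_bound => x y xI yI; apply: cont2V; first by apply: nz; lra.
  by have [a1 a2] := sf_cont F (Dx x y xI); apply: cont2D; exact: cont2X.
pose q x y := ch y ^+ 4 * ((2 * ch y * im (f1 x y) + 6 * sh y * re (f x y)) ^+ 2
     + (2 * ch y * re (f1 x y) - 6 * sh y * im (f x y)) ^+ 2).
have [A A0 HA] : exists2 A : R, 0 < A & forall x y, del <= x <= pi / 2 -> - r <= y <= r ->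
    `|q x y| <= A.
  apply: rect_bound => x y xI yI.
  have [a1 a2] := sf_cont F (Dx x y xI); have [b1 b2] := sf_cont1 F (Dx x y xI).
  have cc := @cont2_ch R x y; have cs := @cont2_sh R x y.
  have cC (z : R) : cont2 (fun _ _ => z) x y by exact: cont2C.
  apply: cont2M; first exact: cont2X.
  by apply: cont2D; apply: cont2X; apply: cont2D; try apply: cont2N; apply: cont2M => //; exact: cont2M.
pose B := ch r ^+ 4; have B0 : 0 < B by rewrite exprn_gt0// ch_gt0.
exists (A * K ^+ 2 + 3 * B * K); first by apply: addr_gt0; [apply: mulr_gt0 => //; exact: exprn_gt0|apply: mulr_gt0 => //; exact: mulr_gt0].
move=> e x y /andP[e0 e1] xI yI; rewrite laplacian_reglogE//.
have n0 : 0 < cnorm2 (f x y) by rewrite lt_neqAle cnorm2_ge0 andbT eq_sym; apply: nz; lra.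
set N := j0 _ _ _; have Nn : cnorm2 (f x y) <= N.
  by rewrite /N/= lerDl mulr_ge0 ?sqr_ge0// exprn_ge0// ltW// ch_gt0.
have N0 : 0 < N by lra.
have iN : N^-1 <= K.
  apply: (@le_trans _ _ (cnorm2 (f x y))^-1); first by rewrite lef_pV2 ?posrE.
  by have := HK x y xI yI; rewrite gtr0_norm// invr_gt0.
have iN0 : 0 < N^-1 by rewrite invr_gt0.
have qA : q x y <= A by apply: le_trans (ler_norm _) (HA _ _ xI yI).
have q0 : 0 <= q x y by rewrite /q mulr_ge0 ?exprn_ge0 ?addr_ge0 ?sqr_ge0// ltW// ch_gt0.
have cB : ch y ^+ 4 <= B.
  have cr : ch y <= ch r by rewrite -ch_norm; apply: ch_homo => //; rewrite ler_norml.
  by apply: lerXn2r => //; rewrite nnegrE ltW// ch_gt0.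
have c40 : 0 <= ch y ^+ 4 by rewrite exprn_ge0// ltW// ch_gt0.
have -> : e ^+ 2 * ch y ^+ 4 * ((2 * ch y * im (f1 x y) + 6 * sh y * re (f x y)) ^+ 2 +
    (2 * ch y * re (f1 x y) - 6 * sh y * im (f x y)) ^+ 2 + 6 * N) / (2 * N ^+ 2) =
    (2^-1 * (q x y * N^-1 ^+ 2) + 3 * (ch y ^+ 4 * N^-1)) * e ^+ 2.
  by rewrite /q; field; lra.
rewrite ler_wpM2r ?sqr_ge0//; apply: lerD.
  have h : q x y * N^-1 ^+ 2 <= A * K ^+ 2.
    by apply: ler_pM => //; [exact: sqr_ge0|apply: lerXn2r => //; rewrite nnegrE ltW].
  have : 0 <= q x y * N^-1 ^+ 2 by rewrite mulr_ge0// sqr_ge0.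
  lra.
by rewrite -mulrA ler_pM2l//; apply: ler_pM => //; exact: ltW.
Qed.

Definition mass e (v : jet) Y x := Int (- Y) Y (fun y => laplacian (U e) x y * j0 v x y).

Definition fluxgap e c Y x := yflux (U e) (poisson c) x Y - yflux (U e) (poisson c) x (- Y).

Lemma fluxgap_small e c eta : 0 < e <= 1 -> 0 < c < 1 -> 0 < eta -> exists2 Y0 : R, 1 <= Y0 &
  forall Y x, Y0 <= Y -> 0 <= x <= pi / 2 -> `|fluxgap e c Y x| <= eta.
Proof.
move=> e01 c01 eta0; have eta2 : 0 < eta / 2 by rewrite divr_gt0.
have [Y0 Y01 HY] := poisson_flux F e01 c01 eta2; exists Y0; first exact: Y01.
move=> Y x YY xI; have yn : Y0 <= `|Y| by rewrite ger0_norm; lra.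
have yn' : Y0 <= `|- Y| by rewrite normrN.
apply: le_trans (ler_normB _ _) _.
by have := HY x Y xI yn; have := HY x (- Y) xI yn'; lra.
Qed.

Lemma contI_mass e c x Y : 0 < e -> 0 < c < 1 -> 0 <= x <= pi / 2 ->
  contI (- Y) Y (fun y => laplacian (U e) x y * j0 (poisson c) x y).
Proof.
move=> e0 c01 xI; have p := @pi_gt0 R.
apply: (contI_laplacian F e0) => y _; [by apply: (sf_dom F); lra|exact: C2_poisson_strip].
Qed.

Lemma mass_tail e c t r Y x : 0 < e -> 0 < c < 1 -> 0 <= t -> 0 <= r <= Y -> 0 <= x <= pi / 2 ->
  (forall x y, 0 <= x <= pi / 2 -> r <= `|y| -> j0 (poisson c) x y <= t * j0 (poisson (c / 2)) x y) ->
  mass e (poisson c) Y x <= t * mass e (poisson (c / 2)) Y x + mass e (poisson c) r x.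
Proof.
move=> e0 c01 t0 rY xI H; have c201 : 0 < c / 2 < 1 by case/andP : c01 => *; apply/andP; split; lra.
have m1 := @contI_mass e c x Y e0 c01 xI; have m2 := @contI_mass e (c / 2) x Y e0 c201 xI.
rewrite /mass -IntZ//; apply: Int_tail => //; first by apply: contIM => //; exact: contIC.
  by move=> y _; rewrite mulr_ge0// mulr_ge0 ?laplacian_reglog_ge0 ?poisson_ge0.
move=> y _ ry; rewrite [leRHS]mulrCA; apply: ler_wpM2l; first exact: laplacian_reglog_ge0.
exact: H.
Qed.

Lemma mass_inner_le r c del : 0 < del -> 0 < r -> 0 < c < 1 ->
  (forall x y, 0 < x <= pi / 2 -> cnorm2 (f x y) != 0) ->
  exists2 C : R, 0 < C & forall e x, 0 < e <= 1 -> del <= x <= pi / 2 ->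
  mass e (poisson c) r x <= C * e ^+ 2.
Proof.
move=> d0 r0 c01 nz; have [C C0 HC] := laplacian_reglog_compact r d0 nz.
have M0 : 0 < (pmin c)^-1 by rewrite invr_gt0 pmin_gt0.
exists (C * (pmin c)^-1 * (2 * r)); first by do 2! apply: mulr_gt0 => //; rewrite mulr_gt0.
move=> e x e01 xI; have [e0 e1] : 0 < e /\ e <= 1 by apply/andP.
have xpi : 0 <= x <= pi / 2 by lra.
have := @Int_cst _ (- r) r (C * e ^+ 2 * (pmin c)^-1); rewrite opprK => /(_ _)/wrap[|H]; first lra.
rewrite (_ : C * (pmin c)^-1 * (2 * r) * e ^+ 2 = C * e ^+ 2 * (pmin c)^-1 * (r + r)); last by ring.
rewrite -H; apply: Int_le; [exact: contI_mass|exact: contIC|] => y yI; apply: ler_pM.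
- exact: laplacian_reglog_ge0.
- exact: poisson_ge0.
- exact: HC.
- apply: le_trans (poisson_le y c01 xpi) _; apply: ler_piMr; first exact: ltW.
  by rewrite invf_le1 ?ch_gt0// ch_ge1.
Qed.

(** The test function lives on half-height [2 * r], twice that of the region to be controlled, so
    that its cosine factor does not degenerate there. *)
Lemma mass_edge_le e c r k kap K del x : 0 < e -> 0 < c < 1 -> 0 < r -> 0 <= K -> 0 <= x <= del -> del <= pi / 4 ->
  (forall y, - (2 * r) <= y <= 2 * r -> 0 <= j0 (sinhcos k kap) x y) ->
  (forall y, - r <= y <= r -> j0 (poisson c) x y <= K * j0 (sinhcos k kap) x y) ->
  mass e (poisson c) r x <= K * mass e (sinhcos k kap) (2 * r) x.
Proof.
move=> e0 c01 r0 K0 xI d4 th0 thK; have p := @pi_gt0 R; have xpi : 0 <= x <= pi / 2 by lra.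
have cth : contI (- (2 * r)) (2 * r) (fun y => laplacian (U e) x y * j0 (sinhcos k kap) x y).
  by apply: (contI_laplacian F e0) => y _; [apply: (sf_dom F); lra|exact: C2_sinhcos].
have cth' : contI (- r) r (fun y => laplacian (U e) x y * j0 (sinhcos k kap) x y).
  by move=> y yI; apply: cth; lra.
apply: (@le_trans _ _ (K * mass e (sinhcos k kap) r x)).
  rewrite /mass -IntZ//; apply: Int_le; [exact: contI_mass|by apply: contIM => //; exact: contIC|].
  by move=> y yI; rewrite [leRHS]mulrCA; apply: ler_wpM2l; [exact: laplacian_reglog_ge0|exact: thK].
apply: ler_wpM2l => //; apply: Int_subset => //; [lra|lra|].
by move=> y yI; rewrite mulr_ge0 ?laplacian_reglog_ge0// th0.
Qed.

End NoZeros.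

Section SinhCosBounds.
Context {R : realType}.
Implicit Types (x y k r : R).

Lemma sh_homo x y : x <= y -> sh x <= sh y.
Proof. by move=> xy; apply: (@der_homo _ sh ch) => // z _; [exact: der_sh|exact: ltW (ch_gt0 z)]. Qed.

Lemma sh_ge0 x : 0 <= x -> 0 <= sh x.
Proof. by move=> /sh_homo; rewrite sh0. Qed.

Lemma sh_gt0 x : 0 < x -> 0 < sh x.
Proof.
move=> x0; have [z _] := @der_mvt _ sh ch 0 x (ltW x0) (fun z _ => der_sh z).
by rewrite sh0 !subr0 => ->; rewrite mulr_gt0// ch_gt0.
Qed.

Lemma sinhcos_ge0 T kap x y : 0 < T -> - kap <= x -> - T <= y <= T ->
  0 <= j0 (sinhcos (pi / 2 / T) kap) x y.
Proof.
move=> T0 x0 /andP[y1 y2]; have p := @pi_gt0 R.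
have k0 : 0 < pi / 2 / T :> R by rewrite !divr_gt0.
have kT : pi / 2 / T * T = pi / 2 :> R by field; lra.
move: k0 kT; set k := pi / 2 / T => k0 kT; rewrite /=; apply: mulr_ge0.
  by apply: sh_ge0; apply: mulr_ge0; [exact: ltW|lra].
apply: cos_ge0_pihalf; rewrite -kT.
have := ler_wpM2l (ltW k0) y1; have := ler_wpM2l (ltW k0) y2; lra.
Qed.

(** At [x = 0] the kernel vanishes while [sinhcos], whose zero line is [x = - kap], does not: the
    quotient is of order [del]. For [|y| <= r] the cosine is at least [cos (pi / 4)]. *)
Lemma poisson_le_sinhcos c r kap : 0 < c < 1 -> 0 < r -> 0 < kap -> exists2 K : R, 0 < K &
  forall del x y, 0 <= x <= del -> del <= pi / 4 -> - r <= y <= r ->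
  j0 (poisson c) x y <= K * del * j0 (sinhcos (pi / 2 / (2 * r)) kap) x y.
Proof.
move=> c01 r0 kap0; have [c0 c1] : 0 < c /\ c < 1 by apply/andP.
have p := @pi_gt0 R; have M0 := pmin_gt0 c01.
have k0 : 0 < pi / 2 / (2 * r) by rewrite !divr_gt0// mulr_gt0.
have kr : pi / 2 / (2 * r) * r = pi / 4 by field; lra.
move: k0 kr; set k := pi / 2 / _ => k0 kr.
have S0 : 0 < sh (k * kap) by apply: sh_gt0; exact: mulr_gt0.
have C0 : 0 < cos (pi / 4 : R) by apply: cos_gt0_pihalf; lra.
have SC : 0 < sh (k * kap) * cos (pi / 4) by exact: mulr_gt0.
exists (2 / pmin c / (sh (k * kap) * cos (pi / 4))); first by apply: divr_gt0 => //; exact: divr_gt0.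
move=> del x y xI d4 yI; have xpi : 0 <= x <= pi / 2 by lra.
have [x0 xd] : 0 <= x /\ x <= del by apply/andP.
have h1 := ch_ge1 (2 * c * y); apply: le_trans (poisson_le_sin y c01 xpi) _.
have th : sh (k * kap) * cos (pi / 4) <= j0 (sinhcos k kap) x y.
  rewrite /=; apply: ler_pM; [exact: ltW|exact: ltW|apply: sh_homo; rewrite ler_pM2l//; lra|].
  have ky : `|k * y| <= pi / 4 by rewrite normrM (gtr0_norm k0) -kr ler_pM2l// ler_norml.
  have kyn := normr_ge0 (k * y).
  by rewrite -(cos_norm (k * y)) leNgt ltr_cos ?in_itv/= -?leNgt//; apply/andP; split; lra.
have d0 : 0 <= del by lra.
apply: (@le_trans _ _ (2 * del / pmin c)).
  apply: ler_pM; first exact: sin_poisson_ge0.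
  - by rewrite invr_ge0 mulr_ge0 ?(ltW M0) ?(ltW (ch_gt0 _)).
  - have cx0 : 0 <= 2 * c * x by rewrite !mulr_ge0// ltW.
    have cx1 : c * x <= del by nra.
    apply: (@le_trans _ _ (2 * c * x)); last by lra.
    have := @der_le _ (@sin R) (fun z => z) (@cos R) (fun=> 1) 0 (2 * c * x) cx0.
    by rewrite sin0 !subr0; apply => z _; [exact: is_derive_sin|exact: der_id|exact: cos_le1].
  - rewrite lef_pV2 ?posrE//; first by apply: ler_peMr => //; exact: ltW.
    by apply: mulr_gt0 => //; lra.
apply: (@le_trans _ _ (2 / pmin c / (sh (k * kap) * cos (pi / 4)) * del * (sh (k * kap) * cos (pi / 4)))).
  by rewrite le_eqVlt; apply/orP; left; apply/eqP; field; rewrite !gt_eqF.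
by apply: ler_wpM2l => //; apply: mulr_ge0 => //; apply: divr_ge0; [apply: divr_ge0 => //; exact: ltW|exact: ltW].
Qed.

End SinhCosBounds.

Section NoZerosLimit.
Context {R : realType}.
Implicit Types (D : R -> R -> Prop) (f : R -> R -> cplx R).
Implicit Types (x y Y c e k r t K del S E eta kap : R).

(** Integration over [x] by comparison of derivatives: [m] absorbs the mass for [x <= del], the
    constant [E] that for [x >= del], and the factor 2 bounds the width [pi / 2]. Subtracting [t]
    times the functional of [c / 2] removes the part of large [|y|]. *)
Lemma sum_wronskian_le D f f1 f2 (F : strip_fun D f f1 f2) (m m' : R -> R) e c t del S E eta Y :
  0 < e -> 0 < c < 1 -> 0 <= Y -> 0 < del <= pi / 4 -> 0 <= t -> 0 <= eta ->
  (forall x, 0 <= x <= pi / 2 -> - fluxgap f f1 f2 e c Y x + t * fluxgap f f1 f2 e (c / 2) Y x <= eta) ->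
  (forall x, 0 <= x <= del -> mass f f1 f2 e (poisson c) Y x <= t * mass f f1 f2 e (poisson (c / 2)) Y x + S * m' x) ->
  (forall x, del <= x <= pi / 2 -> mass f f1 f2 e (poisson c) Y x <= t * mass f f1 f2 e (poisson (c / 2)) Y x + E) ->
  (forall x, 0 <= x <= del -> der m x (m' x)) -> 0 <= E ->
  bdry f f1 f2 e c Y <= t * bdry f f1 f2 e (c / 2) Y + S * (m del - m 0) + 2 * (E + eta).
Proof.
move=> e0 c01 Y0 dI t0 eta0 Hf H1 H2 Hm E0; have p2 := @pihalf_lt2 R.
have c201 : 0 < c / 2 < 1 by case/andP : c01 => *; apply/andP; split; lra.
pose G x := wronskian (reglog f f1 f2 e) (poisson c) Y x + - (t * wronskian (reglog f f1 f2 e) (poisson (c / 2)) Y x).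
pose G' x := mass f f1 f2 e (poisson c) Y x - fluxgap f f1 f2 e c Y x
  + - (t * (mass f f1 f2 e (poisson (c / 2)) Y x - fluxgap f f1 f2 e (c / 2) Y x)).
have dG x : 0 <= x <= pi / 2 -> der G x (G' x).
  move=> xI; apply: derD; first exact: (der_wronskian_poisson F).
  apply: derN; have d := der_wronskian_poisson F e0 c201 Y0 xI.
  by apply: der_eq (derM (derC t x) d) _; rewrite mul0r add0r.
have B1 : G del - G 0 <= (S * m del + eta * del) - (S * m 0 + eta * 0).
  apply: (@der_le _ G (fun x => S * m x + eta * x) G' (fun x => S * m' x + eta)).
  - lra.
  - by move=> x xI; apply: dG; lra.
  - move=> x xI; have d := Hm x xI; by der_auto; ring.
  - move=> x xI; have xpi : 0 <= x <= pi / 2 by lra.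
    have := H1 x xI; have := Hf x xpi; rewrite /G'.
    move: (mass f f1 f2 e (poisson c) Y x) (mass f f1 f2 e (poisson (c / 2)) Y x)
      (fluxgap f f1 f2 e c Y x) (fluxgap f f1 f2 e (c / 2) Y x) (m' x) => u1 u2 u3 u4 u5.
    by clear; lra.
have B2 : G (pi / 2) - G del <= (E + eta) * (pi / 2) - (E + eta) * del.
  apply: (@der_le _ G (fun x => (E + eta) * x) G' (fun x => E + eta)).
  - lra.
  - by move=> x xI; apply: dG; lra.
  - by move=> x xI; der_auto; ring.
  - move=> x xI; have xpi : 0 <= x <= pi / 2 by lra.
    have := H2 x xI; have := Hf x xpi; rewrite /G'.
    move: (mass f f1 f2 e (poisson c) Y x) (mass f f1 f2 e (poisson (c / 2)) Y x)
      (fluxgap f f1 f2 e c Y x) (fluxgap f f1 f2 e (c / 2) Y x) (m' x) => u1 u2 u3 u4 u5.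
    by clear; lra.
rewrite !(bdry_wronskian F)//; rewrite /G in B1 B2.
have q1 : (E + eta) * (pi / 2) <= (E + eta) * 2.
  by apply: ler_wpM2l; [exact: addr_ge0|exact: ltW].
have q2 : 0 <= E * del by apply: mulr_ge0 => //; apply: ltW; case/andP : dI.
move: B1 B2 q1 q2; set v := reglog f f1 f2 e.
move: (wronskian v (poisson c) Y) (wronskian v (poisson (c / 2)) Y) => w1 w2.
move: (w1 0) (w1 del) (w1 (pi / 2)) (w2 0) (w2 del) (w2 (pi / 2)) (m del) (m 0) (pi / 2).
by clear; move=> *; lra.
Qed.

(** The parameters are chosen in the order [t] (weight of the comparison kernel), [r] (height beyond
    which it dominates), [del] (width at the edge), [e0], [Y0], each depending on the earlier ones
    only. *)
Lemma bdry_le_small D f f1 f2 (F : strip_fun D f f1 f2) c eta : 0 < c < 1 -> 0 < eta ->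
  (forall x y, 0 < x <= pi / 2 -> cnorm2 (f x y) != 0) ->
  exists2 e0 : R, 0 < e0 <= 1 & forall e, 0 < e <= e0 -> exists2 Y0 : R, 1 <= Y0 &
  forall Y, Y0 <= Y -> bdry f f1 f2 e c Y <= eta.
Proof.
move=> c01 eta0 nz; have p := @pi_gt0 R.
have c201 : 0 < c / 2 < 1 by case/andP : c01 => *; apply/andP; split; lra.
have [C1 C10 HC1] := bdry_le F c201.
(* [C1] bounds the functional of [c / 2] uniformly in [e], so the far part costs at most
   [eta / 8]. *)
pose t := eta / 8 / C1; have t0 : 0 < t by rewrite !divr_gt0.
have [r r0 Hr] := poisson_half_tail c01 t0.
have T0 : 0 < 2 * r by rewrite mulr_gt0.
have [kap [C2' [kap0 C20 Hth]]] := mass_near_left_edge F T0.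
have [K K0 HK] := poisson_le_sinhcos c01 r0 kap0.
(* [C2'] bounds the edge mass uniformly in [e], and [K * del] is the ratio of the kernels there. *)
pose del := Num.min (eta / 8 / (K * C2')) (pi / 4).
have KC : 0 < K * C2' by rewrite mulr_gt0.
have del0 : 0 < del by rewrite lt_min !divr_gt0.
have del1 : del <= pi / 4 by rewrite ge_min lexx orbT.
have del2 : K * del * C2' <= eta / 8.
  have h : del <= eta / 8 / (K * C2') by rewrite ge_min lexx.
  by rewrite mulrAC mulrC -ler_pdivlMr.
have [C3 C30 HC3] := mass_inner_le F del0 r0 c01 nz.
have e00 : 0 < Num.min 1 (eta / 16 / C3) by rewrite lt_min ltr01 !divr_gt0.
exists (Num.min 1 (eta / 16 / C3)); first by rewrite e00 ge_min lexx.
move=> e /andP[ep]; rewrite le_min => /andP[e1 e2].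
have e01 : 0 < e <= 1 by rewrite ep.
have e2Q : C3 * e ^+ 2 <= eta / 16.
  by rewrite mulrC -ler_pdivlMr//; apply: le_trans e2; rewrite expr2 ler_piMl// ltW.
have [MM [MM' [HM1 HM2 HM3]]] := Hth e e01.
have HM0 x : - kap <= x <= pi / 2 -> 0 <= MM' x.
  move=> xI; apply: le_trans (HM2 x xI); apply: Int_ge0 => y yI.
  by apply: mulr_ge0; [exact: laplacian_reglog_ge0|apply: sinhcos_ge0 => //; case/andP : xI].
have dpi : del <= pi / 2 by apply: le_trans del1 _; lra.
have MMd : MM del - MM 0 <= C2'.
  have k0' : - kap <= 0 by rewrite oppr_le0 ltW.
  have h1 : MM (- kap) <= MM 0.
    apply: (@der_homo _ MM MM') => // x /andP[x1 x2]; [apply: HM1|apply: HM0]; rewrite x1/=;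
      exact: le_trans x2 (le_trans (ltW del0) dpi).
  have h2 : MM del <= MM (pi / 2).
    apply: (@der_homo _ MM MM') => // x /andP[x1 x2]; [apply: HM1|apply: HM0]; rewrite x2 andbT;
      exact: le_trans k0' (le_trans (ltW del0) x1).
  by apply: le_trans HM3; apply: lerB.
have eta32 : 0 < eta / 32 by rewrite divr_gt0.
have eta32t : 0 < eta / 32 / t by rewrite divr_gt0.
have [Y1 Y11 HY1] := fluxgap_small F e01 c01 eta32.
have [Y2 Y21 HY2] := fluxgap_small F e01 c201 eta32t.
have Y10 : 0 <= Y1 by apply: le_trans Y11.
have Y20 : 0 <= Y2 by apply: le_trans Y21.
exists (Y1 + Y2 + 2 * r); first by rewrite -addrA (le_trans Y11)// lerDl addr_ge0// ltW.
move=> Y YY; have YY1 : Y1 <= Y by apply: le_trans YY; rewrite -addrA lerDl addr_ge0// ltW.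
have YY2 : Y2 <= Y by apply: le_trans YY; rewrite addrAC lerDr addr_ge0// ltW.
have Yr : r <= Y.
  by apply: le_trans YY; rewrite mulr_natl mulr2n addrA lerDr addr_ge0 ?addr_ge0// ltW.
have Yp : 0 <= Y by apply: le_trans YY1.
have rY : 0 <= r <= Y by rewrite (ltW r0).
have eta16 : 0 <= eta / 16 by rewrite ltW// divr_gt0.
have del01 : 0 < del <= pi / 4 by rewrite del0.
have := @sum_wronskian_le D f f1 f2 F MM MM' e c t del (K * del) (eta / 16) (eta / 16) Y ep c01 Yp.
move=> /(_ del01 (ltW t0) eta16 _ _ _ _ eta16)/wrap[||||H].
- move=> x xI; have := HY1 Y x YY1 xI; have := HY2 Y x YY2 xI.
  rewrite !ler_norml => /andP[_ b1] /andP[a1 _].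
  have b2 := ler_wpM2l (ltW t0) b1.
  have b3 : t * (eta / 32 / t) = eta / 32 by field; lra.
  move: b2 a1; rewrite b3; clear; lra.
- move=> x xI; have xpi : 0 <= x <= pi / 2 by case/andP : xI => -> /= x2; exact: le_trans dpi.
  apply: le_trans (mass_tail F ep c01 (ltW t0) rY xpi Hr) _; apply: lerD => //.
  have Kd : 0 <= K * del by rewrite mulr_ge0 ?ltW.
  have xk : - kap <= x by case/andP : xI => x1 _; apply: le_trans x1; rewrite oppr_le0 ltW.
  apply: le_trans (mass_edge_le F ep c01 r0 Kd xI del1 _ (fun y => HK del x y xI del1)) _.
    by move=> y yI; exact: sinhcos_ge0.
  by apply: ler_wpM2l => //; apply: HM2; rewrite xk; case/andP : xpi.
- move=> x xI; have xpi : 0 <= x <= pi / 2 by case/andP : xI => x1 ->; rewrite andbT; exact: le_trans (ltW del0) x1.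
  apply: le_trans (mass_tail F ep c01 (ltW t0) rY xpi Hr) _; apply: lerD => //.
  exact: le_trans (HC3 e x e01 xI) e2Q.
- move=> x /andP[x1 x2]; apply: HM1; rewrite (le_trans _ x1) ?oppr_le0 ?(ltW kap0)//=; exact: le_trans dpi.
apply: le_trans H _; have B2 := ler_wpM2l (ltW t0) (HC1 e Y e01 Yp).
have B3 : t * C1 = eta / 8 by rewrite /t; field; lra.
have B4 : K * del * (MM del - MM 0) <= K * del * C2' by apply: ler_wpM2l => //; rewrite mulr_ge0 ?ltW.
move: B2 B4 del2 eta0; rewrite B3; clear; lra.
Qed.

End NoZerosLimit.

(** * The regularised Green function of the strip *)

Section GreenFunction.
Context {R : realType}.
Implicit Types (x y e eta r d c t : R).

(** At [eta = 0] this is [2 * |sin (z - z1)| ^ 2] with [z1 = x1 + i y1], so half its logarithm is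
    [ln |sin (z - z1)|] up to a constant. *)
Definition lden x1 y1 eta : @jet R := Jet (fun x y => ch (2 * (y - y1)) - cos (2 * (x - x1)) + eta)
  (fun x y => 2 * sin (2 * (x - x1))) (fun x y => 2 * sh (2 * (y - y1)))
  (fun x y => 4 * cos (2 * (x - x1))) (fun x y => 4 * ch (2 * (y - y1))).

(* The Green function of the strip with pole [x0 + iy0], regularised at scale [sqrt eta] so that
   it stays smooth and still vanishes at [x = 0]. *)
Definition green x0 y0 eta := jet_sub (jet_ln (lden (- x0) y0 eta)) (jet_ln (lden x0 y0 eta)).

Lemma lden_ge x1 y1 eta x y : 0 < eta <= 1 -> eta * ch (2 * (y - y1)) <= j0 (lden x1 y1 eta) x y.
Proof.
move=> /andP[e0 e1]; rewrite /=; have := ch_ge1 (2 * (y - y1)); have := cos_le1 (2 * (x - x1)).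
move: (ch _) (cos _) => C c c1 C1; nra.
Qed.

Lemma lden_gt0 x1 y1 eta x y : 0 < eta <= 1 -> 0 < j0 (lden x1 y1 eta) x y.
Proof.
move=> e01; apply: lt_le_trans (lden_ge x1 y1 x y e01); case/andP : e01 => e0 _.
by apply: mulr_gt0 => //; exact: ch_gt0.
Qed.

Lemma C2_lden x1 y1 eta x y : C2 (lden x1 y1 eta) x y.
Proof.
have ccos : cont2 (fun x _ => cos (2 * (x - x1))) x y.
  apply: (cont2_fst (h := fun x => cos (2 * (x - x1)))).
  by apply: (@der_continuous _ _ _ (- (2 * sin (2 * (x - x1))))); der_auto; ring.
have csin : cont2 (fun x _ => sin (2 * (x - x1))) x y.
  apply: (cont2_fst (h := fun x => sin (2 * (x - x1)))).
  by apply: (@der_continuous _ _ _ (2 * cos (2 * (x - x1)))); der_auto; ring.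
have cch : cont2 (fun _ y => ch (2 * (y - y1))) x y.
  apply: (cont2_snd (h := fun y => ch (2 * (y - y1)))).
  by apply: (@der_continuous _ _ _ (2 * sh (2 * (y - y1)))); der_auto; ring.
have csh : cont2 (fun _ y => sh (2 * (y - y1))) x y.
  apply: (cont2_snd (h := fun y => sh (2 * (y - y1)))).
  by apply: (@der_continuous _ _ _ (2 * ch (2 * (y - y1)))); der_auto; ring.
have cC (z : R) : cont2 (fun _ _ => z) x y by exact: cont2C.
split => /=.
- by der_auto; ring.
- by der_auto; ring.
- by der_auto; ring.
- by der_auto; ring.
- by apply: cont2D => //; apply: cont2D => //; exact: cont2N.
- exact: cont2M.
- exact: cont2M.
- exact: cont2M.
- exact: cont2M.
Qed.

Lemma C2_green x0 y0 eta x y : 0 < eta <= 1 -> C2 (green x0 y0 eta) x y.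
Proof. by move=> e01; apply: C2_sub; apply: C2_ln; [exact: lden_gt0|exact: C2_lden|exact: lden_gt0|exact: C2_lden]. Qed.

Lemma laplacian_lden x1 y1 eta x y : 0 < eta <= 1 ->
  laplacian (jet_ln (lden x1 y1 eta)) x y =
  2 * eta * (ch (2 * (y - y1)) + cos (2 * (x - x1))) / j0 (lden x1 y1 eta) x y ^+ 2.
Proof.
move=> e01; have g0 := lden_gt0 x1 y1 x y e01; rewrite laplacian_ln ?gt_eqF//.
have g1 : j0 (lden x1 y1 eta) x y != 0 by rewrite gt_eqF.
have h2 : sh (2 * (y - y1)) ^+ 2 = ch (2 * (y - y1)) ^+ 2 - 1 by have := chE (2 * (y - y1)); lra.
have s2 : sin (2 * (x - x1)) ^+ 2 = 1 - cos (2 * (x - x1)) ^+ 2.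
  by have := cos2Dsin2 (2 * (x - x1)); lra.
have e : j0 (lden x1 y1 eta) x y * laplacian (lden x1 y1 eta) x y - jx (lden x1 y1 eta) x y ^+ 2
    - jy (lden x1 y1 eta) x y ^+ 2 = 4 * eta * (ch (2 * (y - y1)) + cos (2 * (x - x1))).
  rewrite /laplacian /=.
  transitivity ((ch (2 * (y - y1)) - cos (2 * (x - x1)) + eta) * (4 * cos (2 * (x - x1)) + 4 * ch (2 * (y - y1)))
    - 4 * sin (2 * (x - x1)) ^+ 2 - 4 * sh (2 * (y - y1)) ^+ 2); first by ring.
  by rewrite h2 s2; ring.
rewrite e; move: (j0 _ _ _) g1 => g g1; by field.
Qed.

Lemma ch_shift x0 y : ch y <= 2 * ch x0 * ch (y - x0).
Proof.
have -> : ch y = ch (y - x0 + x0) by rewrite subrK.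
rewrite chD; have := sh_le_ch (y - x0); have := sh_le_ch x0; rewrite !ler_norml.
have := ch_gt0 x0; have := ch_gt0 (y - x0).
move: (ch x0) (ch (y - x0)) (sh x0) (sh (y - x0)) => a b c d ? ? /andP[? ?] /andP[? ?]; nra.
Qed.

Lemma sin_scale c t : 0 <= c <= 1 -> 0 <= t <= pi -> c * sin t <= sin (c * t).
Proof.
move=> /andP[c0 c1] /andP[t0 t1].
have := @der_homo R (fun t => sin (c * t) - c * sin t) (fun t => c * (cos (c * t) - cos t)) 0 t t0.
rewrite !mulr0 !sin0 mulr0 subr0 subr_ge0; apply.
  by move=> z _; der_auto; ring.
move=> z /andP[z0 zt]; apply: mulr_ge0 => //; rewrite subr_ge0.
by rewrite leNgt ltr_cos ?in_itv/= -?leNgt//; [nra|apply/andP; split; nra|apply/andP; split; nra].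
Qed.

Section Pole.
Variables (x0 y0 : R).
Hypothesis x0I : 0 < x0 < pi / 2.
Local Notation S0 := (sin (2 * x0)).
Local Notation q := (1 - `|cos (2 * x0)|).
Local Notation E y := (ch (2 * (y - y0))).

Lemma sin2x0_gt0 : 0 < S0.
Proof. by move: x0I => H; apply: sin_gt0_pi; lra. Qed.

Lemma q_gt0 : 0 < q.
Proof.
rewrite subr_gt0; have := sin2x0_gt0; have := cos2Dsin2 (2 * x0).
by rewrite -[cos _ ^+ 2]real_normK ?num_real//; have := normr_ge0 (cos (2 * x0)); nra.
Qed.

Lemma E_ge1 y : 1 <= E y. Proof. exact: ch_ge1. Qed.

Lemma E_ge y : ch (2 * y) <= 2 * ch (2 * y0) * E y.
Proof. by rewrite (_ : 2 * (y - y0) = 2 * y - 2 * y0); [exact: ch_shift|ring]. Qed.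

Lemma lden_diff eta x y : j0 (lden (- x0) y0 eta) x y - j0 (lden x0 y0 eta) x y = 2 * sin (2 * x) * S0.
Proof.
by rewrite /= opprK !mulrDr !mulrN !cosD cosN sinN; ring.
Qed.

(** The mirrored pole [- x0] lies outside the strip: there [cos (2 (x + x0)) <= |cos (2 x0)| < 1],
    and [q] measures the gap. *)
Lemma ldenN_ge eta x y : 0 < eta -> 0 <= x <= pi / 2 -> q * E y <= j0 (lden (- x0) y0 eta) x y.
Proof.
move=> e0 xI; rewrite /= opprK; have c1 : cos (2 * (x + x0)) <= `|cos (2 * x0)|.
  rewrite mulrDr cosD; have s1 : 0 <= sin (2 * x) by apply: sin_ge0_pi; lra.
  have := sin2x0_gt0; have := ler_norm (cos (2 * x0)); have := ler_normr (- cos (2 * x0)) (cos (2 * x0)).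
  have a1 := cos_le1 (2 * x); have a2 := cos_geN1 (2 * x).
  have n0 := normr_ge0 (cos (2 * x0)).
  have : `|cos (2 * x) * cos (2 * x0)| <= `|cos (2 * x0)|.
    by rewrite normrM ler_piMl// ler_norml a1 a2.
  by have := ler_norm (cos (2 * x) * cos (2 * x0)); nra.
have := E_ge1 y; have := normr_ge0 (cos (2 * x0)); nra.
Qed.

Lemma green_ge0 eta x y : 0 < eta <= 1 -> 0 <= x <= pi / 2 -> 0 <= j0 (green x0 y0 eta) x y.
Proof.
move=> e01 xI; rewrite [j0 _ _ _]/= -mulrBr mulr_ge0// subr_ge0.
have := lden_diff eta x y; have := lden_gt0 x0 y0 x y e01; have := lden_gt0 (- x0) y0 x y e01.
rewrite /= => a1 a2 a3; rewrite ler_ln ?posrE//.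
have s1 : 0 <= sin (2 * x) by apply: sin_ge0_pi; lra.
by have := sin2x0_gt0; nra.
Qed.

Lemma green_0 eta y : j0 (green x0 y0 eta) 0 y = 0.
Proof. by rewrite /= opprK sub0r add0r mulrN cosN subrr. Qed.

Lemma green_le_sin eta x y : 0 < eta <= 1 -> 0 <= x <= pi / 2 ->
  j0 (green x0 y0 eta) x y <= sin (2 * x) * S0 / j0 (lden x0 y0 eta) x y.
Proof.
move=> e01 xI; have a1 := lden_gt0 x0 y0 x y e01; have a2 := lden_gt0 (- x0) y0 x y e01.
have a3 := lden_diff eta x y.
have -> : j0 (green x0 y0 eta) x y = 2^-1 * (ln (j0 (lden (- x0) y0 eta) x y) - ln (j0 (lden x0 y0 eta) x y)).
  by rewrite mulrBr.
rewrite -ln_div ?posrE//.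
move: (j0 (lden (- x0) y0 eta) x y) (j0 (lden x0 y0 eta) x y) a1 a2 a3 => p g g0 p0 a3.
have := @le_ln1Dx R (p / g - 1); rewrite (_ : 1 + (p / g - 1) = p / g); last by ring.
have pg : 0 < p / g by exact: divr_gt0.
move=> /(_ _)/wrap[|H]; first lra.
have e : p / g - 1 = 2 * (sin (2 * x) * S0 / g).
  have -> : 2 * (sin (2 * x) * S0 / g) = 2 * sin (2 * x) * S0 / g by ring.
  by rewrite -a3; field; lra.
lra.
Qed.

(* Away from the pole [lden] is comparable to [E y]; near it the logarithm is at most [ln (1 / eta)]. *)
Lemma green_le_E : exists2 C : R, 0 < C & forall eta x y, 0 < eta <= 1 -> 1 <= - ln eta ->
  0 <= x <= pi / 2 -> j0 (green x0 y0 eta) x y <= C * - ln eta * (sin (2 * x) / E y).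
Proof.
have s0 := sin2x0_gt0; have s1 := sin_le1 (2 * x0).
(* Chosen so that [lden < r * E y] forces [|sin (2 (x - x0))| <= S0 / 4], whence
   [sin (2 x) >= S0 / 2]: near the pole the right-hand side is then not small. *)
pose r := S0 ^+ 2 / 32; have r0 : 0 < r by rewrite divr_gt0// exprn_gt0.
have r1 : r <= 1 / 32 by rewrite /r; nra.
have ir : 0 < r^-1 by rewrite invr_gt0.
have iS : 0 < 8 / S0 by rewrite divr_gt0.
exists (r^-1 + 8 / S0); first by rewrite addr_gt0.
move=> eta x y e01 L1 xI; have [e0 e1] : 0 < eta /\ eta <= 1 by apply/andP.
have sx : 0 <= sin (2 * x) by apply: sin_ge0_pi; lra.
have E1 := E_ge1 y; have E0 : 0 < E y by lra.
set L := - ln eta in L1 *.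
have sE : 0 <= sin (2 * x) / E y by rewrite divr_ge0// ltW.
have LsE : 0 <= L * (sin (2 * x) / E y) by rewrite mulr_ge0//; lra.
have [A|B] := lerP (r * E y) (j0 (lden x0 y0 eta) x y).
  apply: le_trans (green_le_sin y e01 xI) _.
  apply: (@le_trans _ _ (sin (2 * x) / (r * E y))).
    apply: ler_pM; [by rewrite mulr_ge0// ltW|by rewrite invr_ge0 ltW// lden_gt0| |].
      by rewrite ler_piMr.
    by rewrite lef_pV2 ?posrE ?lden_gt0// mulr_gt0.
  have -> : sin (2 * x) / (r * E y) = r^-1 * (sin (2 * x) / E y) by field; rewrite !gt_eqF.
  apply: (@le_trans _ _ (r^-1 * (L * (sin (2 * x) / E y)))).
    by rewrite ler_pM2l// ler_peMl.
  rewrite -mulrA ler_wpM2r//; lra.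
pose d := 2 * (x - x0); have Gm : j0 (lden x0 y0 eta) x y = E y - cos d + eta by [].
have cd : (1 - r) * E y < cos d by rewrite Gm in B; lra.
have cd1 := cos_le1 d; have rE : (1 - r) * E y <= 1 by lra.
have cd2 : 1 - r <= cos d by nra.
have sd : `|sin d| <= S0 / 4.
  have := cos2Dsin2 d; rewrite -[sin d ^+ 2]real_normK ?num_real// => H.
  have : `|sin d| ^+ 2 <= (S0 / 4) ^+ 2 by rewrite /r in cd2; nra.
  by rewrite ler_sqr ?nnegrE//; rewrite divr_ge0// ltW.
have s2 : S0 / 2 <= sin (2 * x).
  have -> : sin (2 * x) = S0 * cos d + cos (2 * x0) * sin d.
    by rewrite -sinD; congr sin; rewrite /d; ring.
  have : `|cos (2 * x0) * sin d| <= S0 / 4.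
    by rewrite normrM; apply: le_trans sd; rewrite ler_piMl// ler_norml cos_le1 cos_geN1.
  rewrite ler_norml => /andP[h1 _].
  have : S0 * (1 - r) <= S0 * cos d by rewrite ler_pM2l.
  have : S0 * r <= S0 * (1 / 32) by rewrite ler_pM2l.
  lra.
have g1 : j0 (green x0 y0 eta) x y <= 2 * L.
  have a1 := lden_gt0 x0 y0 x y e01; have a2 := lden_gt0 (- x0) y0 x y e01.
  have lm : ln eta <= ln (j0 (lden x0 y0 eta) x y).
    rewrite ler_ln ?posrE//; apply: le_trans (lden_ge x0 y0 x y e01).
    by rewrite ler_peMr// ltW.
  have lp : ln (j0 (lden (- x0) y0 eta) x y) <= 3.
    have p4 : j0 (lden (- x0) y0 eta) x y <= 4.
      by rewrite /=; have := cos_geN1 (2 * (x - - x0)); nra.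
    apply: (@le_trans _ _ (j0 (lden (- x0) y0 eta) x y - 1)); last by lra.
    have := @le_ln1Dx R (j0 (lden (- x0) y0 eta) x y - 1); rewrite (_ : 1 + (_ - 1) = j0 (lden (- x0) y0 eta) x y); last by ring.
    by apply; lra.
  have -> : j0 (green x0 y0 eta) x y = 2^-1 * (ln (j0 (lden (- x0) y0 eta) x y) - ln (j0 (lden x0 y0 eta) x y)).
    by rewrite mulrBr.
  rewrite /L in L1 *; lra.
apply: le_trans g1 _.
have k1 : S0 / 4 <= sin (2 * x) / E y.
  rewrite ler_pdivlMr//; apply: le_trans s2.
  have E2 : E y <= 2 by nra.
  by have := ler_wpM2l (ltW s0) E2; lra.
have k2 : 0 <= r^-1 * (L * (sin (2 * x) / E y)) by apply: mulr_ge0 => //; exact: ltW.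
have k3 : 8 / S0 * (L * (S0 / 4)) <= 8 / S0 * (L * (sin (2 * x) / E y)).
  by rewrite ler_pM2l// ler_wpM2l//; lra.
have k4 : 8 / S0 * (L * (S0 / 4)) = 2 * L by field; lra.
rewrite mulrDl mulrDl -!mulrA; rewrite k4 in k3; rewrite -!mulrA in k2 k3; lra.
Qed.

(** [sin (2 x) <= 2 * sin (2 c x)] and [pden <= 2 * ch (2 y)] hold for all [c] in [[1 / 2, 1[]
    alike. The uniformity in [c] lets the contribution of a zero survive the limit [c = 1]. *)
Lemma green_le_poisson : exists2 C : R, 0 < C & forall eta c x y, 0 < eta <= 1 -> 1 <= - ln eta ->
  1 / 2 <= c < 1 -> 0 <= x <= pi / 2 ->
  j0 (green x0 y0 eta) x y <= C * - ln eta * j0 (poisson c) x y.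
Proof.
have [C C0 HC] := green_le_E; have c2 := ch_gt0 (2 * y0).
exists (C * (8 * ch (2 * y0))); first by rewrite mulr_gt0// mulr_gt0.
move=> eta c x y e01 L1 cI xI; apply: le_trans (HC eta x y e01 L1 xI) _.
set L := - ln eta in L1 *; have CL : 0 <= C * L by apply: mulr_ge0; lra.
rewrite (_ : C * (8 * ch (2 * y0)) * L * j0 (poisson c) x y =
  C * L * (8 * ch (2 * y0) * j0 (poisson c) x y)); last by ring.
apply: ler_wpM2l => //; have c01 : 0 < c < 1 by lra.
have [c12 c1] : 1 / 2 <= c /\ c < 1 by apply/andP.
have p := @pi_gt0 R.
have xI2 : 0 <= 2 * x <= pi by lra.
have s1 : sin (2 * x) <= 2 * sin (2 * c * x).
  have := @sin_scale c (2 * x); rewrite (_ : c * (2 * x) = 2 * c * x); last by ring.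
  move=> /(_ _ xI2)/wrap[|H]; first lra.
  have := sin_ge0_pi xI2; nra.
have ss : 0 <= sin (2 * c * x) by exact: sin_poisson_ge0.
have d0 := pden_gt0 y c01 xI; have E0 : 0 < E y by exact: ch_gt0.
have d1 : pden c x y <= 2 * ch (2 * y).
  have h1 : ch (2 * c * y) <= ch (2 * y).
    rewrite -(ch_norm (2 * c * y)) -(ch_norm (2 * y)); apply: ch_homo => //.
    by rewrite !normrM normr_nat ler_wpM2r// ger0_norm; lra.
  by rewrite /pden; have := cos_le1 (2 * c * x); have := ch_ge1 (2 * y); lra.
have Ey := E_ge y.
rewrite /= ler_pdivrMr// mulrAC mulrA ler_pdivlMr//.
have pd : pden c x y <= 4 * ch (2 * y0) * E y by lra.
have : sin (2 * x) * pden c x y <= 2 * sin (2 * c * x) * (4 * ch (2 * y0) * E y).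
  by apply: ler_pM => //; [exact: sin_ge0_pi|exact: ltW].
lra.
Qed.

Lemma green_x0 eta y : 0 < eta <= 1 -> 0 <= jx (green x0 y0 eta) 0 y <= 2 / (q * E y).
Proof.
move=> e01; have e0 : 0 < eta by case/andP : e01.
have p := @pi_gt0 R; have i0 : 0 <= (0 : R) <= pi / 2 by apply/andP; split; lra.
have G := ldenN_ge y e0 i0; have E0 : 0 < E y by exact: ch_gt0.
have qE : 0 < q * E y by apply: mulr_gt0 => //; exact: q_gt0.
have e : jx (green x0 y0 eta) 0 y = 2 * S0 / j0 (lden (- x0) y0 eta) 0 y.
  have g0 := lden_gt0 (- x0) y0 0 y e01; move: g0.
  rewrite /= opprK sub0r add0r mulrN sinN cosN => g0; by field; lra.
have g0 : 0 < j0 (lden (- x0) y0 eta) 0 y by exact: lden_gt0.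
have s0 := sin2x0_gt0; rewrite e; apply/andP; split; first by rewrite divr_ge0 ?mulr_ge0// ltW.
apply: ler_pM; [by rewrite mulr_ge0// ltW|by rewrite invr_ge0 ltW| |by rewrite lef_pV2 ?posrE].
by have := sin_le1 (2 * x0); lra.
Qed.

Lemma green_xpi2 eta y : 0 < eta <= 1 -> - (2 / (q * E y)) <= jx (green x0 y0 eta) (pi / 2) y <= 0.
Proof.
move=> e01; have e0 : 0 < eta by case/andP : e01.
have p := @pi_gt0 R; have i0 : 0 <= (pi / 2 : R) <= pi / 2 by apply/andP; split; lra.
have G := ldenN_ge y e0 i0; have E0 : 0 < E y by exact: ch_gt0.
have qE : 0 < q * E y by apply: mulr_gt0 => //; exact: q_gt0.
have e : jx (green x0 y0 eta) (pi / 2) y = - (2 * S0 / j0 (lden (- x0) y0 eta) (pi / 2) y).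
  have g0 := lden_gt0 (- x0) y0 (pi / 2) y e01; move: g0.
  rewrite /= opprK; have -> : 2 * (pi / 2 + x0) = 2 * x0 + pi by field.
  have -> : 2 * (pi / 2 - x0) = - (2 * x0) + pi by field.
  rewrite !cosDpi !sinDpi cosN sinN => g0; by field; lra.
have g0 : 0 < j0 (lden (- x0) y0 eta) (pi / 2) y by exact: lden_gt0.
have s0 := sin2x0_gt0; rewrite e oppr_le0 lerN2; apply/andP; split; last by rewrite divr_ge0 ?mulr_ge0// ltW.
apply: ler_pM; [by rewrite mulr_ge0// ltW|by rewrite invr_ge0 ltW| |by rewrite lef_pV2 ?posrE].
by have := sin_le1 (2 * x0); lra.
Qed.

(** Crude in [eta], but applied only with [eta] fixed and [Y] tending to infinity. *)
Lemma green_flux_le eta x y : 0 < eta <= 1 -> 0 <= x <= pi / 2 ->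
  j0 (green x0 y0 eta) x y <= eta^-1 / E y /\ `|jy (green x0 y0 eta) x y| <= 2 / eta ^+ 2 / E y.
Proof.
move=> e01 xI; have e0 : 0 < eta by case/andP : e01.
have sx : 0 <= sin (2 * x) by apply: sin_ge0_pi; lra.
have s0 := sin2x0_gt0; have E0 : 0 < E y by exact: ch_gt0.
have a1 := lden_gt0 x0 y0 x y e01; have a2 := lden_gt0 (- x0) y0 x y e01.
have b1 := lden_ge x0 y0 x y e01; have b2 := lden_ge (- x0) y0 x y e01.
have eE : 0 < eta * E y by exact: mulr_gt0.
have ss : sin (2 * x) * S0 <= 1.
  have s0' := ltW s0; have l1 := sin_le1 (2 * x); have l2 := sin_le1 (2 * x0); exact: mulr_ile1.
have ss0 : 0 <= sin (2 * x) * S0 by rewrite mulr_ge0// ltW.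
split.
  apply: le_trans (green_le_sin y e01 xI) _; rewrite -invfM -[leRHS]mul1r.
  by apply: ler_pM => //; [rewrite invr_ge0 ltW|rewrite lef_pV2 ?posrE].
have -> : jy (green x0 y0 eta) x y =
    - (sh (2 * (y - y0)) * (2 * (sin (2 * x) * S0)) / (j0 (lden (- x0) y0 eta) x y * j0 (lden x0 y0 eta) x y)).
  have -> : 2 * (sin (2 * x) * S0) = j0 (lden (- x0) y0 eta) x y - j0 (lden x0 y0 eta) x y.
    by rewrite lden_diff mulrA.
  have -> : jy (green x0 y0 eta) x y = 2 * sh (2 * (y - y0)) / (2 * j0 (lden (- x0) y0 eta) x y)
    - 2 * sh (2 * (y - y0)) / (2 * j0 (lden x0 y0 eta) x y) by [].
  by move: (j0 (lden (- x0) y0 eta) x y) (j0 (lden x0 y0 eta) x y) a1 a2 => p g g0 p0; field; lra.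
have gg : 0 < j0 (lden (- x0) y0 eta) x y * j0 (lden x0 y0 eta) x y by exact: mulr_gt0.
rewrite normrN normrM normfV (gtr0_norm gg) normrM (ger0_norm (mulr_ge0 _ ss0))//.
apply: (@le_trans _ _ (E y * 2 / (eta * E y * (eta * E y)))).
  apply: ler_pM; [by apply: mulr_ge0 => //; exact: mulr_ge0|by rewrite invr_ge0 ltW| |].
    by apply: ler_pM; rewrite ?sh_le_ch ?mulr_ge0//; lra.
  rewrite lef_pV2 ?posrE//; last exact: mulr_gt0.
  by apply: ler_pM => //; exact: ltW.
by rewrite le_eqVlt; apply/orP; left; apply/eqP; field; rewrite !gt_eqF.
Qed.

End Pole.
End GreenFunction.

Section GreenLaplacian.
Context {R : realType}.
Implicit Types (x y e eta : R).

Lemma ch_near0 (z : R) : `|z| <= 1 / 2 -> ch z <= 1 + 2 * z ^+ 2.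
Proof.
move=> z12; rewrite -ch_norm; have -> : z ^+ 2 = `|z| ^+ 2 by rewrite real_normK ?num_real.
have := normr_ge0 z; move: `|z| z12 => {}z z12 z0.
have ez : ch z <= 2.
  apply: le_trans (ch_le z) _; rewrite ger0_norm//.
  apply: (@le_trans _ _ (expR (1 / 2))); first by rewrite ler_expR.
  rewrite -[leRHS]lnK ?posrE// ler_expR.
  have := @le_ln1Dx R (- (1 / 2)); rewrite (_ : 1 + - (1 / 2) = 2^-1); last by field.
  by rewrite lnV ?posrE// => /(_ _)/wrap[|H]; lra.
have [a /andP[a0 a1] ha] := @der_mvt R ch sh 0 z z0 (fun z _ => der_ch z).
have [b /andP[b0 b1] hb] := @der_mvt R sh ch 0 a a0 (fun z _ => der_sh z).
rewrite ch0 subr0 in ha; rewrite sh0 !subr0 in hb.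
have cb : ch b <= 2 by apply: le_trans ez; apply: ch_homo => //; exact: le_trans a1.
have : sh a <= 2 * z by rewrite hb; apply: ler_pM => //; exact: ltW (ch_gt0 b).
nra.
Qed.

Lemma cos_near0 (z : R) : 1 - z ^+ 2 / 2 <= cos z.
Proof.
have h : 0 <= `|z| by [].
have := @der_homo R (fun t => cos t + t ^+ 2 / 2) (fun t => - sin t + t) 0 `|z| h.
rewrite cos0 cos_norm expr0n/= mul0r addr0 real_normK ?num_real// => H.
suff : 1 <= cos z + z ^+ 2 / 2 by lra.
apply: H.
  by move=> t _; der_auto; field.
move=> t /andP[t0 _]; rewrite addrC subr_ge0.
have := @der_le R sin (fun z => z) cos (fun=> 1) 0 t t0; rewrite sin0 !subr0; apply => u _.
- exact: is_derive_sin.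
- exact: der_id.
- exact: cos_le1.
Qed.

Lemma laplacian_green x0 y0 eta x y : 0 < eta <= 1 -> laplacian (green x0 y0 eta) x y =
  laplacian (jet_ln (lden (- x0) y0 eta)) x y - laplacian (jet_ln (lden x0 y0 eta)) x y.
Proof. by move=> e01; rewrite laplacian_sub. Qed.

Lemma laplacian_lden_ge0 x1 y1 eta x y : 0 < eta <= 1 -> 0 <= laplacian (jet_ln (lden x1 y1 eta)) x y.
Proof.
move=> e01; rewrite laplacian_lden// divr_ge0 ?sqr_ge0//; have [e0 _] := andP e01.
rewrite mulr_ge0//; first by rewrite mulr_ge0// ltW.
by have := ch_ge1 (2 * (y - y1)); have := cos_geN1 (2 * (x - x1)); lra.
Qed.

(** The mirrored pole stays at a distance from the strip, so smoothing it costs only [O(eta)]. *)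
Lemma laplacian_ldenN_le x0 y0 : 0 < x0 < pi / 2 -> exists2 C : R, 0 < C &
  forall eta x y, 0 < eta <= 1 -> 0 <= x <= pi / 2 ->
  laplacian (jet_ln (lden (- x0) y0 eta)) x y <= C * eta / ch (2 * y).
Proof.
move=> x0I; have q0 := q_gt0 x0I; set q := (1 - _) in q0.
have c0 := ch_gt0 (2 * y0).
exists (8 * ch (2 * y0) / q ^+ 2); first by apply: divr_gt0; [rewrite mulr_gt0|rewrite exprn_gt0].
move=> eta x y e01 xI; rewrite laplacian_lden//; have [e0 e1] := andP e01.
have G := ldenN_ge y0 x0I y e0 xI; rewrite -/q in G.
set g := j0 _ _ _ in G *; set E := ch (2 * (y - y0)) in G *.
have E1 : 1 <= E by exact: ch_ge1.
have qE : 0 < q * E by rewrite mulr_gt0//; lra.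
have g0 : 0 < g by lra.
have Ey : ch (2 * y) <= 2 * ch (2 * y0) * E by exact: E_ge.
have cy := ch_gt0 (2 * y).
apply: (@le_trans _ _ (2 * eta * (2 * E) / (q * E) ^+ 2)).
  apply: ler_pM.
  - rewrite mulr_ge0//; first by rewrite mulr_ge0// ltW.
    by have := cos_geN1 (2 * (x - - x0)); lra.
  - by rewrite invr_ge0 sqr_ge0.
  - apply: ler_wpM2l; first by rewrite mulr_ge0// ltW.
    by have := cos_le1 (2 * (x - - x0)); lra.
  - by rewrite lef_pV2 ?posrE ?exprn_gt0//; apply: lerXn2r => //; rewrite nnegrE ltW.
have -> : 2 * eta * (2 * E) / (q * E) ^+ 2 = 4 * eta / q ^+ 2 * E^-1 by field; lra.
have -> : 8 * ch (2 * y0) / q ^+ 2 * eta / ch (2 * y) = 4 * eta / q ^+ 2 * (2 * ch (2 * y0) / ch (2 * y)).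
  by field; lra.
apply: ler_wpM2l; first by rewrite divr_ge0 ?sqr_ge0// mulr_ge0// ltW.
by rewrite ler_pdivlMr// mulrC ler_pdivrMr//; lra.
Qed.

(* On the square of side [2 e] around the pole, so that the total mass there is at least [1 / 8]. *)
Lemma laplacian_lden_near x0 y0 e x y : 0 < e <= 1 / 4 -> `|x - x0| <= e -> `|y - y0| <= e ->
  (64 * e ^+ 2)^-1 <= laplacian (jet_ln (lden x0 y0 (e ^+ 2))) x y.
Proof.
move=> /andP[e0 e4] xe ye; have e20 : 0 < e ^+ 2 by rewrite exprn_gt0.
have e21 : 0 < e ^+ 2 <= 1 by rewrite e20 /=; nra.
rewrite laplacian_lden//; have g0 := lden_gt0 x0 y0 x y e21; move: g0; rewrite /=.
set u := x - x0 in xe *; set v := y - y0 in ye *.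
have u2 : u ^+ 2 <= e ^+ 2 by rewrite -[u ^+ 2]real_normK ?num_real//; have := normr_ge0 u; nra.
have v2 : v ^+ 2 <= e ^+ 2 by rewrite -[v ^+ 2]real_normK ?num_real//; have := normr_ge0 v; nra.
have c1 : ch (2 * v) <= 1 + 8 * e ^+ 2.
  apply: le_trans (ch_near0 _) _; last by rewrite exprMn; lra.
  by rewrite normrM normr_nat; lra.
have c2 : 1 - 2 * e ^+ 2 <= cos (2 * u).
  by apply: le_trans (cos_near0 _); rewrite exprMn; lra.
have c3 := ch_ge1 (2 * v); have c4 := cos_le1 (2 * u).
have e16 : e ^+ 2 <= 1 / 16 by nra.
move: (ch _) (cos _) c1 c2 c3 c4 => C c c1 c2 c3 c4 g0.
(* [11 = 8 + 2 + 1] collects the errors of [ch], of [cos] and [eta = e ^+ 2]; the resulting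
   [2 / 121] exceeds [1 / 64]. Over an area [4 * e ^+ 2] this is a mass of at least [1 / 16]. *)
have g1 : C - c + e ^+ 2 <= 11 * e ^+ 2 by lra.
apply: (@le_trans _ _ (2 * e ^+ 2 * 1 / (11 * e ^+ 2) ^+ 2)).
  have -> : 2 * e ^+ 2 * 1 / (11 * e ^+ 2) ^+ 2 = 128 / 121 * (64 * e ^+ 2)^-1 by field; lra.
  have : 0 < (64 * e ^+ 2)^-1 by rewrite invr_gt0 mulr_gt0.
  lra.
apply: ler_pM.
- by rewrite mulr1 mulr_ge0// ltW.
- by rewrite invr_ge0 sqr_ge0.
- apply: ler_wpM2l; [by rewrite mulr_ge0// ltW|lra].
- rewrite lef_pV2 ?posrE ?exprn_gt0//; last by rewrite mulr_gt0.
  by apply: lerXn2r => //; rewrite nnegrE ltW// mulr_gt0.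
Qed.

(* For a suitable [A], a subharmonic majorant of [reglog] for all [e <= 1]. *)
Definition majorant (A : R) : @jet R := Jet (fun _ y => A + 3 * ln (ch y)) (fun _ _ => 0)
  (fun _ y => 3 * sh y / ch y) (fun _ _ => 0) (fun _ y => 3 / ch y ^+ 2).

Lemma C2_majorant A x y : C2 (majorant A) x y.
Proof.
have c0 : ch y != 0 by rewrite gt_eqF// ch_gt0.
have h2 : sh y ^+ 2 = ch y ^+ 2 - 1 by have := chE y; lra.
have cc := @cont2_ch R x y; have cs := @cont2_sh R x y.
have cC (z : R) : cont2 (fun _ _ => z) x y by exact: cont2C.
split => /=.
- exact: derC.
- by der_auto; [exact: ch_gt0|ring].
- exact: derC.
- have -> : 3 / ch y ^+ 2 = 3 * (ch y ^+ 2 - sh y ^+ 2) / ch y ^+ 2 by rewrite chE mulr1.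
  by der_auto => //; field.
- by apply: cont2D => //; apply: cont2M => //; apply: cont2_ln => //; exact: ch_gt0.
- exact: cC.
- by apply: cont2M; [exact: cont2M|exact: cont2V].
- exact: cC.
- by apply: cont2M => //; apply: cont2V; [rewrite expf_neq0|exact: cont2X].
Qed.

Lemma laplacian_majorant_ge0 A x y : 0 <= laplacian (majorant A) x y.
Proof. by rewrite /laplacian/= add0r divr_ge0// sqr_ge0. Qed.

End GreenLaplacian.

(** * An interior zero bounds the boundary functional from below *)

Section InteriorZero.
Context {R : realType}.
Implicit Types (D : R -> R -> Prop) (f : R -> R -> cplx R) (x y Y c e eta A : R).

(** [f] is Lipschitz near the zero, so [|f|] is [O(e)] at distance [e], which is also the scale of
    the regularising term. *)
Lemma reglog_near_zero D f f1 f2 (F : strip_fun D f f1 f2) x0 y0 : 0 < x0 < pi / 2 ->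
  cnorm2 (f x0 y0) = 0 -> exists C e1 : R, 0 < e1 /\ forall e x y, 0 < e <= e1 ->
  `|x - x0| <= e -> `|y - y0| <= e -> j0 (reglog f f1 f2 e) x y <= ln e + C.
Proof.
move=> x0I fz; have [h1 h2] := sqrD_eq0 fz; have p := @pi_gt0 R; have [x00 x0p] := andP x0I.
have Dx x y : 0 <= x <= x0 + x0 -> D x y by move=> xI; apply: (sf_dom F); lra.
have [K1 K10 HK1] : exists2 K : R, 0 < K & forall x y, 0 <= x <= x0 + x0 -> y0 - 1 <= y <= y0 + 1 ->
    `|re (f1 x y)| <= K.
  by apply: rect_bound => x y xI _; exact: (sf_cont1 F (Dx x y xI)).1.
have [K2 K20 HK2] : exists2 K : R, 0 < K & forall x y, 0 <= x <= x0 + x0 -> y0 - 1 <= y <= y0 + 1 ->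
    `|im (f1 x y)| <= K.
  by apply: rect_bound => x y xI _; exact: (sf_cont1 F (Dx x y xI)).2.
pose K := K1 + K2; have K0 : 0 < K by exact: addr_gt0.
pose B := ch (`|y0| + 1); have B1 : 1 <= B by exact: ch_ge1.
exists (2^-1 * ln (8 * K ^+ 2 + B ^+ 6)), (Num.min 1 x0); split; first by rewrite lt_min ltr01.
move=> e x y /andP[e0]; rewrite le_min => /andP[e1 ex] xe ye.
have xI t : Num.min x0 x <= t <= Num.max x0 x -> 0 <= t <= x0 + x0.
  rewrite ge_min le_max; move: xe; rewrite ler_norml => /andP[? ?] /andP[/orP[]? /orP[]?];
    apply/andP; split; lra.
have yI t : Num.min y0 y <= t <= Num.max y0 y -> y0 - 1 <= t <= y0 + 1.
  rewrite ge_min le_max; move: ye; rewrite ler_norml => /andP[? ?] /andP[/orP[]? /orP[]?];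
    apply/andP; split; lra.
have xx : 0 <= x <= x0 + x0 by apply: xI; rewrite ge_min le_max lexx !orbT.
have yy : y0 - 1 <= y <= y0 + 1 by apply: yI; rewrite ge_min le_max lexx !orbT.
have xx0 : 0 <= x0 <= x0 + x0 by apply/andP; split; lra.
have k1 a b : 0 <= a <= x0 + x0 -> y0 - 1 <= b <= y0 + 1 -> `|re (f1 a b)| <= K /\ `|im (f1 a b)| <= K.
  by move=> aI bI; have := HK1 a b aI bI; have := HK2 a b aI bI; rewrite /K; split; lra.
have r1 : `|re (f x y) - re (f x0 y)| <= K * e.
  apply: le_trans (_ : _ <= K * `|x - x0|) _; last by rewrite ler_wpM2l// ltW.
  apply: (@der_lipschitz _ (fun x => re (f x y)) (fun x => re (f1 x y))) => t tI.
  have tt := xI t tI; split; last exact: (k1 t y tt yy).1.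
  by have [? ? ? ?] := sf_holo F (Dx t y tt).
have i1 : `|im (f x y) - im (f x0 y)| <= K * e.
  apply: le_trans (_ : _ <= K * `|x - x0|) _; last by rewrite ler_wpM2l// ltW.
  apply: (@der_lipschitz _ (fun x => im (f x y)) (fun x => im (f1 x y))) => t tI.
  have tt := xI t tI; split; last exact: (k1 t y tt yy).2.
  by have [? ? ? ?] := sf_holo F (Dx t y tt).
have r2 : `|re (f x0 y) - re (f x0 y0)| <= K * e.
  apply: le_trans (_ : _ <= K * `|y - y0|) _; last by rewrite ler_wpM2l// ltW.
  apply: (@der_lipschitz _ (fun y => re (f x0 y)) (fun y => - im (f1 x0 y))) => t tI.
  have tt := yI t tI; split; last by rewrite normrN; exact: (k1 x0 t xx0 tt).2.
  by have [? ? ? ?] := sf_holo F (Dx x0 t xx0).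
have i2 : `|im (f x0 y) - im (f x0 y0)| <= K * e.
  apply: le_trans (_ : _ <= K * `|y - y0|) _; last by rewrite ler_wpM2l// ltW.
  apply: (@der_lipschitz _ (fun y => im (f x0 y)) (fun y => re (f1 x0 y))) => t tI.
  have tt := yI t tI; split; last exact: (k1 x0 t xx0 tt).1.
  by have [? ? ? ?] := sf_holo F (Dx x0 t xx0).
rewrite h1 subr0 in r2; rewrite h2 subr0 in i2.
have r3 : `|re (f x y)| <= 2 * (K * e).
  by rewrite -[re (f x y)](subrK (re (f x0 y))); apply: le_trans (ler_normD _ _) _; rewrite mulr_natl mulr2n lerD.
have i3 : `|im (f x y)| <= 2 * (K * e).
  by rewrite -[im (f x y)](subrK (im (f x0 y))); apply: le_trans (ler_normD _ _) _; rewrite mulr_natl mulr2n lerD.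
have Ke : 0 <= 2 * (K * e) by rewrite !mulr_ge0// ltW.
have sq (a : R) : `|a| <= 2 * (K * e) -> a ^+ 2 <= 4 * K ^+ 2 * e ^+ 2.
  move=> ha; rewrite -[a ^+ 2]real_normK ?num_real//.
  rewrite (_ : 4 * K ^+ 2 * e ^+ 2 = (2 * (K * e)) ^+ 2); last by ring.
  by apply: lerXn2r => //; rewrite nnegrE.
have cB : ch y ^+ 6 <= B ^+ 6.
  have cy : ch y <= B.
    rewrite -ch_norm /B; apply: ch_homo => //.
    rewrite -[y in `|y|](subrK y0); apply: le_trans (ler_normD _ _) _; rewrite addrC lerD2l.
    exact: le_trans ye e1.
  by apply: lerXn2r => //; rewrite nnegrE ltW ?ch_gt0//; lra.
have e20 : 0 < e ^+ 2 by rewrite exprn_gt0.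
have Q0 : 0 < 8 * K ^+ 2 + B ^+ 6.
  by apply: addr_gt0; [apply: mulr_gt0 => //; exact: exprn_gt0|apply: exprn_gt0; lra].
have -> : ln e + 2^-1 * ln (8 * K ^+ 2 + B ^+ 6) = 2^-1 * ln (e ^+ 2 * (8 * K ^+ 2 + B ^+ 6)).
  by rewrite lnM ?posrE// (lnXn 2 e0) -[ln e *+ 2]mulr_natl; field.
rewrite [j0 _ _ _]/= ler_wpM2l// ler_ln ?posrE; [|exact: (regn_gt0 f f1 f2)|exact: mulr_gt0].
rewrite mulrDr; apply: lerD; last by rewrite ler_pM2l.
by have := sq _ r3; have := sq _ i3; rewrite /cnorm2; lra.
Qed.

(** With a suitable [A] this is nonpositive on the strip, so its product with each of the two
    nonnegative parts of the Laplacian of [green] has a known sign. *)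
Definition defect f f1 f2 A e := jet_sub (reglog f f1 f2 e) (majorant A).

Lemma ge1_recip_ch x0 y : (ch (2 * (y - x0)))^-1 <= 2 * ch (2 * x0) / ch (2 * y).
Proof.
have h := E_ge x0 y; have h1 := ch_gt0 (2 * y); have h2 := ch_gt0 (2 * (y - x0)).
by rewrite ler_pdivlMr// mulrC ler_pdivrMr//; lra.
Qed.

Lemma recip_ch_lorentz k : 0 < k -> exists2 C : R, 0 < C & forall y, (ch (k * y))^-1 <= C * lorentz y.
Proof.
move=> k0; have [C C0 HC] := @ch_decay R k 1 k0 ler01; exists C => // y.
apply: le_trans (HC y); rewrite -[leLHS]mul1r; apply: ler_wpM2r.
  by rewrite invr_ge0 ltW// ch_gt0.
by have := lnch_ge0 y; lra.
Qed.

Lemma defect_bounds D f f1 f2 (F : strip_fun D f f1 f2) : exists2 A : R, 0 <= A & forall e, 0 < e <= 1 ->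
  (forall x y, 0 <= x <= pi / 2 -> - (A - ln e) <= j0 (defect f f1 f2 A e) x y <= 0) /\
  (forall y, - (A + 3 * ln (ch y)) <= j0 (defect f f1 f2 A e) (pi / 2) y /\
    jx (defect f f1 f2 A e) (pi / 2) y = 0).
Proof.
have [A A0 HA] := reglog_le F; exists A; first exact: A0.
move=> e e01; have [e0 e1] := andP e01; split.
  move=> x y xI; have h1 := HA e x y e01 xI; have h2 := reglog_ge f f1 f2 x y e0.
  have -> : j0 (defect f f1 f2 A e) x y = j0 (reglog f f1 f2 e) x y - (A + 3 * ln (ch y)) by [].
  by apply/andP; split; lra.
move=> y; have [h1 h2] := reglog_axis F y e0; split.
  have -> : j0 (defect f f1 f2 A e) (pi / 2) y = j0 (reglog f f1 f2 e) (pi / 2) y - (A + 3 * ln (ch y)) by [].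
  by lra.
have -> : jx (defect f f1 f2 A e) (pi / 2) y = jx (reglog f f1 f2 e) (pi / 2) y - 0 by [].
by rewrite h1 subr0.
Qed.

Lemma C2_defect D f f1 f2 (F : strip_fun D f f1 f2) A e x y : 0 < e -> D x y -> C2 (defect f f1 f2 A e) x y.
Proof. by move=> e0 Dxy; apply: C2_sub; [exact: (C2_reglog_dom F)|exact: C2_majorant]. Qed.

Lemma contI_defect D f f1 f2 (F : strip_fun D f f1 f2) A e x a b : 0 < e -> 0 <= x <= pi / 2 ->
  contI a b (j0 (defect f f1 f2 A e) x).
Proof.
move=> e0 xI y _; have p := @pi_gt0 R; apply: cont2_secr; apply: C2_0.
by apply: (C2_defect F A e0); apply: (sf_dom F); lra.
Qed.

Lemma contI_green_x x0 y0 eta x a b : 0 < eta <= 1 -> contI a b (jx (green x0 y0 eta) x).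
Proof. by move=> e01 y _; apply: cont2_secr; apply: C2_1; exact: C2_green. Qed.

(* [bdry_ge] at [c = 1 / 2] bounds the logarithm on the edge [x = 0] from below in the mean. *)
Lemma left_edge_ge D f f1 f2 (F : strip_fun D f f1 f2) A : 0 <= A -> exists2 C : R, 0 < C &
  forall e, 0 < e <= 1 -> exists2 Y0 : R, 1 <= Y0 & forall Y, Y0 <= Y ->
  - C <= Int (- Y) Y (fun y => j0 (defect f f1 f2 A e) 0 y * (1 + ch y)^-1).
Proof.
move=> A0; have p := @pi_gt0 R; have [B B0 HB] := reglog_le F.
have i0 : 0 <= (0 : R) <= pi / 2 by apply/andP; split; lra.
have i1 : 0 <= (pi / 2 : R) <= pi / 2 by apply/andP; split; lra.
have i3 : 0 <= (pi / 2 : R) <= pi by apply/andP; split; lra.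
have i4 : 0 <= (0 : R) <= pi by apply/andP; split; lra.
have c12 : 0 < (1 / 2 : R) < 1 by apply/andP; split; lra.
have k1 : 0 < 1 :> R by [].
have [C1 C10 HC1] := ch_decay k1 A0; have [C2 C20 HC2] := ch_decay k1 B0.
exists (1 + 4 * (2 * C2) + 4 * C1); first lra.
move=> e e01; have [e0 e1] := andP e01.
have [Y0 Y01 HY] := bdry_ge F e01 c12 k1; exists Y0; first exact: Y01.
move=> Y YY; have Yp : 0 <= Y by lra.
have ec y : 2 * (1 / 2) / (1 + ch (2 * (1 / 2) * y)) = (1 + ch y)^-1.
  by rewrite (_ : 2 * (1 / 2) = 1) ?mul1r//; field.
have ck : contI (- Y) Y (fun y => (1 + ch y)^-1).
  move=> y _; have h : 1 + ch y != 0 by have := ch_gt0 y; lra.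
  by apply: (@der_continuous _ _ _ (- (1 + ch y) ^- 2 * sh y)); der_auto => //; ring.
have cm : contI (- Y) Y (fun y => A + 3 * ln (ch y)).
  move=> y _; apply: (@der_continuous _ _ _ (3 * (sh y / ch y))).
  by der_auto; [exact: ch_gt0|ring].
have cU x : 0 <= x <= pi -> contI (- Y) Y (j0 (reglog f f1 f2 e) x) by exact: (contI_reglog F).
have cw : contI (- Y) Y (axis_weight (1 / 2)) by apply: contIN; exact: contI_poisson_x.
have h1 : Int (- Y) Y (fun y => j0 (defect f f1 f2 A e) 0 y * (1 + ch y)^-1) =
    bdry f f1 f2 e (1 / 2) Y - Int (- Y) Y (fun y => j0 (reglog f f1 f2 e) (pi / 2) y * axis_weight (1 / 2) y)
    - Int (- Y) Y (fun y => (A + 3 * ln (ch y)) * (1 + ch y)^-1).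
  have c1 : contI (- Y) Y (fun y => j0 (reglog f f1 f2 e) 0 y * (1 + ch y)^-1).
    by apply: contIM => //; exact: cU.
  have c2 : contI (- Y) Y (fun y => j0 (reglog f f1 f2 e) (pi / 2) y * axis_weight (1 / 2) y).
    by apply: contIM => //; exact: cU.
  have c3 : contI (- Y) Y (fun y => (A + 3 * ln (ch y)) * (1 + ch y)^-1) by apply: contIM.
  have -> : bdry f f1 f2 e (1 / 2) Y = Int (- Y) Y (fun y => j0 (reglog f f1 f2 e) 0 y * (1 + ch y)^-1
      + j0 (reglog f f1 f2 e) (pi / 2) y * axis_weight (1 / 2) y).
    by apply: eq_Int => y _; rewrite ec.
  rewrite IntD// addrK -IntB//; apply: eq_Int => y _.
  have -> : j0 (defect f f1 f2 A e) 0 y = j0 (reglog f f1 f2 e) 0 y - (A + 3 * ln (ch y)) by [].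
  by rewrite mulrBl.
have h2 : Int (- Y) Y (fun y => j0 (reglog f f1 f2 e) (pi / 2) y * axis_weight (1 / 2) y) <= 4 * (2 * C2).
  apply: Int_le_lorentz => //; [by rewrite mulr_ge0// ltW|by apply: contIM => //; exact: cU|].
  move=> y _; have a1 := HB e (pi / 2) y e01 i1; have [_ a2] := reglog_axis F y e0.
  have a3 := le_trans (ler_norm _) (axis_weight_le y c12).
  rewrite (_ : pi * (1 / 2) = pi / 2) in a3; last by field.
  rewrite cos_pihalf add0r (_ : 2 * (1 / 2) * y = 1 * y) in a3; last by field.
  have := HC2 y; have cy := ch_gt0 (1 * y).
  have a4 := ler_wpM2l a2 a3.
  have a5 : j0 (reglog f f1 f2 e) (pi / 2) y * (2 / ch (1 * y)) <= (B + 3 * ln (ch y)) * (2 / ch (1 * y)).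
    by apply: ler_wpM2r a1; rewrite divr_ge0// ltW.
  lra.
have h3 : Int (- Y) Y (fun y => (A + 3 * ln (ch y)) * (1 + ch y)^-1) <= 4 * C1.
  apply: Int_le_lorentz => //; [exact: ltW|by apply: contIM|].
  move=> y _; apply: le_trans (HC1 y); rewrite mul1r; apply: ler_wpM2l.
    by have := lnch_ge0 y; lra.
  have cy := ch_gt0 y; by rewrite lef_pV2 ?posrE//; lra.
have h4 := HY Y YY; rewrite h1; lra.
Qed.

(** On [x = 0] the logarithm has no pointwise lower bound uniform in [e], only the weighted mean of
    [left_edge_ge]. The [x]-derivative of [green] is at most a multiple of that weight, and the
    defect is nonpositive. *)
Lemma green_edge0_ge D f f1 f2 (F : strip_fun D f f1 f2) A x0 y0 : 0 <= A -> 0 < x0 < pi / 2 ->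
  (forall e, 0 < e <= 1 -> forall x y, 0 <= x <= pi / 2 -> j0 (defect f f1 f2 A e) x y <= 0) ->
  exists2 C : R, 0 < C & forall e, 0 < e <= 1 -> exists2 Y0 : R, 1 <= Y0 & forall Y eta, Y0 <= Y -> 0 < eta <= 1 ->
  - C <= - wronskian (defect f f1 f2 A e) (green x0 y0 eta) Y 0.
Proof.
move=> A0 x0I Vle; have [C C0 HC] := left_edge_ge F A0; have q0 := q_gt0 x0I.
set q := (1 - _) in q0; have c0 := ch_gt0 (2 * y0); have p := @pi_gt0 R.
pose K := 8 * ch (2 * y0) / q; have K0 : 0 < K by apply: divr_gt0 => //; exact: mulr_gt0.
exists (K * C); first exact: mulr_gt0.
move=> e e01; have [Y0 Y01 HY] := HC e e01; exists Y0; first exact: Y01.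
have [e0 e1] := andP e01.
have i0 : 0 <= (0 : R) <= pi / 2 by apply/andP; split; lra.
move=> Y eta YY eta01.
have cV : contI (- Y) Y (j0 (defect f f1 f2 A e) 0) by exact: (contI_defect F).
have cg : contI (- Y) Y (jx (green x0 y0 eta) 0) by exact: contI_green_x.
have ck : contI (- Y) Y (fun y => (1 + ch y)^-1).
  move=> y _; have h : 1 + ch y != 0 by have := ch_gt0 y; lra.
  by apply: (@der_continuous _ _ _ (- (1 + ch y) ^- 2 * sh y)); der_auto => //; ring.
have -> : wronskian (defect f f1 f2 A e) (green x0 y0 eta) Y 0 =
    Int (- Y) Y (fun y => - (j0 (defect f f1 f2 A e) 0 y * jx (green x0 y0 eta) 0 y)).
  by apply: eq_Int => y _; rewrite green_0 mulr0 sub0r.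
rewrite IntN; last exact: contIM.
rewrite opprK -mulrN; apply: (@le_trans _ _ (K * Int (- Y) Y (fun y => j0 (defect f f1 f2 A e) 0 y * (1 + ch y)^-1))).
  by rewrite ler_pM2l//; exact: HY.
rewrite -IntZ; last exact: contIM.
apply: Int_le; [by apply: contIM; [exact: contIC|exact: contIM]|exact: contIM|].
move=> y _; rewrite mulrCA; apply: ler_wnM2l; first exact: Vle.
have [g0 g1] := andP (green_x0 y0 x0I y eta01); apply: le_trans g1 _.
rewrite -/q invfM mulrA; apply: (@le_trans _ _ (2 / q * (2 * ch (2 * y0) / ch (2 * y)))).
  by apply: ler_wpM2l; [rewrite divr_ge0// ltW|exact: ge1_recip_ch].
have h1 := ch_ge1 y; have h2 : 1 + ch y <= 2 * ch (2 * y) by rewrite ch_double; nra.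
have -> : 2 / q * (2 * ch (2 * y0) / ch (2 * y)) = K * (2 * ch (2 * y))^-1.
  by rewrite /K; have := ch_gt0 (2 * y) => h; field; rewrite !gt_eqF.
by rewrite ler_pM2l// lef_pV2 ?posrE//; lra.
Qed.

(** On the slit the defect is bounded below pointwise, so the integrable majorant of [ch_decay]
    suffices. *)
Lemma green_axis_ge D f f1 f2 (F : strip_fun D f f1 f2) A x0 y0 : 0 <= A -> 0 < x0 < pi / 2 ->
  (forall e, 0 < e <= 1 -> forall y, - (A + 3 * ln (ch y)) <= j0 (defect f f1 f2 A e) (pi / 2) y <= 0 /\
    jx (defect f f1 f2 A e) (pi / 2) y = 0) ->
  exists2 C : R, 0 < C & forall e Y eta, 0 < e <= 1 -> 0 <= Y -> 0 < eta <= 1 ->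
  - C <= wronskian (defect f f1 f2 A e) (green x0 y0 eta) Y (pi / 2).
Proof.
move=> A0 x0I HV; have q0 := q_gt0 x0I; set q := (1 - _) in q0.
have c0 := ch_gt0 (2 * y0); have p := @pi_gt0 R; have k2 : 0 < 2 :> R by [].
have [C C0 HC] := ch_decay k2 A0.
pose K := 4 * ch (2 * y0) / q; have K0 : 0 < K by apply: divr_gt0 => //; exact: mulr_gt0.
exists (4 * (K * C)); first by do 2! apply: mulr_gt0 => //.
move=> e Y eta e01 Y0 eta01; have [e0 e1] := andP e01.
have i1 : 0 <= (pi / 2 : R) <= pi / 2 by apply/andP; split; lra.
have cV : contI (- Y) Y (j0 (defect f f1 f2 A e) (pi / 2)) by exact: (contI_defect F).
have cg : contI (- Y) Y (jx (green x0 y0 eta) (pi / 2)) by exact: contI_green_x.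
have -> : wronskian (defect f f1 f2 A e) (green x0 y0 eta) Y (pi / 2) =
    Int (- Y) Y (fun y => - (j0 (defect f f1 f2 A e) (pi / 2) y * jx (green x0 y0 eta) (pi / 2) y)).
  by apply: eq_Int => y _; rewrite (HV e e01 y).2 mul0r sub0r.
apply: Int_ge_lorentz => //; [by rewrite ltW// mulr_gt0|by apply: contIN; exact: contIM|].
move=> y _; have [v1 v2] := andP (HV e e01 y).1; have [g1 g2] := andP (green_xpi2 y0 x0I y eta01).
have h := HC y; have T0 : 0 <= A + 3 * ln (ch y) by have := lnch_ge0 y; lra.
rewrite lerN2 -mulrNN; have h2 : - jx (green x0 y0 eta) (pi / 2) y <= K / ch (2 * y).
  rewrite lerNl; apply: le_trans g1; rewrite lerN2 -/q invfM mulrA.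
  apply: (@le_trans _ _ (2 / q * (2 * ch (2 * y0) / ch (2 * y)))).
    by apply: ler_wpM2l; [rewrite divr_ge0// ltW|exact: ge1_recip_ch].
  rewrite le_eqVlt; apply/orP; left; apply/eqP; rewrite /K; have := ch_gt0 (2 * y) => hh.
  by field; rewrite !gt_eqF.
apply: (@le_trans _ _ ((A + 3 * ln (ch y)) * (K / ch (2 * y)))).
  by apply: ler_pM => //; [by rewrite oppr_ge0|by rewrite oppr_ge0|rewrite lerNl].
rewrite (_ : _ * (K / _) = K * ((A + 3 * ln (ch y)) / ch (2 * y))); last by ring.
by rewrite -[leRHS]mulrA ler_pM2l.
Qed.

Lemma green_fluxgap_small D f f1 f2 (F : strip_fun D f f1 f2) A e x0 y0 eta d : 0 < e <= 1 -> 0 < x0 < pi / 2 ->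
  0 < eta <= 1 -> 0 < d ->
  (forall x y, 0 <= x <= pi / 2 -> - (A - ln e) <= j0 (defect f f1 f2 A e) x y <= 0) -> 0 <= A ->
  exists2 Y0 : R, 1 <= Y0 & forall Y x, Y0 <= Y -> 0 <= x <= pi / 2 ->
  `|yflux (defect f f1 f2 A e) (green x0 y0 eta) x Y - yflux (defect f f1 f2 A e) (green x0 y0 eta) x (- Y)| <= d.
Proof.
move=> e01 x0I eta01 d0 HV A0; have [e0 e1] := andP e01; have [eta0 eta1] := andP eta01.
have [B B0 HB] := reglog_y_le F; have le0 : ln e <= 0 by rewrite ln_le0.
have Be : 0 <= B / e ^+ 2 by rewrite divr_ge0// sqr_ge0.
pose V := B / e ^+ 2 + 6 + (A - ln e); have V0 : 0 < V by rewrite /V; lra.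
pose W := eta^-1 + 2 / eta ^+ 2; have W0 : 0 < W by rewrite addr_gt0 ?divr_gt0 ?invr_gt0 ?exprn_gt0.
have c0 := ch_gt0 (2 * y0); pose K := 2 * ch (2 * y0) * (V * W).
have K0 : 0 < K by do 2! apply: mulr_gt0 => //.
have k2 : 0 < 2 :> R by []; have d2 : 0 < d / 2 / K by apply: divr_gt0 => //; exact: divr_gt0.
have [Y0 Y01 HY] := @ch_decay_small R 2 1 (d / 2 / K) k2 ler01 d2; exists Y0; first exact: Y01.
have main x y : 0 <= x <= pi / 2 -> Y0 <= `|y| -> `|yflux (defect f f1 f2 A e) (green x0 y0 eta) x y| <= d / 2.
  move=> xI yY; have h := HY y yY; have cy := ch_gt0 (2 * y); have cE := ch_gt0 (2 * (y - y0)).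
  have iE : 0 < (ch (2 * (y - y0)))^-1 by rewrite invr_gt0.
  have h' : (ch (2 * y))^-1 <= d / 2 / K.
    apply: le_trans h; rewrite -[leLHS]mul1r; apply: ler_wpM2r; first by rewrite invr_ge0 ltW.
    by have := lnch_ge0 y; lra.
  have [g1 g2] := green_flux_le y0 x0I y eta01 xI; have g0 := green_ge0 y0 x0I y eta01 xI.
  have [v1 v2] := andP (HV x y xI); rewrite /yflux.
  have vy : `|jy (defect f f1 f2 A e) x y| <= V.
    have -> : jy (defect f f1 f2 A e) x y = jy (reglog f f1 f2 e) x y - 3 * sh y / ch y by [].
    apply: le_trans (ler_normB _ _) _; have u := HB e x y e01 xI.
    have : `|3 * sh y / ch y| <= 3.
      have c1 := ch_gt0 y; rewrite normrM normfV (gtr0_norm c1) (normrM 3) normr_nat ler_pdivrMr//.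
      by apply: ler_wpM2l => //; exact: sh_le_ch.
    by rewrite /V; lra.
  have v0 : `|j0 (defect f f1 f2 A e) x y| <= V by rewrite ler_norml /V; apply/andP; split; lra.
  apply: le_trans (ler_normB _ _) _; rewrite (normrM (jy _ _ _)) (normrM (j0 _ _ _)) (ger0_norm g0).
  have r1 := ler_pM (normr_ge0 _) g0 vy g1; have r2 := ler_pM (normr_ge0 _) (normr_ge0 _) v0 g2.
  apply: le_trans (lerD r1 r2) _.
  rewrite (_ : _ + _ = V * W * (ch (2 * (y - y0)))^-1); last by rewrite /W; ring.
  have VW : 0 < V * W by exact: mulr_gt0.
  apply: (@le_trans _ _ (V * W * (2 * ch (2 * y0) / ch (2 * y)))).
    by rewrite ler_pM2l//; exact: ge1_recip_ch.
  rewrite (_ : _ * (_ / _) = K * (ch (2 * y))^-1); last by rewrite /K; ring.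
  by rewrite mulrC -ler_pdivlMr.
move=> Y x YY xI; apply: le_trans (ler_normB _ _) _.
have yn : Y0 <= `|Y| by rewrite ger0_norm//; lra.
have yn' : Y0 <= `|- Y| by rewrite normrN.
by have := main x Y xI yn; have := main x (- Y) xI yn'; lra.
Qed.

End InteriorZero.

Section InteriorZeroBound.
Context {R : realType}.
Implicit Types (D : R -> R -> Prop) (f : R -> R -> cplx R) (x y Y c e eta A : R).

Lemma neg_ln_le e : 0 < e -> - ln e <= e^-1 - 1.
Proof.
move=> e0; have ie : 0 < e^-1 by rewrite invr_gt0.
have := @le_ln1Dx R (e^-1 - 1); rewrite (_ : 1 + (e^-1 - 1) = e^-1); last by ring.
by rewrite lnV ?posrE//; apply; lra.
Qed.

(** The Laplacian of [green] is [P - Q]: [P], from the mirrored pole, gives the bounded error [K];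
    [Q], from the pole, multiplies a nonpositive function, and on the slices [|x - x0| <= e] it
    meets the depth [- ln e] of the defect near the zero. *)
Lemma green_integrand_le D f f1 f2 (F : strip_fun D f f1 f2) A x0 y0 : 0 <= A -> 0 < x0 < pi / 2 ->
  cnorm2 (f x0 y0) = 0 ->
  (forall e, 0 < e <= 1 -> forall x y, 0 <= x <= pi / 2 -> - (A - ln e) <= j0 (defect f f1 f2 A e) x y <= 0) ->
  exists K C e1 : R, [/\ 0 < K, 0 < C, 0 < e1 & forall e Y x, 0 < e <= e1 -> `|y0| + 1 <= Y -> 0 <= x <= pi / 2 ->
    let I := Int (- Y) Y (fun y => laplacian (defect f f1 f2 A e) x y * j0 (green x0 y0 (e ^+ 2)) x y
      - j0 (defect f f1 f2 A e) x y * laplacian (green x0 y0 (e ^+ 2)) x y) in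
    let J := mass f f1 f2 e (green x0 y0 (e ^+ 2)) Y x in
    I <= J + K /\ (`|x - x0| <= e -> C <= - ln e -> I <= J + K - (- ln e - C) / (32 * e))].
Proof.
move=> A0 x0I fz HV; have [C3 [e3 [e30 H3]]] := reglog_near_zero F x0I fz.
have [C4 C40 H4] := laplacian_ldenN_le y0 x0I; have k2 : 0 < 2 :> R by [].
have [C5 C50 H5] := recip_ch_lorentz k2; have p := @pi_gt0 R.
have A1 : 0 < A + 1 by lra.
exists (4 * ((A + 1) * C4 * C5)), (`|C3| + 1), (Num.min e3 (1 / 4)); split.
- by rewrite mulr_gt0// mulr_gt0// mulr_gt0.
- by rewrite ltr_wpDl.
- by rewrite lt_min e30/=; lra.
move=> e Y x /andP[e0]; rewrite le_min => /andP[e13 e14] YY xI I J.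
have e01 : 0 < e <= 1 by apply/andP; split; lra.
have e20 : 0 < e ^+ 2 by rewrite exprn_gt0.
have e21 : e ^+ 2 <= 1 by rewrite expr_le1//; lra.
have e201 : 0 < e ^+ 2 <= 1 by rewrite e20.
have Y0 : 0 <= Y by have := normr_ge0 y0; lra.
have YY' : - Y <= Y by lra.
have Dx y : D x y by apply: (sf_dom F); lra.
set V := defect f f1 f2 A e in I *; set G := green x0 y0 (e ^+ 2) in I J *.
pose P := laplacian (jet_ln (lden (- x0) y0 (e ^+ 2))) x.
pose Q := laplacian (jet_ln (lden x0 y0 (e ^+ 2))) x.
have CG y : C2 G x y by exact: C2_green.
have CV y : C2 V x y by apply: (C2_defect F).
have CP y : C2 (jet_ln (lden (- x0) y0 (e ^+ 2))) x y by apply: C2_ln; [exact: lden_gt0|exact: C2_lden].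
have CQ y : C2 (jet_ln (lden x0 y0 (e ^+ 2))) x y by apply: C2_ln; [exact: lden_gt0|exact: C2_lden].
have cV : contI (- Y) Y (j0 V x) by move=> y _; apply: cont2_secr; exact: C2_0 (CV y).
have cG : contI (- Y) Y (j0 G x) by move=> y _; apply: cont2_secr; exact: C2_0 (CG y).
have cLV : contI (- Y) Y (laplacian V x) by move=> y _; apply: cont2_secr; exact: cont2_laplacian (CV y).
have cP : contI (- Y) Y P by move=> y _; apply: cont2_secr; exact: cont2_laplacian (CP y).
have cQ : contI (- Y) Y Q by move=> y _; apply: cont2_secr; exact: cont2_laplacian (CQ y).
have cLU : contI (- Y) Y (fun y => laplacian (reglog f f1 f2 e) x y * j0 G x y).
  by apply: (contI_laplacian F e0) => y _; [exact: Dx|exact: CG].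
have VG y : - (A - ln e) <= j0 V x y <= 0 by exact: HV.
have cl : contI (- Y) Y (fun y => (A + 1) * C4 * C5 * lorentz y).
  by apply: contIM; [exact: contIC|exact: contI_lorentz].
(* With [eta = e ^+ 2] the smoothing error stays bounded even when multiplied by the depth
   [A - ln e] of the defect. *)
have small : (A - ln e) * e ^+ 2 <= A + 1.
  have h := neg_ln_le e0; have h2 : A * e ^+ 2 <= A by rewrite ler_piMr.
  have h3 : - ln e * e ^+ 2 <= (e^-1 - 1) * e ^+ 2 by rewrite ler_wpM2r// ltW.
  have h4 : (e^-1 - 1) * e ^+ 2 = e - e ^+ 2 by field; lra.
  lra.
have AL : 0 <= A - ln e by have : ln e <= 0 by [rewrite ln_le0//; lra]; lra.
have pw y : laplacian V x y * j0 G x y - j0 V x y * laplacian G x y <=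
    laplacian (reglog f f1 f2 e) x y * j0 G x y + (A + 1) * C4 * C5 * lorentz y + j0 V x y * Q y.
  have -> : laplacian V x y = laplacian (reglog f f1 f2 e) x y - laplacian (majorant A) x y.
    by rewrite laplacian_sub.
  have -> : laplacian G x y = P y - Q y by exact: laplacian_green.
  have g0 : 0 <= j0 G x y by exact: green_ge0.
  have m0 := mulr_ge0 (laplacian_majorant_ge0 A x y) g0.
  have [v1 v2] := andP (VG y).
  have P0 : 0 <= P y by exact: laplacian_lden_ge0.
  have P1 : P y <= C4 * e ^+ 2 / ch (2 * y) by exact: H4.
  have : - j0 V x y * P y <= (A + 1) * C4 * C5 * lorentz y.
    apply: (@le_trans _ _ ((A - ln e) * (C4 * e ^+ 2 / ch (2 * y)))).
      by apply: ler_pM => //; [rewrite oppr_ge0|rewrite lerNl].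
    rewrite (_ : _ * (C4 * _ / _) = (A - ln e) * e ^+ 2 * (C4 * (ch (2 * y))^-1)); last by ring.
    rewrite (_ : (A + 1) * C4 * C5 * lorentz y = (A + 1) * (C4 * (C5 * lorentz y))); last by ring.
    have h5 := H5 y; have c0 := ch_gt0 (2 * y).
    apply: ler_pM => //; first by rewrite mulr_ge0// ltW.
      by rewrite mulr_ge0 ?invr_ge0// ltW.
    by rewrite ler_pM2l.
  move: m0; move: (laplacian (majorant A) x y) (laplacian (reglog f f1 f2 e) x y) (j0 G x y) (j0 V x y) (P y) (Q y).
  by clear; move=> *; lra.
have cVQ : contI (- Y) Y (fun y => j0 V x y * Q y) by exact: contIM.
have Q0 y : 0 <= Q y by exact: laplacian_lden_ge0.
have II : I <= J + 4 * ((A + 1) * C4 * C5) + Int (- Y) Y (fun y => j0 V x y * Q y).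
  have h1 : I <= Int (- Y) Y (fun y => laplacian (reglog f f1 f2 e) x y * j0 G x y
      + (A + 1) * C4 * C5 * lorentz y + j0 V x y * Q y).
    apply: Int_le => //; last by apply: contID => //; exact: contID.
    apply: contID; [exact: contIM|apply: contIN; apply: contIM => //].
    by move=> y _; apply: cont2_secr; exact: cont2_laplacian (CG y).
  apply: le_trans h1 _; rewrite IntD//; last exact: contID.
  rewrite IntD// lerD2r lerD2l IntZ; last exact: contI_lorentz.
  rewrite mulrC; apply: ler_wpM2r; last exact: Int_lorentz.
  by rewrite ltW// mulr_gt0// mulr_gt0.
split.
  apply: le_trans II _; rewrite gerDl -oppr_ge0 -IntN//; apply: Int_ge0 => y _.
  by rewrite -mulNr; apply: mulr_ge0 => //; rewrite oppr_ge0; case/andP : (VG y).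
move=> xe CL; apply: le_trans II _; rewrite lerD2l lerNr -IntN//.
have yl : - Y <= y0 - e by have := ler_norm (- y0); rewrite normrN; lra.
have yr : y0 + e <= Y by have := ler_norm y0; lra.
(* The density [(64 * e ^+ 2)^-1] times the length [2 * e] of the segment across the pole. *)
have -> : (- ln e - (`|C3| + 1)) / (32 * e) = (- ln e - (`|C3| + 1)) * (64 * e ^+ 2)^-1 * ((y0 + e) - (y0 - e)).
  by field; lra.
rewrite -(@Int_cst _ (y0 - e) (y0 + e)); last by lra.
have sub : forall y, - Y <= y <= Y -> 0 <= - (j0 V x y * Q y).
  by move=> y _; rewrite -mulNr; apply: mulr_ge0 => //; rewrite oppr_ge0; case/andP : (VG y).
apply: le_trans (Int_subset (contIN cVQ) yl yr sub).
apply: Int_le; [exact: contIC|by move=> y yI; apply: (contIN cVQ); lra|].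
move=> y yI; have ye : `|y - y0| <= e by rewrite ler_norml; lra.
have e14' : 0 < e <= 1 / 4 by rewrite e0.
have q1 : (64 * e ^+ 2)^-1 <= Q y by exact: laplacian_lden_near.
rewrite -mulNr; apply: ler_pM => //; [lra|by rewrite invr_ge0 mulr_ge0// ltW|].
have e3I : 0 < e <= e3 by rewrite e0.
have u := H3 e x y e3I xe ye; have l0 := lnch_ge0 y.
have -> : j0 V x y = j0 (reglog f f1 f2 e) x y - (A + 3 * ln (ch y)) by [].
by have := ler_norm C3; lra.
Qed.

Lemma mass_green_le D f f1 f2 (F : strip_fun D f f1 f2) x0 y0 : 0 < x0 < pi / 2 ->
  exists2 C : R, 0 < C & forall e c Y x, 0 < e <= 1 -> 1 <= - ln e -> 1 / 2 <= c < 1 -> 0 <= x <= pi / 2 ->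
  mass f f1 f2 e (green x0 y0 (e ^+ 2)) Y x <= C * - ln e * mass f f1 f2 e (poisson c) Y x.
Proof.
move=> x0I; have [C C0 HC] := green_le_poisson y0 x0I; exists (2 * C); first by rewrite mulr_gt0.
move=> e c Y x e01 L1 cI xI; have [e0 e1] := andP e01; have p := @pi_gt0 R.
have e20 : 0 < e ^+ 2 by rewrite exprn_gt0.
have e201 : 0 < e ^+ 2 <= 1 by rewrite e20 expr_le1// ltW.
have l2 : ln (e ^+ 2) = 2 * ln e by rewrite (lnXn 2 e0) mulr_natl.
have c01 : 0 < c < 1 by lra.
rewrite /mass -IntZ; last exact: (contI_mass F).
apply: Int_le.
- by apply: (contI_laplacian F e0) => y _; [apply: (sf_dom F); lra|exact: C2_green].
- by apply: contIM; [exact: contIC|exact: (contI_mass F)].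
move=> y _; rewrite [leRHS]mulrCA; apply: ler_wpM2l; first exact: laplacian_reglog_ge0.
have L2 : 1 <= - ln (e ^+ 2) by rewrite l2; lra.
apply: le_trans (HC (e ^+ 2) c x y e201 L2 cI xI) _.
by rewrite l2 le_eqVlt; apply/orP; left; apply/eqP; ring.
Qed.

(* The growth [1 / 16 * - ln e] comes from the pole of [green]; dividing by the bound of
   [green] by [poisson] leaves a constant that does not depend on [e] or [c]. *)
Lemma bdry_green_ge D f f1 f2 (F : strip_fun D f f1 f2) x0 y0 : 0 < x0 < pi / 2 ->
  cnorm2 (f x0 y0) = 0 -> exists B C e1 : R, [/\ 0 < B, 0 < C, 0 < e1 & forall e c, 0 < e <= e1 ->
    B <= - ln e -> 1 / 2 <= c < 1 ->
    exists2 Y0 : R, 1 <= Y0 & forall Y, Y0 <= Y -> - ln e / 16 - B <= C * - ln e * bdry f f1 f2 e c Y].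
Proof.
move=> x0I fz; have p := @pi_gt0 R; have p2 := @pihalf_lt2 R; have [x00 x0p] := andP x0I.
have [A A0 HA] := defect_bounds F.
have HV e : 0 < e <= 1 -> forall x y, 0 <= x <= pi / 2 -> - (A - ln e) <= j0 (defect f f1 f2 A e) x y <= 0.
  by move=> /HA[].
have HV0 e : 0 < e <= 1 -> forall x y, 0 <= x <= pi / 2 -> j0 (defect f f1 f2 A e) x y <= 0.
  by move=> e01 x y xI; case/andP : (HV e e01 x y xI).
have HVa e : 0 < e <= 1 -> forall y, - (A + 3 * ln (ch y)) <= j0 (defect f f1 f2 A e) (pi / 2) y <= 0 /\
    jx (defect f f1 f2 A e) (pi / 2) y = 0.
  move=> e01 y; have [_ h] := HA e e01; have [h1 h2] := h y; split => //.
  by rewrite h1 HV0//; apply/andP; split; lra.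
have [K [C3 [e3 [K0 C30 e30 H3]]]] := green_integrand_le F A0 x0I fz HV.
have [C C0 HC] := mass_green_le F y0 x0I.
have [Ca Ca0 Ha] := green_edge0_ge F y0 A0 x0I HV0.
have [Cb Cb0 Hb] := green_axis_ge F y0 A0 x0I HVa.
exists (1 + C3 + 2 * (K + 2) + Ca + Cb), C.
(* [e <= x0] and [e <= pi / 2 - x0] keep [[x0 - e, x0 + e]] inside the strip. *)
exists (Num.min (Num.min e3 1) (Num.min x0 (pi / 2 - x0))); split => //.
- by move: K0 C30 Ca0 Cb0; clear; lra.
- by rewrite !lt_min e30 ltr01 x00 subr_gt0.
move=> e c /andP[e0]; rewrite !le_min => /andP[/andP[e13 e11] /andP[ex0 exp]] BL cI.
set L := - ln e in BL *.
have L1 : 1 <= L by apply: le_trans BL; rewrite -!addrA lerDl !addr_ge0// ?mulr_ge0 ?addr_ge0// ltW.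
have L3 : C3 <= L.
  by apply: le_trans BL; rewrite -!addrA addrCA lerDl !addr_ge0// ?mulr_ge0 ?addr_ge0// ltW.
have e01 : 0 < e <= 1 by rewrite e0.
have e3I : 0 < e <= e3 by rewrite e0.
have c01 : 0 < c < 1 by move: cI; clear; lra.
have e20 : 0 < e ^+ 2 by rewrite exprn_gt0.
have e201 : 0 < e ^+ 2 <= 1 by rewrite e20 expr_le1// ltW.
have CL : 0 < C * L by apply: mulr_gt0 => //; exact: lt_le_trans L1.
have iCL : 0 < (C * L)^-1 by rewrite invr_gt0.
have [Y1 Y11 HY1] := fluxgap_small F e01 c01 iCL.
have [Y2 Y21 HY2] := green_fluxgap_small F y0 e01 x0I e201 ltr01 (HV e e01) A0.
have [Y3 Y31 HY3] := Ha e e01.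
have y0n := normr_ge0 y0.
exists (Y1 + Y2 + Y3 + `|y0|); first by move: Y11 Y21 Y31 y0n; clear; lra.
move=> Y YY; have [h1 h2 h3 h4 Yp] : [/\ Y1 <= Y, Y2 <= Y, Y3 <= Y, `|y0| + 1 <= Y & 0 <= Y].
  by move: Y11 Y21 Y31 y0n YY; clear; move=> *; split; lra.
set V := defect f f1 f2 A e; set G := green x0 y0 (e ^+ 2).
pose I x := Int (- Y) Y (fun y => laplacian V x y * j0 G x y - j0 V x y * laplacian G x y).
pose gap x := yflux V G x Y - yflux V G x (- Y).
have dG x : 0 <= x <= pi / 2 -> der (wronskian V G Y) x (I x - gap x).
  move=> xI; have [k k0 Hk] := strip_nbhd F Y xI; apply: (der_wronskian Yp k0) => z y zk yY.
  by split; [apply: (C2_defect F) => //; exact: Hk|exact: C2_green].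
(* [C * L] times the kernel dominates [green], so the mass terms of the two identities combine to
   something nonnegative: [W'] is bounded below, and by a quantity of order [L / e] where
   [|x - x0| <= e]. *)
pose W x := C * L * wronskian (reglog f f1 f2 e) (poisson c) Y x + - wronskian V G Y x.
pose W' x := C * L * (mass f f1 f2 e (poisson c) Y x - fluxgap f f1 f2 e c Y x) + - (I x - gap x).
have dW x : 0 <= x <= pi / 2 -> der W x (W' x).
  move=> xI; have d := der_wronskian_poisson F e0 c01 Yp xI.
  by apply: derD; [apply: der_eq (derM (derC _ x) d) _; rewrite mul0r add0r|apply: derN; exact: dG].
have lowb x : 0 <= x <= pi / 2 -> - (K + 2) <= W' x /\
    (`|x - x0| <= e -> (L - C3) / (32 * e) - (K + 2) <= W' x).
  move=> xI; have [i1 i2] := H3 e Y x e3I h4 xI.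
  have g1 := HY1 Y x h1 xI; have g2 := HY2 Y x h2 xI.
  have m1 := HC e c Y x e01 L1 cI xI.
  have g3 : C * L * fluxgap f f1 f2 e c Y x <= 1.
    by rewrite mulrC -ler_pdivlMr// div1r; apply: le_trans (ler_norm _) g1.
  have g4 : - gap x <= 1 by apply: le_trans (ler_norm _) _; rewrite normrN.
  rewrite -/V -/G -/(I x) in i1 i2; rewrite -/G in m1; rewrite -/L in m1.
  split=> [|xe]; rewrite /W' mulrBr.
    move: i1 m1 g3 g4; rewrite -/L.
    move: (I x) (gap x) (mass _ _ _ _ _ _ _) (C * L * mass _ _ _ _ _ _ _) (C * L * fluxgap _ _ _ _ _ _ _).
    by clear; move=> *; lra.
  have {}i2 := i2 xe L3; move: i2 m1 g3 g4; rewrite -/L.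
  move: (I x) (gap x) (mass f f1 f2 e G Y x) (C * L * mass _ _ _ _ _ _ _) (C * L * fluxgap _ _ _ _ _ _ _) ((L - C3) / (32 * e)).
  by clear; move=> *; lra.
have step a b m : 0 <= a -> a <= b -> b <= pi / 2 -> (forall x, a <= x <= b -> m <= W' x) ->
    m * (b - a) <= W b - W a.
  move=> a0 ab bp Hm; rewrite mulrBr; apply: (@der_le _ (fun x => m * x) W (fun=> m) W' a b ab _ _ Hm).
    by move=> x _; der_auto; ring.
  by move=> x /andP[ax xb]; apply: dW; rewrite (le_trans a0 ax) (le_trans xb bp).
have xe0 : 0 <= x0 - e by rewrite subr_ge0.
have xep : x0 + e <= pi / 2 by move: exp; clear; lra.
have xep' : x0 - e <= pi / 2 by move: xep e0; clear; lra.
have xe0' : 0 <= x0 + e by apply: addr_ge0; exact: ltW.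
have xe1 : x0 - e <= x0 + e by move: e0; clear; lra.
have s1 : - (K + 2) * (x0 - e - 0) <= W (x0 - e) - W 0.
  by apply: step => // x /andP[x1 x2]; apply: (lowb x _).1; rewrite x1 (le_trans x2).
have s2 : ((L - C3) / (32 * e) - (K + 2)) * ((x0 + e) - (x0 - e)) <= W (x0 + e) - W (x0 - e).
  apply: step => // x /andP[x1 x2]; apply: (lowb x _).2.
    by rewrite (le_trans xe0 x1) (le_trans x2).
  by rewrite ler_norml; move: x1 x2; clear; move=> *; apply/andP; split; lra.
have s3 : - (K + 2) * (pi / 2 - (x0 + e)) <= W (pi / 2) - W (x0 + e).
  by apply: step => // x /andP[x1 x2]; apply: (lowb x _).1; rewrite x2 andbT (le_trans xe0' x1).
have s4 : (L - C3) / (32 * e) * ((x0 + e) - (x0 - e)) = (L - C3) / 16 by field; lra.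
have a1 := HY3 Y (e ^+ 2) h3 e201; have b1 := Hb e Y (e ^+ 2) e01 Yp e201.
rewrite -/V -/G in a1 b1; rewrite (bdry_wronskian F)// mulrBr.
rewrite mulrBl s4 in s2.
have Kp : (K + 2) * (pi / 2) <= (K + 2) * 2 by apply: ler_wpM2l; [move: K0; clear; lra|exact: ltW].
move: s1 s2 s3 a1 b1 Kp C30; rewrite /W.
move: (C * L * wronskian _ _ _ (pi / 2)) (C * L * wronskian _ _ _ 0) (C * L * wronskian _ _ _ (x0 + e)) (C * L * wronskian _ _ _ (x0 - e)).
move: (wronskian V G Y (pi / 2)) (wronskian V G Y 0) (wronskian V G Y (x0 + e)) (wronskian V G Y (x0 - e)) (pi / 2) => ? ? ? ? ? ? ? ? ?.
by clear; move=> *; lra.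
Qed.

(** Both sides of [bdry_green_ge] grow like [- ln e]. Once [- ln e >= 32 * B], half of the
    coefficient [1 / 16] is left, and division by [C * - ln e] removes [e]. *)
Lemma bdry_ge_zero D f f1 f2 (F : strip_fun D f f1 f2) x0 y0 : 0 < x0 < pi / 2 ->
  cnorm2 (f x0 y0) = 0 -> exists k e0 : R, [/\ 0 < k, 0 < e0 <= 1 & forall e c, 0 < e <= e0 -> 1 / 2 <= c < 1 ->
    exists2 Y0 : R, 1 <= Y0 & forall Y, Y0 <= Y -> k <= bdry f f1 f2 e c Y].
Proof.
move=> x0I fz; have [B [C [e1 [B0 C0 e10 H]]]] := bdry_green_ge F x0I fz.
exists (32 * C)^-1, (Num.min (Num.min e1 1) (expR (- (32 * B)))); split.
- by rewrite invr_gt0 mulr_gt0.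
- by rewrite !lt_min e10 ltr01 expR_gt0/= !ge_min lexx !orbT.
move=> e c /andP[e0]; rewrite !le_min => /andP[/andP[ee1 e01] eB] cI.
have LB : 32 * B <= - ln e by rewrite lerNr -ler_expR lnK ?posrE.
have e1I : 0 < e <= e1 by rewrite e0.
have BL : B <= - ln e by move: LB B0; clear; lra.
have [Y0 Y01 HY] := H e c e1I BL cI; exists Y0; first exact: Y01.
move=> Y YY; have h := HY Y YY; have L0 : 0 < - ln e by exact: lt_le_trans BL.
move: h L0 LB C0; move: (- ln e) (bdry _ _ _ _ _ _) => L b h L0 LB C0.
have CL : 0 < C * L by exact: mulr_gt0.
rewrite -(ler_pM2l CL); apply: le_trans h.
rewrite (_ : C * L * (32 * C)^-1 = L / 32); last by field; lra.
by move: LB; clear; lra.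
Qed.

End InteriorZeroBound.

(** * The limit of [e] to 0 *)

Section Convergence.
Context d (T : measurableType d) (R : realType) (mu : {measure set T -> \bar R}).
Implicit Types (D : set T) (f g N E w : T -> R).

Lemma Rdominated_cvg D (f_ : nat -> T -> R) f g : measurable D ->
  (forall n, measurable_fun D (f_ n)) -> measurable_fun D f ->
  {ae mu, forall x, D x -> f_ n x @[n --> \oo] --> f x} ->
  mu.-integrable D (EFin \o g) -> {ae mu, forall x n, D x -> `|f_ n x| <= g x} ->
  mu.-integrable D (EFin \o f) /\
  (\int[mu]_(x in D) f_ n x)%R @[n --> \oo] --> (\int[mu]_(x in D) f x)%R.
Proof.
move=> mD mf_ mf cf ig fg.
have mf_' n : measurable_fun D (EFin \o f_ n) by exact/measurable_EFinP.
have mf' : measurable_fun D (EFin \o f) by exact/measurable_EFinP.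
have cf' : {ae mu, forall x, D x -> (EFin \o f_ n) x @[n --> \oo] --> (EFin \o f) x}.
  by apply: filterS cf => x cfx Dx; apply: cvg_EFin; [exact: nearW|exact: cfx].
have fg' : {ae mu, forall x n, D x -> (`|(EFin \o f_ n) x| <= (EFin \o g) x)%E}.
  by apply: filterS fg => x fgx n Dx; rewrite lee_fin; exact: fgx.
have [i1 _ c1] := dominated_convergence mD mf_' mf' cf' ig fg'.
split => //; apply: fine_cvg; rewrite /Rintegral fineK//.
exact: integrable_fin_num.
Qed.

Lemma RintegralNE D f : measurable D -> mu.-integrable D (EFin \o f) ->
  (\int[mu]_(x in D) (f x)%:E)%E = ((\int[mu]_(x in D) f x)%R)%:E.
Proof. by move=> mD fi; rewrite /Rintegral fineK//; exact: integrable_fin_num. Qed.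

Let u N E n x : R := 2^-1 * ln (N x + (n.+1%:R^-1) ^+ 2 * E x).

(* If the integrals of the regularised logarithms stay bounded below, monotone convergence makes
   the zero set of [N] negligible. *)
Lemma regularised_ln_cvg D N E w C : measurable D -> measurable_fun D N -> measurable_fun D E ->
  measurable_fun D w -> (forall x, D x -> 0 <= N x) -> (forall x, D x -> 0 < E x) ->
  (forall x, D x -> 0 < w x) ->
  (forall n, mu.-integrable D (EFin \o (fun x => u N E n x * w x))) ->
  (forall n, - C <= \int[mu]_(x in D) (u N E n x * w x))%R ->
  [/\ {ae mu, forall x, D x -> 0 < N x},
      mu.-integrable D (EFin \o (fun x => 2^-1 * ln (N x) * w x)) &
      (\int[mu]_(x in D) (u N E n x * w x))%R @[n --> \oo] -->
      (\int[mu]_(x in D) (2^-1 * ln (N x) * w x))%R].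
Proof.
move=> mD mN mE mw N0 E0 w0 iu uC.
have e0 n : 0 < (n.+1%:R^-1 : R) by rewrite invr_gt0.
have q0 n x : D x -> 0 < (n.+1%:R^-1) ^+ 2 * E x by move=> /E0 h; rewrite mulr_gt0// exprn_gt0.
have p0 n x : D x -> 0 < N x + (n.+1%:R^-1) ^+ 2 * E x by move=> Dx; rewrite ltr_wpDl ?q0// N0.
have mu_ n : measurable_fun D (u N E n).
  apply: measurable_funM => //; apply: (measurableT_comp (@measurable_ln R)).
  by apply: measurable_funD => //; apply: measurable_funM.
have mln : measurable_fun D (fun x => 2^-1 * ln (N x) * w x).
  apply: measurable_funM => //; apply: measurable_funM => //.
  exact: (measurableT_comp (@measurable_ln R)).
have und x m n : D x -> (m <= n)%N -> u N E n x <= u N E m x.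
  move=> Dx mn; rewrite /u ler_pM2l// ler_ln ?posrE ?p0// lerD2l ler_pM2r ?E0//.
  by apply: lerXn2r; rewrite ?nnegrE; [exact: ltW|exact: ltW|rewrite lef_pV2 ?posrE// ler_nat].
(* The decrease from the first regularisation is nonnegative and monotone in [n]; its integrals are
   bounded by means of [C]. *)
pose h n x : \bar R := ((u N E 0%N x - u N E n x) * w x)%:E.
have h0 n x : D x -> (0 <= h n x)%E.
  by move=> Dx; rewrite lee_fin mulr_ge0 ?subr_ge0 ?und// ltW// w0.
have mh n : measurable_fun D (h n).
  by apply/measurable_EFinP; apply: measurable_funM => //; exact: measurable_funB.
have hnd x : D x -> {homo h ^~ x : m n / (m <= n)%N >-> (m <= n)%E}.
  by move=> Dx m n mn; rewrite lee_fin ler_pM2r ?w0// lerD2l lerN2 und.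
pose hoo x := limn (h ^~ x).
have mhoo : measurable_fun D hoo.
  apply: (emeasurable_fun_cvg h) => // x Dx.
  by apply: ereal_nondecreasing_is_cvgn => m n mn; exact: hnd.
pose M := (\int[mu]_(x in D) (u N E 0%N x * w x))%R + C.
have hM n : (\int[mu]_(x in D) h n x <= M%:E)%E.
  have ei : mu.-integrable D (EFin \o (fun x => u N E 0%N x * w x - u N E n x * w x)).
    by have := integrableB mD (iu 0%N) (iu n); apply: eq_integrable => // x _; rewrite /= EFinB.
  rewrite (_ : (\int[mu]_(x in D) h n x)%E =
      (\int[mu]_(x in D) (u N E 0%N x * w x - u N E n x * w x)%:E)%E); last first.
    by apply: eq_integral => x _; rewrite /h mulrBl.
  rewrite (RintegralNE mD ei) RintegralB// lee_fin /M lerD2l lerNl; exact: uC.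
have ihoo : mu.-integrable D hoo.
  apply/integrableP; split => //.
  have hoo0 x : D x -> (0 <= hoo x)%E.
    move=> Dx; apply: lime_ge; last by apply: nearW => n; exact: h0.
    by apply: ereal_nondecreasing_is_cvgn => m n mn; exact: hnd.
  under eq_integral => x xD do rewrite (gee0_abs (hoo0 x (set_mem xD))).
  rewrite (monotone_convergence mu mD mh h0 hnd).
  apply: (@le_lt_trans _ _ M%:E); last exact: ltry.
  apply: lime_le; last by apply: nearW => n; exact: hM.
  apply: ereal_nondecreasing_is_cvgn => m n mn.
  by apply: ge0_le_integral => //; try (by move=> x Dx; exact: h0); move=> x Dx; exact: hnd.
have hle x n : D x -> (h n x <= hoo x)%E.
  move=> Dx; have := ereal_nondecreasing_cvgn (hnd x Dx) => /cvg_lim.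
  by rewrite /hoo => ->//; apply: ereal_sup_ubound; exists n.
have fin := integrable_ae mD ihoo.
have aeN : {ae mu, forall x, D x -> 0 < N x}.
  apply: filterS fin => x hx Dx; have hfin := hx Dx.
  rewrite lt_neqAle N0// andbT; apply/eqP => Nx.
  (* Where [N] vanishes the decrease is of order [ln (n + 1)], so its almost everywhere finite limit
     excludes such points up to a null set. *)
  have hn n : h n x = (ln n.+1%:R * w x)%:E.
    rewrite /h /u -Nx !add0r; congr ((_ * _)%:E).
    rewrite invr1 expr1n mul1r lnM ?posrE ?exprn_gt0 ?E0// (lnXn 2 (e0 n)) lnV ?posrE//.
    by rewrite -[_ *+ 2]mulr_natl; field.
  have bnd n : ln n.+1%:R * w x <= fine (hoo x).
    by rewrite -lee_fin fineK// -hn; exact: hle.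
  have := @cvg_ln_natr R => /cvgryPge /(_ (fine (hoo x) / w x + 1)) [n _ /(_ n.+1)].
  move=> /(_ (leqnSn n))/= H; have := bnd n; rewrite -ler_pdivlMr ?w0// => H2.
  by have := le_trans H H2; rewrite gerDl ler10.
(* The first regularisation plus the total decrease dominates every term. *)
pose G x := `|u N E 0%N x * w x| + fine (hoo x).
have iG : mu.-integrable D (EFin \o G).
  have i1 : mu.-integrable D (EFin \o (fun x => `|u N E 0%N x * w x|)).
    by have := integrable_abse (iu 0%N); apply: eq_integrable => // x _.
  have i2 : mu.-integrable D (EFin \o (fine \o hoo)).
    have mf2 : measurable_fun D (EFin \o (fine \o hoo)).
      by apply/measurable_EFinP; apply: (measurableT_comp (f := fine)) => //; exact: fine_measurable.
    apply: (le_integrable mD mf2 _ ihoo) => x Dx /=.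
    by case: (hoo x) => [r| |]//=; rewrite ?normr0 leey.
  by have := integrableD mD i1 i2; apply: eq_integrable => // x _; rewrite /= EFinD.
have [|||||i c] := @Rdominated_cvg D (fun n x => u N E n x * w x) (fun x => 2^-1 * ln (N x) * w x) G mD.
- by move=> n; exact: measurable_funM.
- exact: mln.
- apply: filterS aeN => x Nx Dx; have {}Nx := Nx Dx.
  apply: cvgM; last exact: cvg_cst.
  apply: cvgM; first exact: cvg_cst.
  apply: (@continuous_cvg _ R R _ _ (fun n : nat => N x + (n.+1%:R^-1) ^+ 2 * E x) (@ln R) (N x)); first exact: continuous_ln.
  rewrite -[X in _ --> X]addr0; apply: cvgD; first exact: cvg_cst.
  rewrite -[X in _ --> X](mul0r (E x)); apply: cvgM; last exact: cvg_cst.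
  have -> : (0 : R) = 0 ^+ 2 by rewrite expr0n.
  by apply: (@continuous_cvg _ R R _ _ (fun n : nat => n.+1%:R^-1) (fun z : R => z ^+ 2) 0); [exact: exprn_continuous|exact: cvg_harmonic].
- exact: iG.
- apply: filterS fin => x hx n Dx; rewrite /G.
  have := hle x n Dx; rewrite -[hoo x]fineK ?hx//= lee_fin => hh.
  rewrite -[u N E n x](subKr (u N E 0%N x)) mulrBl; apply: le_trans (ler_normB _ _) _.
  by rewrite lerD2l ger0_norm//; have := h0 n x Dx; rewrite lee_fin.
- by split.
Qed.

End Convergence.

Section HalfLine.
Context {R : realType}.
Implicit Types (f g : R -> R).
Local Notation mu := (@lebesgue_measure R).

Lemma lorentz_integrable : mu.-integrable `[0, +oo[ (EFin \o lorentz).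
Proof.
apply/integrableP; split.
  apply/measurable_EFinP; apply: measurable_funTS; apply: continuous_measurable_fun => y.
  by apply: (contI_lorentz (a := y) (b := y)); rewrite lexx.
under eq_integral => y _ do rewrite /= (gtr0_norm (lorentz_gt0 y)).
have := integral0y_oneDsqr R; rewrite /oneDsqr -/(lorentz _) => ->.
by rewrite ltry.
Qed.

Lemma half_line_cvg f C : (forall y : R, 0 <= y -> {for y, continuous f}) ->
  (forall y : R, 0 <= y -> `|f y| <= C * lorentz y) ->
  mu.-integrable `[0, +oo[ (EFin \o f) /\
  (Int 0 n%:R f) @[n --> \oo] --> (\int[mu]_(y in `[0%R, +oo[) f y)%R.
Proof.
move=> cf fC.
have mf : measurable_fun (`[0, +oo[ : set R) f.
  apply: subspace_continuous_measurable_fun => //; apply: continuous_in_subspaceT => y.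
  by rewrite inE/= in_itv/= andbT; exact: cf.
have iC : mu.-integrable `[0, +oo[ (EFin \o (fun y => C * lorentz y)).
  rewrite (_ : _ \o _ = (fun y => C%:E * (EFin \o lorentz) y)%E).
    by apply: integrableZl => //; exact: lorentz_integrable.
  by apply/funext => y; rewrite /= EFinM.
have [|||||i c] := @Rdominated_cvg _ _ R mu `[0, +oo[ (fun n => f \_ `[0, n%:R]) f (fun y => C * lorentz y) (measurable_itv _).
- move=> n; apply/measurable_restrict; [exact: measurable_itv|exact: measurable_itv|].
  by apply: measurable_funS mf; [exact: measurable_itv|exact: subIsetl].
- exact: mf.
- apply: aeW => y; rewrite /= in_itv/= andbT => y0.
  apply: cvg_near_cst; near=> n; rewrite patchE mem_set//= in_itv/= y0/=.
  near: n; exact: nbhs_infty_ger.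
- exact: iC.
- apply: aeW => y n; rewrite /= in_itv/= andbT => y0; rewrite patchE.
  case: ifP => _; first exact: fC.
  by rewrite normr0; apply: le_trans (fC y y0).
split => //; apply: cvg_trans c; apply: near_eq_cvg; near=> n.
rewrite -Rintegral_mkcondr /Int; congr Rintegral.
apply/seteqP; split => y; rewrite /= !in_itv/= andbT; first by move=> [].
by move=> /andP[-> ->].
Unshelve. all: end_near. Qed.

End HalfLine.

Section BoundaryLimit.
Context {R : realType}.
Variables (D : R -> R -> Prop) (f f1 f2 : R -> R -> cplx R).
Implicit Types (x y e c : R).
Local Notation mu := (@lebesgue_measure R).
Local Notation U := (reglog f f1 f2).

Definition Hint (g : R -> R) : R := (\int[mu]_(y in `[0%R, +oo[) g y)%R.
Definition Hintegrable (g : R -> R) : Prop := mu.-integrable `[0, +oo[ (EFin \o g).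

Definition edge_weight c y := 2 * c / (1 + ch (2 * c * y)).

Lemma edge_weight_le c y : 0 < c < 1 -> 0 < edge_weight c y <= 2 / ch (2 * c * y).
Proof.
move=> /andP[c0 c1]; rewrite /edge_weight; have h := ch_gt0 (2 * c * y).
have h1 : 0 < 1 + ch (2 * c * y) by lra.
apply/andP; split; first by rewrite divr_gt0//; lra.
apply: ler_pM; [lra|by rewrite invr_ge0 ltW|lra|rewrite lef_pV2 ?posrE//; lra].
Qed.

Lemma contI_edge_weight c a b : contI a b (edge_weight c).
Proof.
move=> y _; have h := ch_gt0 (2 * c * y); rewrite /edge_weight.
apply: (@der_continuous _ _ _ (2 * c * (- (1 + ch (2 * c * y)) ^- 2 * (2 * c * sh (2 * c * y))))).
by der_auto; [rewrite gt_eqF//; lra|field; lra].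
Qed.

Lemma contI_axis_weight c a b : 0 < c < 1 -> contI a b (axis_weight c).
Proof.
move=> c01; have p := @pi_gt0 R.
by apply: contIN; apply: contI_poisson_x => //; apply/andP; split; lra.
Qed.

Lemma axis_weight_le_ch c y : 0 < c < 1 -> `|axis_weight c y| <= 2 / pmin c / ch (2 * c * y).
Proof.
move=> c01; have p := @pi_gt0 R; apply: le_trans (axis_weight_le y c01) _.
have i1 : 0 <= (pi / 2 : R) <= pi / 2 by apply/andP; split; lra.
have := pden_ge y c01 i1; have m := pmin_gt0 c01; have h := ch_gt0 (2 * c * y).
rewrite /pden (_ : 2 * c * (pi / 2) = pi * c); last by field.
move=> d; have mh : 0 < pmin c * ch (2 * c * y) by apply: mulr_gt0.
rewrite (_ : 2 / pmin c / ch (2 * c * y) = 2 / (pmin c * ch (2 * c * y))); last first.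
  by rewrite (invfM (pmin c)) mulrA.
by rewrite ler_pM2l// lef_pV2 ?posrE//; exact: lt_le_trans d.
Qed.

Lemma edge_abs (F : strip_fun D f f1 f2) e c : 0 < e <= 1 -> 0 < c < 1 -> exists C : R, forall y,
  `|j0 (U e) 0 y * edge_weight c y| <= C * lorentz y.
Proof.
move=> e01 c01; have [A A0 HA] := reglog_le F; have [e0 e1] : 0 < e /\ e <= 1 by apply/andP.
have p := @pi_gt0 R; have l0 : ln e <= 0 by rewrite ln_le0.
have i0 : 0 <= (0 : R) <= pi / 2 by apply/andP; split; lra.
have c2 : 0 < 2 * c by case/andP: c01 => ? _; rewrite mulr_gt0.
have Ae : 0 <= A - ln e by lra.
have [C C0 HC] := ch_decay c2 Ae; exists (2 * C) => y.
have /andP[w0 w1] := edge_weight_le y c01.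
rewrite normrM (gtr0_norm w0); apply: le_trans (_ : 2 * ((A - ln e + 3 * ln (ch y)) / ch (2 * c * y)) <= _); last first.
  by rewrite -[leRHS]mulrA ler_pM2l//.
rewrite [leRHS](_ : _ = (A - ln e + 3 * ln (ch y)) * (2 / ch (2 * c * y))); last by rewrite mulrCA.
apply: ler_pM => //; first by rewrite ltW.
have := HA e 0 y e01 i0; have := reglog_ge f f1 f2 0 y e0; have := lnch_ge0 y.
by move: l0 A0; clear; move=> ? ? ? ? ?; rewrite ler_norml; apply/andP; split; lra.
Qed.

(** On the slit the logarithm is nonnegative, so [reglog_le] alone gives a bound uniform in [e]; on
    the edge [x = 0] this fails. *)
Lemma axis_abs (F : strip_fun D f f1 f2) c : 0 < c < 1 -> exists C : R, forall e y, 0 < e <= 1 ->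
  `|j0 (U e) (pi / 2) y * axis_weight c y| <= C * lorentz y.
Proof.
move=> c01; have [A A0 HA] := reglog_le F.
have p := @pi_gt0 R.
have i1 : 0 <= (pi / 2 : R) <= pi / 2 by apply/andP; split; lra.
have c2 : 0 < 2 * c by case/andP: c01 => ? _; rewrite mulr_gt0.
have m := pmin_gt0 c01; have m2 : 0 < 2 / pmin c by rewrite divr_gt0.
have [C C0 HC] := ch_decay c2 A0; exists (2 / pmin c * C) => e y e01.
have [e0 e1] : 0 < e /\ e <= 1 by apply/andP.
have u0 := (reglog_axis F y e0).2.
rewrite normrM (ger0_norm u0).
apply: le_trans (_ : 2 / pmin c * ((A + 3 * ln (ch y)) / ch (2 * c * y)) <= _); last first.
  by rewrite -[leRHS]mulrA ler_pM2l//.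
rewrite [leRHS](_ : _ = (A + 3 * ln (ch y)) * (2 / pmin c / ch (2 * c * y))); last by ring.
apply: ler_pM => //; first exact: HA.
exact: axis_weight_le_ch.
Qed.

Lemma bdry_limit (F : strip_fun D f f1 f2) e c : 0 < e <= 1 -> 0 < c < 1 ->
  [/\ Hintegrable (fun y => j0 (U e) 0 y * edge_weight c y),
      Hintegrable (fun y => j0 (U e) (pi / 2) y * axis_weight c y) &
      bdry f f1 f2 e c n%:R @[n --> \oo] -->
      2 * (Hint (fun y => j0 (U e) 0 y * edge_weight c y) +
           Hint (fun y => j0 (U e) (pi / 2) y * axis_weight c y))].
Proof.
move=> e01 c01; have p := @pi_gt0 R; have [e0 e1] : 0 < e /\ e <= 1 by apply/andP.
have i0 : 0 <= (0 : R) <= pi by apply/andP; split; lra.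
have i1 : 0 <= (pi / 2 : R) <= pi by apply/andP; split; lra.
have [C0 HC0] := edge_abs F e01 c01; have [C1 HC1] := axis_abs F c01.
have c0 a b : contI a b (fun y => j0 (U e) 0 y * edge_weight c y).
  by apply: contIM; [exact: (contI_reglog F)|exact: contI_edge_weight].
have c1 a b : contI a b (fun y => j0 (U e) (pi / 2) y * axis_weight c y).
  by apply: contIM; [exact: (contI_reglog F)|exact: contI_axis_weight].
have [||h0 l0] := @half_line_cvg R (fun y => j0 (U e) 0 y * edge_weight c y) C0.
- by move=> y _; apply: (c0 y y); rewrite lexx.
- by move=> y _; exact: HC0.
have [||h1 l1] := @half_line_cvg R (fun y => j0 (U e) (pi / 2) y * axis_weight c y) C1.
- by move=> y _; apply: (c1 y y); rewrite lexx.
- by move=> y _; exact: HC1.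
split; [exact: h0|exact: h1|].
have eU x y : 0 <= x <= pi -> j0 (U e) x (- y) = j0 (U e) x y.
  by move=> xp; have [E1 E2] := sf_even F y xp; rewrite /= /cnorm2 E1 E2 chN sqrrN.
have -> : (fun n => bdry f f1 f2 e c n%:R) =
    (fun n => 2 * (Int 0 n%:R (fun y => j0 (U e) 0 y * edge_weight c y) +
                   Int 0 n%:R (fun y => j0 (U e) (pi / 2) y * axis_weight c y))).
  apply/funext => n; rewrite -IntD// -Int_even//; first exact: contID.
  move=> y; rewrite !eU//; congr (_ * _ + _ * _); first by rewrite /edge_weight mulrN chN.
  by rewrite !axis_weightE mulrN chN.
apply: cvgM; first exact: cvg_cst.
by apply: cvgD; [exact: l0|exact: l1].
Qed.

End BoundaryLimit.

Section BoundaryFunctional.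
Context {R : realType}.
Variables (D : R -> R -> Prop) (f f1 f2 : R -> R -> cplx R).
Implicit Types (x y e c : R).
Local Notation mu := (@lebesgue_measure R).
Local Notation U := (reglog f f1 f2).
Local Notation en := (fun n : nat => (n.+1%:R^-1 : R)).

(** Since [ln 0 = 0], a zero of [f] gives the value 0; on the edge [x = 0] such points form a null
    set by [edge_ln_cvg]. *)
Definition lnabs x y : R := 2^-1 * ln (cnorm2 (f x y)).

Definition bdry_lim e c : R := Hint (fun y => j0 (U e) 0 y * edge_weight c y) +
  Hint (fun y => j0 (U e) (pi / 2) y * axis_weight c y).

Definition bdry_ln c : R := Hint (fun y => lnabs 0 y * edge_weight c y) +
  Hint (fun y => lnabs (pi / 2) y * axis_weight c y).

Lemma harmonic01 n : 0 < (en n) <= 1.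
Proof. by rewrite invr_gt0 ltr0n/= invf_le1 ?ltr0n// ler1n. Qed.

Lemma harmonic_near e : 0 < e -> \forall n \near \oo, en n <= e.
Proof.
move=> e0; have /cvgrPdist_le/(_ e e0) := @cvg_harmonic R; apply: filterS => n.
by rewrite sub0r normrN ger0_norm// invr_ge0.
Qed.

Lemma bdry_lim_ge (F : strip_fun D f f1 f2) e c k : 0 < e <= 1 -> 0 < c < 1 ->
  (exists2 Y0 : R, 1 <= Y0 & forall Y, Y0 <= Y -> k <= bdry f f1 f2 e c Y) -> k / 2 <= bdry_lim e c.
Proof.
move=> e01 c01 [Y0 _ HY]; have [_ _ l] := bdry_limit F e01 c01.
have : k <= 2 * bdry_lim e c; last by lra.
rewrite /bdry_lim -(cvg_lim _ l)//; apply: limr_ge; first by apply/cvg_ex; eexists; exact: l.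
by apply: filterS (nbhs_infty_ger Y0) => n; exact: HY.
Qed.

Lemma bdry_lim_le (F : strip_fun D f f1 f2) e c k : 0 < e <= 1 -> 0 < c < 1 ->
  (exists2 Y0 : R, 1 <= Y0 & forall Y, Y0 <= Y -> bdry f f1 f2 e c Y <= k) -> bdry_lim e c <= k / 2.
Proof.
move=> e01 c01 [Y0 _ HY]; have [_ _ l] := bdry_limit F e01 c01.
have : 2 * bdry_lim e c <= k; last by lra.
rewrite /bdry_lim -(cvg_lim _ l)//; apply: limr_le; first by apply/cvg_ex; eexists; exact: l.
by apply: filterS (nbhs_infty_ger Y0) => n; exact: HY.
Qed.

Lemma bdry_lim_ge0 (F : strip_fun D f f1 f2) e c : 0 < e <= 1 -> 0 < c < 1 -> 0 <= bdry_lim e c.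
Proof.
move=> e01 c01; apply/ler_addgt0Pr => eta eta0.
have e2 : 0 < 2 * eta by rewrite mulr_gt0.
have := bdry_lim_ge F e01 c01 (bdry_ge F e01 c01 e2); lra.
Qed.

Lemma continuous_cnorm2 (F : strip_fun D f f1 f2) x y : 0 <= x <= pi ->
  {for y, continuous (fun y => cnorm2 (f x y))}.
Proof.
move=> xp; have [c1 c2] := sf_cont F (sf_dom F y xp).
apply: (@cont2_secr _ (fun x y => cnorm2 (f x y))); rewrite /cnorm2.
by apply: cont2D; exact: cont2X.
Qed.

Lemma continuous_measurable_half (g : R -> R) : (forall y, {for y, continuous g}) ->
  measurable_fun (`[0, +oo[ : set R) g.
Proof. by move=> cg; apply: measurable_funTS; exact: continuous_measurable_fun. Qed.

Lemma le_Hint (g h : R -> R) : Hintegrable g -> Hintegrable h ->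
  (forall y, 0 <= y -> g y <= h y) -> Hint g <= Hint h.
Proof.
move=> ig ih gh; apply: le_Rintegral => //.
by move=> y; rewrite /= in_itv/= andbT; exact: gh.
Qed.

Lemma measurable_edge_weight c : measurable_fun (`[0, +oo[ : set R) (edge_weight c).
Proof.
by apply: continuous_measurable_half => y; apply: (contI_edge_weight (a := y) (b := y)); rewrite lexx.
Qed.

Lemma measurable_axis_weight c : 0 < c < 1 -> measurable_fun (`[0, +oo[ : set R) (axis_weight c).
Proof.
move=> c01; apply: continuous_measurable_half => y.
by apply: (contI_axis_weight (a := y) (b := y)) => //; rewrite lexx.
Qed.

Lemma measurable_lnabs (F : strip_fun D f f1 f2) x : 0 <= x <= pi ->
  measurable_fun (`[0, +oo[ : set R) (lnabs x).
Proof.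
move=> xp; apply: measurable_funM => //; apply: (measurableT_comp (@measurable_ln R)).
by apply: continuous_measurable_half => y; exact: (continuous_cnorm2 F).
Qed.

Lemma HintegrableZ C (g : R -> R) : Hintegrable g -> Hintegrable (fun y => C * g y).
Proof.
move=> ig; rewrite /Hintegrable (_ : _ \o _ = (fun y => C%:E * (EFin \o g) y)%E).
  exact: integrableZl.
by apply/funext => y; rewrite /= EFinM.
Qed.

Lemma lorentzZ_integrable C : Hintegrable (fun y => C * lorentz y).
Proof. by apply: HintegrableZ; exact: lorentz_integrable. Qed.

(** The lower bound demanded by [regularised_ln_cvg] is [bdry_lim >= 0] itself: the integral over
    [x = 0] is at least minus that over the slit, which [axis_abs] bounds uniformly in [e]. *)
Lemma edge_ln_cvg (F : strip_fun D f f1 f2) c : 0 < c < 1 ->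
  [/\ {ae mu, forall y, `[0, +oo[%classic y -> 0 < cnorm2 (f 0 y)},
      Hintegrable (fun y => lnabs 0 y * edge_weight c y) &
      Hint (fun y => j0 (U (en n)) 0 y * edge_weight c y) @[n --> \oo] -->
      Hint (fun y => lnabs 0 y * edge_weight c y)].
Proof.
move=> c01; have p := @pi_gt0 R; have i0 : 0 <= (0 : R) <= pi by apply/andP; split; lra.
have [C HC] := axis_abs F c01.
have mE : measurable_fun (`[0, +oo[ : set R) (fun y : R => ch y ^+ 6).
  apply: continuous_measurable_half => y.
  by apply: (@der_continuous _ _ _ (6%:R * ch y ^+ 5 * sh y)); der_auto.
have [||||||||h1 h2 h3] := @regularised_ln_cvg _ _ R mu `[0, +oo[ (fun y => cnorm2 (f 0 y))
  (fun y => ch y ^+ 6) (edge_weight c) (Hint (fun y => C * lorentz y)) (measurable_itv _).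
- by apply: continuous_measurable_half => y; exact: (continuous_cnorm2 F).
- exact: mE.
- exact: measurable_edge_weight.
- by move=> y _; rewrite cnorm2_ge0.
- by move=> y _; rewrite exprn_gt0 ?ch_gt0.
- by move=> y _; have /andP[] := edge_weight_le y c01.
- by move=> n; have [+ _ _] := bdry_limit F (harmonic01 n) c01.
- move=> n; have := bdry_lim_ge0 F (harmonic01 n) c01; rewrite /bdry_lim.
  have [_ i1 _] := bdry_limit F (harmonic01 n) c01.
  have : Hint (fun y => j0 (U (en n)) (pi / 2) y * axis_weight c y) <= Hint (fun y => C * lorentz y).
    apply: le_Hint => //; first exact: lorentzZ_integrable.
    by move=> y _; apply: le_trans (ler_norm _) _; exact: HC (harmonic01 n).
  rewrite -/(Hint _); set u := Hint _; set v := Hint _; set w := Hint _ => h1 h2; lra.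
- by split.
Qed.

Lemma axis_ln_cvg (F : strip_fun D f f1 f2) c : 0 < c < 1 ->
  Hintegrable (fun y => lnabs (pi / 2) y * axis_weight c y) /\
  Hint (fun y => j0 (U (en n)) (pi / 2) y * axis_weight c y) @[n --> \oo] -->
  Hint (fun y => lnabs (pi / 2) y * axis_weight c y).
Proof.
move=> c01; have p := @pi_gt0 R; have i0 : 0 <= (pi / 2 : R) <= pi by apply/andP; split; lra.
have [C HC] := axis_abs F c01.
have mU n : measurable_fun (`[0, +oo[ : set R) (j0 (U (en n)) (pi / 2)).
  apply: continuous_measurable_half => y; have /andP[e0 _] := harmonic01 n.
  by apply: (contI_reglog F e0 i0 (a := y) (b := y)); rewrite lexx.
have [|||||i1 c1] := @Rdominated_cvg _ _ R mu `[0, +oo[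
  (fun n y => j0 (U (en n)) (pi / 2) y * axis_weight c y)
  (fun y => lnabs (pi / 2) y * axis_weight c y) (fun y => C * lorentz y) (measurable_itv _).
- by move=> n; apply: measurable_funM; [exact: mU|exact: measurable_axis_weight].
- by apply: measurable_funM; [exact: (measurable_lnabs F)|exact: measurable_axis_weight].
- apply: aeW => y _; apply: cvgM; last exact: cvg_cst.
  apply: cvgM; first exact: cvg_cst.
  have [h1 _] := sf_axis F y; have /andP[h2 _] := sf_axis_bounds F y.
  apply: (@continuous_cvg _ R R _ _ (fun n : nat => cnorm2 (f (pi / 2) y) + (n.+1%:R^-1) ^+ 2 * ch y ^+ 6) (@ln R) (cnorm2 (f (pi / 2) y))).
    by apply: continuous_ln; rewrite /cnorm2 h1; nra.
  rewrite -[X in _ --> X]addr0; apply: cvgD; first exact: cvg_cst.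
  rewrite -[X in _ --> X](mul0r (ch y ^+ 6)); apply: cvgM; last exact: cvg_cst.
  have -> : (0 : R) = 0 ^+ 2 by rewrite expr0n.
  by apply: (@continuous_cvg _ R R _ _ (fun n : nat => n.+1%:R^-1) (fun z : R => z ^+ 2) 0); [exact: exprn_continuous|exact: cvg_harmonic].
- exact: lorentzZ_integrable.
- by apply: aeW => y n _; exact: HC (harmonic01 n).
- by split.
Qed.

Lemma bdry_lim_cvg (F : strip_fun D f f1 f2) c : 0 < c < 1 ->
  bdry_lim (en n) c @[n --> \oo] --> bdry_ln c.
Proof.
by move=> c01; have [_ _ l0] := edge_ln_cvg F c01; have [_ l1] := axis_ln_cvg F c01; exact: cvgD.
Qed.

Lemma bdry_ln_zero (F : strip_fun D f f1 f2) x0 y0 : 0 < x0 < pi / 2 -> cnorm2 (f x0 y0) = 0 ->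
  exists2 k : R, 0 < k & forall c, 1 / 2 <= c < 1 -> k <= bdry_ln c.
Proof.
move=> x0I fz; have [k [e0 [k0 /andP[e00 e01] H]]] := bdry_ge_zero F x0I fz.
exists (k / 2); first by rewrite divr_gt0.
move=> c cI; have c01 : 0 < c < 1 by case/andP: cI => ? ?; apply/andP; split; lra.
have l := bdry_lim_cvg F c01; rewrite -(cvg_lim _ l)//; apply: limr_ge.
  by apply/cvg_ex; eexists; exact: l.
near=> n; have /andP[n0 n1] := harmonic01 n.
apply: bdry_lim_ge => //; first by rewrite n0.
apply: H => //; rewrite n0/=; near: n; exact: harmonic_near.
Unshelve. all: end_near. Qed.

Lemma bdry_ln_nozero (F : strip_fun D f f1 f2) c : 0 < c < 1 ->
  (forall x y, 0 < x <= pi / 2 -> cnorm2 (f x y) != 0) -> bdry_ln c = 0.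
Proof.
move=> c01 nz; have l := bdry_lim_cvg F c01.
have cl : cvgn (fun n => bdry_lim (en n) c) by apply/cvg_ex; eexists; exact: l.
apply/eqP; rewrite eq_le -(cvg_lim _ l)//; apply/andP; split; last first.
  by apply: limr_ge => //; apply: nearW => n; exact: (bdry_lim_ge0 F (harmonic01 n)).
apply/ler_addgt0Pr => eta eta0; rewrite add0r.
have [e0 /andP[e00 _] H] := bdry_le_small F c01 eta0 nz.
apply: limr_le => //; near=> n; have /andP[n0 n1] := harmonic01 n.
have : bdry_lim (en n) c <= eta / 2.
  apply: (bdry_lim_le F) => //; first by rewrite n0.
  by apply: H; rewrite n0/=; near: n; exact: harmonic_near.
by have := eta0; lra.
Unshelve. all: end_near. Qed.

End BoundaryFunctional.

(** * The limit of [c] to 1 *)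

Section UnitParameter.
Context {R : realType}.
Variables (D : R -> R -> Prop) (f f1 f2 : R -> R -> cplx R).
Implicit Types (x y e c : R).
Local Notation mu := (@lebesgue_measure R).
Local Notation U := (reglog f f1 f2).
Local Notation cn := (fun n : nat => (1 - 2^-1 * n.+1%:R^-1 : R)).

Lemma measurable_fun_recip (A : set R) (g : R -> R) : measurable_fun A g -> (forall y, 0 <= g y) ->
  measurable_fun A (fun y => (g y)^-1).
Proof.
move=> mg g0; rewrite (_ : (fun y => _) = (fun y => g y `^ (-1))).
  exact: (measurableT_comp (@measurable_powR R (-1))).
by apply/funext => y; rewrite powR_inv1.
Qed.

Lemma approx_one n : 1 / 2 <= cn n < 1.
Proof.
have := @harmonic01 R n; move: (n.+1%:R^-1 : R) => z /andP[h0 h1].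
by apply/andP; split; lra.
Qed.

Lemma approx_one_cvg : cn n @[n --> \oo] --> (1 : R).
Proof.
rewrite -[X in _ --> X]subr0; apply: cvgB; first exact: cvg_cst.
rewrite -(mulr0 2^-1); apply: cvgM; first exact: cvg_cst.
exact: cvg_harmonic.
Qed.

Lemma edge_weight1 y : edge_weight 1 y = (ch y ^+ 2)^-1.
Proof.
rewrite /edge_weight !mulr1 ch_double (_ : 1 + (_ - 1) = 2 * ch y ^+ 2); last by ring.
by rewrite (invfM 2) mulrA divff// mul1r.
Qed.

(** At [c = 1] the denominator is the square of [ch (2 * y) - 1 = 2 * sh y ^+ 2], nonzero off
    [y = 0], so continuity in [c] applies. *)
Lemma axis_weight_cvg y : 0 < y -> axis_weight (cn n) y @[n --> \oo] --> (sh y ^+ 2)^-1.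
Proof.
move=> y0; have s0 := sh_gt0 y0; have s2 : 0 < sh y ^+ 2 by rewrite exprn_gt0.
have E : ch (2 * y) = 1 + 2 * sh y ^+ 2 by rewrite ch_double; have := chE y; lra.
have H : axis_weight 1 y = (sh y ^+ 2)^-1.
  by rewrite axis_weightE !mulr1 cospi E; field; lra.
rewrite -H; apply: (@continuous_cvg _ R R _ _ cn (axis_weight ^~ y) 1); last exact: approx_one_cvg.
have q0 : (cos (pi * 1) + ch (2 * 1 * y)) ^+ 2 != 0.
  by rewrite !mulr1 cospi E expf_neq0// gt_eqF//; lra.
rewrite (_ : axis_weight ^~ y = fun c =>
   - (2 * c * (1 + cos (pi * c) * ch (2 * c * y)) / (cos (pi * c) + ch (2 * c * y)) ^+ 2)); last first.
  by apply/funext => c; rewrite axis_weightE.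
have dcos : der (fun c => cos (pi * c)) 1 (- (pi * sin (pi * 1))) by der_auto; ring.
have dch : der (fun c => ch (2 * c * y)) 1 (2 * y * sh (2 * 1 * y)) by der_auto; ring.
apply: der_continuous; apply: derN; apply: derM; last first.
  apply: derV; first exact: q0.
  by apply: derX; apply: derD; [exact: dcos|exact: dch].
apply: derM; first by apply: derM; [exact: derC|exact: der_id].
by apply: derD; [exact: derC|apply: derM; [exact: dcos|exact: dch]].
Qed.

Lemma edge_weight_cvg y : edge_weight (cn n) y @[n --> \oo] --> (ch y ^+ 2)^-1.
Proof.
rewrite -edge_weight1; apply: (@continuous_cvg _ R R _ _ cn (edge_weight ^~ y) 1); last exact: approx_one_cvg.
have h := ch_gt0 (2 * 1 * y).
have dch : der (fun c => 1 + ch (2 * c * y)) 1 (2 * y * sh (2 * 1 * y)) by der_auto; ring.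
apply: der_continuous; apply: derM; last by apply: derV; [rewrite gt_eqF//; lra|exact: dch].
by apply: derM; [exact: derC|exact: der_id].
Qed.

Lemma axis_ln_bounds (F : strip_fun D f f1 f2) y : 0 <= lnabs f (pi / 2) y <= ln (ch y).
Proof.
have [h1 _] := sf_axis F y; have /andP[h2 h3] := sf_axis_bounds F y.
have r0 : 0 < re (f (pi / 2) y) by lra.
have -> : lnabs f (pi / 2) y = ln (re (f (pi / 2) y)).
  by rewrite /lnabs /cnorm2 h1 expr0n addr0 (lnXn 2 r0) -[ln _ *+ 2]mulr_natl mulrA mulVf ?mul1r.
by rewrite ln_ge0//= ler_ln ?posrE// ch_gt0.
Qed.

(** The quotient is at most 2 because [ln z <= z - 1]; where [ch y < 2] one has [|y| < 3], so
    [lorentz y >= 1 / 10] and the constant 20 suffices. Where [ch y >= 2], [ch_decay] takes over. *)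
Lemma lnch_recip_lorentz : exists2 C : R, 0 <= C & forall y, 2 * ln (ch y) / (ch y - 1) <= C * lorentz y.
Proof.
have [C C0 HC] := @ch_decay R 1 0 ltr01 (lexx 0); exists (20 + 2 * C); first lra.
move=> y; have h1 := ch_ge1 y; have l0 := lnch_ge0 y; have l1 := lnch_le_ch y.
have q0 := lorentz_gt0 y; have := HC y; rewrite mul1r add0r => HCy.
have c0 := ch_gt0 y; have [h2|h2] := lerP 2 (ch y).
  apply: le_trans (_ : 2 * (3 * ln (ch y) / ch y) <= _); last first.
    have : 0 <= 20 * lorentz y by lra.
    lra.
  rewrite -subr_ge0 (_ : _ - _ = ln (ch y) * (4 * ch y - 6) / (ch y * (ch y - 1))); last by field; lra.
  by rewrite divr_ge0// mulr_ge0//; lra.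
have : 2 * ln (ch y) / (ch y - 1) <= 2.
  move: h1; rewrite le_eqVlt => /predU1P[<-|h1]; first by rewrite subrr invr0 mulr0.
  by rewrite ler_pdivrMr; lra.
have := ch_cube y (@ltr01 R); rewrite !mul1r => h3.
have y0 := normr_ge0 y; set z := `|y| in y0 h3.
have z3 : z < 3.
  rewrite ltNge; apply/negP => z3; have : 27 <= z ^+ 3 by rewrite (_ : 27 = 3 ^+ 3); [apply: lerXn2r; rewrite ?nnegrE//; lra|ring].
  lra.
have z2 : y ^+ 2 < 9 by have : z ^+ 2 = y ^+ 2 by [rewrite real_normK ?num_real]; nra.
have : 10^-1 <= lorentz y by rewrite /lorentz lef_pV2 ?posrE ?lorentz_den_gt0//; lra.
have := mulr_ge0 (ltW C0) (ltW q0); lra.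
Qed.

Lemma ch_le_double c y : 1 / 2 <= c -> ch y <= ch (2 * c * y).
Proof.
move=> c2; rewrite -(ch_norm y) -(ch_norm (_ * y)).
by apply: ch_homo; rewrite ?normr_ge0// normrM ler_peMl// ger0_norm; lra.
Qed.

(** Dominated convergence on both edges. At [x = 0] each weight with [c >= 1 / 2] is at most twice
    that of [1 / 2], for which integrability is known. On the slit the singularity of the weight at
    [y = 0] is offset by [ln |f| <= ln (ch y)]. *)
Lemma bdry_ln_cvg (F : strip_fun D f f1 f2) :
  [/\ Hintegrable (fun y => lnabs f 0 y * (ch y ^+ 2)^-1),
      Hintegrable (fun y => lnabs f (pi / 2) y * (sh y ^+ 2)^-1) &
      bdry_ln f (cn n) @[n --> \oo] --> Hint (fun y => lnabs f 0 y * (ch y ^+ 2)^-1) +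
        Hint (fun y => lnabs f (pi / 2) y * (sh y ^+ 2)^-1)].
Proof.
have p := @pi_gt0 R.
have i0 : 0 <= (0 : R) <= pi by apply/andP; split; lra.
have i1 : 0 <= (pi / 2 : R) <= pi by apply/andP; split; lra.
have cn01 n : 0 < (cn n) < 1 by have /andP[h1 ->] := approx_one n; rewrite andbT (lt_le_trans _ h1)// divr_gt0.
have chc n y : ch y <= ch (2 * (cn n) * y) by apply: ch_le_double; have /andP[] := approx_one n.
have half01 : 0 < (2^-1 : R) < 1 by apply/andP; split; lra.
have [_ iL _] := edge_ln_cvg F half01.
have iG : Hintegrable (fun y => 2 * `|lnabs f 0 y * edge_weight 2^-1 y|).
  have i2 : Hintegrable (fun y => `|lnabs f 0 y * edge_weight 2^-1 y|).
    by have := integrable_abse iL; apply: eq_integrable => // x _.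
  exact: HintegrableZ.
have m0 := measurable_lnabs F i0; have m1 := measurable_lnabs F i1.
have mch : measurable_fun (`[0, +oo[ : set R) (fun y : R => (ch y ^+ 2)^-1).
  apply: measurable_fun_recip; last by move=> y; exact: sqr_ge0.
  apply: continuous_measurable_half => y.
  by apply: (@der_continuous _ _ _ (2%:R * ch y ^+ 1 * sh y)); der_auto.
have msh : measurable_fun (`[0, +oo[ : set R) (fun y : R => (sh y ^+ 2)^-1).
  apply: measurable_fun_recip; last by move=> y; exact: sqr_ge0.
  apply: continuous_measurable_half => y.
  by apply: (@der_continuous _ _ _ (2%:R * sh y ^+ 1 * ch y)); der_auto.
have [|||||j0 l0] := @Rdominated_cvg _ _ R mu `[0, +oo[
  (fun n y => lnabs f 0 y * edge_weight (cn n) y)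
  (fun y => lnabs f 0 y * (ch y ^+ 2)^-1) (fun y => 2 * `|lnabs f 0 y * edge_weight 2^-1 y|) (measurable_itv _).
- by move=> n; apply: measurable_funM; [exact: m0|exact: measurable_edge_weight].
- by apply: measurable_funM; [exact: m0|exact: mch].
- by apply: aeW => y _; apply: cvgM; [exact: cvg_cst|exact: edge_weight_cvg].
- exact: iG.
- apply: aeW => y n _; rewrite !(normrM (lnabs f 0 y)) (mulrCA 2); apply: ler_wpM2l; first exact: normr_ge0.
  have /andP[w0 _] := edge_weight_le y (cn01 n); have /andP[v0 _] := edge_weight_le y half01.
  rewrite (gtr0_norm w0) (gtr0_norm v0) /edge_weight; have /andP[h1 h2] := cn01 n.
  have c1 := chc n y; have c0 := ch_ge1 y.
  rewrite divff// !mul1r; move: c1 h1 h2; move: (1 - _) => c c1 h1 h2.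
  apply: ler_pM; [lra|rewrite invr_ge0; lra|lra|].
  by rewrite lef_pV2 ?posrE; lra.
have [C C0 HC] := lnch_recip_lorentz.
have [|||||j1 l1] := @Rdominated_cvg _ _ R mu `[0, +oo[
  (fun n y => lnabs f (pi / 2) y * axis_weight (cn n) y)
  (fun y => lnabs f (pi / 2) y * (sh y ^+ 2)^-1) (fun y => C * lorentz y) (measurable_itv _).
- by move=> n; apply: measurable_funM; [exact: m1|exact: measurable_axis_weight].
- by apply: measurable_funM; [exact: m1|exact: msh].
(* At [y = 0] the logarithm vanishes, so convergence holds whatever the weights do. *)
- apply: aeW => y; rewrite /= in_itv/= andbT le_eqVlt => /predU1P[<-|y0].
    have /andP[g0 g1] := axis_ln_bounds F 0; rewrite ch0 ln1 in g1.
    have -> : lnabs f (pi / 2) 0 = 0 by apply/eqP; rewrite eq_le g0 g1.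
    by rewrite mul0r; under eq_fun do rewrite mul0r; exact: cvg_cst.
  by apply: cvgM; [exact: cvg_cst|exact: axis_weight_cvg].
- exact: lorentzZ_integrable.
- apply: aeW => y n _; have /andP[g0 g1] := axis_ln_bounds F y.
  rewrite normrM (ger0_norm g0); apply: le_trans (HC y).
  have := ch_ge1 y; rewrite le_eqVlt => /predU1P[h|h].
    rewrite -h ln1 in g1; have -> : lnabs f (pi / 2) y = 0 by apply/eqP; rewrite eq_le g0 g1.
    by rewrite mul0r -h ln1 mulr0 mul0r.
  rewrite (_ : 2 * ln (ch y) / (ch y - 1) = ln (ch y) * (2 / (ch y - 1))); last by ring.
  apply: ler_pM => //; apply: le_trans (axis_weight_le y (cn01 n)) _.
  have c1 := chc n y; have := cos_geN1 (pi * (cn n)) => c2.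
  by rewrite ler_pM2l// lef_pV2 ?posrE; lra.
split; [exact: j0|exact: j1|].
by apply: cvgD; [exact: l0|exact: l1].
Qed.

(** Without zeros [bdry_ln] vanishes for every [c < 1]; with a zero it is at least a fixed [k > 0]
    for all [c] in [[1 / 2, 1[]. The limit preserves both. *)
Lemma bdry_identity_iff (F : strip_fun D f f1 f2) :
  Hint (fun y => lnabs f 0 y * (ch y ^+ 2)^-1) + Hint (fun y => lnabs f (pi / 2) y * (sh y ^+ 2)^-1) = 0 <->
  (forall x y, 0 < x < pi / 2 -> cnorm2 (f x y) != 0).
Proof.
have [_ _ l] := bdry_ln_cvg F.
have cl : cvgn (fun n => bdry_ln f (cn n)) by apply/cvg_ex; eexists; exact: l.
have cn01 n : 0 < (cn n) < 1 by have /andP[h1 ->] := approx_one n; rewrite andbT (lt_le_trans _ h1)// divr_gt0.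
split.
  move=> H x y xI; apply/negP => /eqP fz; have [k k0 Hk] := bdry_ln_zero F xI fz.
  have : k <= 0; last by lra.
  by rewrite -H -(cvg_lim _ l)//; apply: limr_ge => //; apply: nearW => n; apply: Hk; exact: approx_one.
move=> nz; rewrite -(cvg_lim _ l)//; apply/cvg_lim => //; apply: cvg_near_cst; apply: nearW => n.
apply: (bdry_ln_nozero F) => // x y /andP[x0]; rewrite le_eqVlt => /predU1P[->|x1]; last first.
  by apply: nz; rewrite x0.
have [h1 _] := sf_axis F y; have /andP[h2 _] := sf_axis_bounds F y.
by rewrite /cnorm2 h1 gt_eqF//; nra.
Qed.

End UnitParameter.

(** * Change of variables from [y] to [t] and [sigma] *)

Section HalfLineSubstitution.
Context {R : realType}.
Implicit Types (a l x y : R).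
Local Notation mu := (@lebesgue_measure R).

(** The rule for nonnegative functions, applied to the positive and negative parts of [G];
    positivity of [F'] lets the maximum with 0 commute with the jacobian. *)
Lemma half_line_substitution (F F' G : R -> R) a l :
  (forall x, a <= x -> der F x (F' x)) -> (forall x, a <= x -> 0 < F' x) ->
  (forall x, a <= x -> {for x, continuous F'}) -> F' x @[x --> +oo] --> l ->
  F x @[x --> +oo] --> +oo -> (forall y, F a <= y -> {for y, continuous G}) ->
  (\int[mu]_(y in `[F a, +oo[) (G y)%:E = \int[mu]_(x in `[a, +oo[) (G (F x) * F' x)%:E)%E.
Proof.
move=> dF F'0 cF' F'l Foo.
have mF x y : a <= x -> x < y -> F x < F y.
  move=> ax xy; have [z|z /andP[xz zy] E] := der_mvt (ltW xy) (f := F) (f' := F').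
    by move=> /andP[xz _]; apply: dF; exact: le_trans xz.
  rewrite -subr_gt0 E mulr_gt0 ?subr_gt0// F'0//; exact: le_trans xz.
have eF' x : a <= x -> F^`() x = F' x by move=> /dF; exact: der_derive1.
have pos (H : R -> R) : (forall y, F a <= y -> {for y, continuous H}) -> (forall y, 0 <= H y) ->
    (\int[mu]_(y in `[F a, +oo[) (H y)%:E = \int[mu]_(x in `[a, +oo[) (H (F x) * F' x)%:E)%E.
  move=> cH H0; rewrite (@increasing_ge0_integration_by_substitutiony _ F H a).
  - by apply: eq_integral => x; rewrite inE/= in_itv/= andbT => ax; rewrite fctE/= eF'.
  - by move=> x y; rewrite !in_itv/= !andbT => ax ay; exact: mF.
  - move=> x; rewrite in_itv/= andbT => ax.
    rewrite /continuous_at eF' ?ltW//; apply: cvg_trans (cF' x (ltW ax)).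
    apply: near_eq_cvg; near=> z; rewrite eF'//; apply: ltW; near: z; exact: lt_nbhsr.
  - apply/cvg_ex; exists (F' a); apply: cvg_trans (cvg_at_right_filter (cF' a (lexx a))).
    apply: near_eq_cvg; near=> z; rewrite eF'//; apply: ltW; near: z; exact: nbhs_right_gt.
  - apply/cvg_ex; exists l; apply: cvg_trans F'l; apply: near_eq_cvg; near=> z.
    by rewrite eF'//; near: z; apply: nbhs_pinfty_ge; rewrite num_real.
  - split; first by move=> x; rewrite in_itv/= andbT => /ltW /dF; exact: der_derivable.
    by apply: cvg_at_right_filter; apply: der_continuous (dF a _).
  - exact: Foo.
  - apply: continuous_in_subspaceT => y; rewrite inE/= in_itv/= andbT; exact: cH.
  - by move=> y _; exact: H0.
move=> cG; rewrite integralE [RHS]integralE; congr (_ - _)%E.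
  transitivity (\int[mu]_(y in `[F a, +oo[) (Num.max (G y) 0)%:E)%E.
    by apply: eq_integral => y _; rewrite funeposE EFin_max.
  rewrite (pos (fun y => Num.max (G y) 0)).
  - apply: eq_integral => x; rewrite inE/= in_itv/= andbT => ax; rewrite funeposE -EFin_max.
    by rewrite maxr_pMl ?mul0r// ltW// F'0.
  - by move=> y /cG cy; apply: continuous_max => //; exact: cst_continuous.
  - by move=> y; rewrite le_max lexx orbT.
transitivity (\int[mu]_(y in `[F a, +oo[) (Num.max (- G y) 0)%:E)%E.
  by apply: eq_integral => y _; rewrite funenegE EFin_max.
rewrite (pos (fun y => Num.max (- G y) 0)).
- apply: eq_integral => x; rewrite inE/= in_itv/= andbT => ax; rewrite funenegE -EFinN -EFin_max.
  by rewrite maxr_pMl ?mul0r ?mulNr// ltW// F'0.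
- by move=> y /cG cy; apply: continuous_max; [exact: continuousN|exact: cst_continuous].
- by move=> y; rewrite le_max lexx orbT.
Unshelve. all: end_near. Qed.

End HalfLineSubstitution.

Section HyperbolicInverses.
Context {R : realType}.
Implicit Types (t p y : R).

Lemma der_sqrt (g : R -> R) x l : 0 < g x -> der g x l ->
  der (fun x => Num.sqrt (g x)) x (l * (2 * Num.sqrt (g x))^-1).
Proof. by move=> g0 dg; apply: der_comp dg (is_derive1_sqrt g0). Qed.

Definition asinh t := ln (t + Num.sqrt (t ^+ 2 + 1)).

Definition acosh t := ln (t + Num.sqrt (t ^+ 2 - 1)).

Lemma asinh_root t : [/\ 0 < Num.sqrt (t ^+ 2 + 1), Num.sqrt (t ^+ 2 + 1) ^+ 2 = t ^+ 2 + 1 &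
  0 < t + Num.sqrt (t ^+ 2 + 1)].
Proof.
have t2 := sqr_ge0 t; have q : 0 < t ^+ 2 + 1 by lra.
have s0 : 0 < Num.sqrt (t ^+ 2 + 1) by rewrite sqrtr_gt0.
have s2 : Num.sqrt (t ^+ 2 + 1) ^+ 2 = t ^+ 2 + 1 by rewrite sqr_sqrtr// ltW.
by split=> //; nra.
Qed.

Lemma sh_asinh t : sh (asinh t) = t.
Proof.
have [s0 s2 p0] := asinh_root t; rewrite sh_ln//; set s := Num.sqrt _ in s0 s2 p0 *.
have -> : (t + s)^-1 = s - t.
  by apply: (mulfI (lt0r_neq0 p0)); rewrite divff ?gt_eqF//; nra.
by field.
Qed.

Lemma ch_asinh t : ch (asinh t) = Num.sqrt (t ^+ 2 + 1).
Proof.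
have [s0 s2 p0] := asinh_root t; have := chE (asinh t); rewrite sh_asinh => h.
have c0 := ch_gt0 (asinh t); set s := Num.sqrt _ in s0 s2 p0 *; nra.
Qed.

Lemma der_asinh t : der asinh t (Num.sqrt (t ^+ 2 + 1))^-1.
Proof.
have [s0 s2 p0] := asinh_root t; have t2 := sqr_ge0 t.
have d : der (fun t => t ^+ 2 + 1) t (2%:R * t) by der_auto; ring.
apply: der_eq; first by apply: (@der_ln _ (fun t => t + Num.sqrt (t ^+ 2 + 1)) t _ p0); apply: derD; [exact: der_id|apply: der_sqrt d; lra].
set s := Num.sqrt _ in s0 s2 p0 *; by field; lra.
Qed.

Lemma acosh_root t : 1 < t -> [/\ 0 < Num.sqrt (t ^+ 2 - 1), Num.sqrt (t ^+ 2 - 1) ^+ 2 = t ^+ 2 - 1 &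
  0 < t + Num.sqrt (t ^+ 2 - 1)].
Proof.
move=> t1; have q : 0 < t ^+ 2 - 1 by nra.
have s0 : 0 < Num.sqrt (t ^+ 2 - 1) by rewrite sqrtr_gt0.
by split; rewrite ?sqr_sqrtr; lra.
Qed.

Lemma ch_acosh t : 1 < t -> ch (acosh t) = t.
Proof.
move=> t1; have [s0 s2 p0] := acosh_root t1; rewrite ch_ln//; set s := Num.sqrt _ in s0 s2 p0 *.
have -> : (t + s)^-1 = t - s.
  by apply: (mulfI (lt0r_neq0 p0)); rewrite divff ?gt_eqF//; nra.
by field.
Qed.

Lemma sh_acosh t : 1 < t -> sh (acosh t) = Num.sqrt (t ^+ 2 - 1).
Proof.
move=> t1; have [s0 s2 p0] := acosh_root t1; rewrite sh_ln//; set s := Num.sqrt _ in s0 s2 p0 *.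
have -> : (t + s)^-1 = t - s.
  by apply: (mulfI (lt0r_neq0 p0)); rewrite divff ?gt_eqF//; nra.
by field.
Qed.

Lemma acosh_gt0 t : 1 < t -> 0 < acosh t.
Proof. by move=> t1; have [s0 _ _] := acosh_root t1; rewrite ln_gt0//; lra. Qed.

Lemma acosh_ch y : 0 < y -> acosh (ch y) = y.
Proof.
move=> y0; have s0 := sh_gt0 y0; rewrite /acosh (_ : ch y ^+ 2 - 1 = sh y ^+ 2); last by have := chE y; lra.
by rewrite sqrtr_sqr gtr0_norm// chDsh expRK.
Qed.

Lemma der_acosh t : 1 < t -> der acosh t (Num.sqrt (t ^+ 2 - 1))^-1.
Proof.
move=> t1; have [s0 s2 p0] := acosh_root t1; have t2 : 0 < t ^+ 2 - 1 by nra.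
have d : der (fun t => t ^+ 2 - 1) t (2%:R * t) by der_auto; ring.
apply: der_eq; first by apply: (@der_ln _ (fun t => t + Num.sqrt (t ^+ 2 - 1)) t _ p0); apply: derD; [exact: der_id|apply: der_sqrt d; lra].
set s := Num.sqrt _ in s0 s2 p0 *; by field; lra.
Qed.

End HyperbolicInverses.

Section CriticalLineSubstitution.
Context {R : realType}.
Implicit Types (a t y : R).
Local Notation mu := (@lebesgue_measure R).

Definition asinh_jac a t := (a * Num.sqrt ((t / a) ^+ 2 + 1))^-1.

Lemma asinh_jac_gt0 a t : 0 < a -> 0 < asinh_jac a t.
Proof. by move=> a0; rewrite invr_gt0 mulr_gt0//; have [] := asinh_root (t / a). Qed.

Lemma continuous_asinh y : {for y, continuous (@asinh R)}.
Proof. exact: der_continuous (der_asinh y). Qed.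

Lemma continuous_scale a t : {for t, continuous (fun t => t / a)}.
Proof. by apply: (@der_continuous _ _ _ (a^-1)); der_auto; ring. Qed.

Lemma continuous_asinh_jac a t : 0 < a -> {for t, continuous (asinh_jac a)}.
Proof.
move=> a0; have [s0 s2 p0] := asinh_root (t / a); have t2 := sqr_ge0 (t / a).
have d : der (fun t => (t / a) ^+ 2 + 1) t (2%:R * (t / a) / a) by der_auto; ring.
apply: der_continuous; apply: derV; first by rewrite mulf_neq0// gt_eqF.
by apply: derM; [exact: derC|apply: der_sqrt d; lra].
Qed.

Lemma asinh_substitution a (G : R -> R) : 0 < a -> (forall y, {for y, continuous G}) ->
  (\int[mu]_(y in `[0%R, +oo[) (G y)%:E =
   \int[mu]_(t in `[0%R, +oo[) (G (asinh (t / a)) * asinh_jac a t)%:E)%E.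
Proof.
move=> a0 cG; have E0 : asinh (0 / a) = 0.
  by rewrite mul0r /asinh expr0n/= !add0r sqrtr1 ln1.
rewrite -[in LHS]E0.
have jt t : 0 < t -> asinh_jac a t <= t^-1.
  move=> t0; have [s0 s2 p0] := asinh_root (t / a); rewrite /asinh_jac.
  have ta : 0 < t / a by rewrite divr_gt0.
  rewrite lef_pV2 ?posrE ?mulr_gt0// -ler_pdivrMl// mulrC; nra.
apply: (@half_line_substitution _ (fun t => asinh (t / a)) (asinh_jac a) G 0 0).
- move=> t _; have dt : der (fun t => t / a) t a^-1 by der_auto; ring.
  apply: der_eq (der_comp dt (der_asinh _)) _; by rewrite /asinh_jac invfM.
- by move=> t _; exact: asinh_jac_gt0.
- by move=> t _; exact: continuous_asinh_jac.
- apply/cvgrPdist_le => e e0; near=> t.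
  have te : e^-1 <= t by near: t; apply: nbhs_pinfty_ge; rewrite num_real.
  have t0 : 0 < t by apply: lt_le_trans te; rewrite invr_gt0.
  rewrite sub0r normrN gtr0_norm ?asinh_jac_gt0//; apply: le_trans (jt t t0) _.
  by rewrite -[leRHS]invrK lef_pV2 ?posrE ?invr_gt0.
- apply/cvgryPge => A; near=> t.
  have te : a * expR A <= t by near: t; apply: nbhs_pinfty_ge; rewrite num_real.
  have [s0 s2 p0] := asinh_root (t / a).
  rewrite -[A]expRK /asinh ler_ln ?posrE ?expR_gt0//.
  by move: te; rewrite mulrC -ler_pdivlMr// => te; lra.
- by move=> y _; exact: cG.
Unshelve. all: end_near. Qed.

Lemma asinh_integrable a (G : R -> R) : 0 < a -> (forall y, {for y, continuous G}) -> Hintegrable G ->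
  Hintegrable (fun t => G (asinh (t / a)) * asinh_jac a t).
Proof.
move=> a0 cG /integrableP[_ iG]; apply/integrableP; split.
  apply/measurable_EFinP; apply: continuous_measurable_half => t.
  apply: continuousM; last exact: continuous_asinh_jac.
  apply: continuous_comp; last exact: cG.
  by apply: continuous_comp; [exact: continuous_scale|exact: continuous_asinh].
have H := @asinh_substitution a (fun y => `|G y|) a0; rewrite /= in iG H.
rewrite (_ : (\int[mu]_(t in _) _)%E = (\int[mu]_(y in `[0%R, +oo[) (`|G y|)%:E)%E) ?iG//.
rewrite H; last by move=> y; apply: continuous_comp; [exact: cG|exact: norm_continuous].
by apply: eq_integral => t _; rewrite /= normrM (gtr0_norm (asinh_jac_gt0 t a0)).
Qed.

Lemma HintegrableB (g h : R -> R) : Hintegrable g -> Hintegrable h -> Hintegrable (fun y => g y - h y).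
Proof.
move=> ig ih; rewrite /Hintegrable (_ : _ \o _ = (EFin \o g) \- (EFin \o h))%E; first exact: integrableB.
by apply/funext => y; rewrite /= EFinB.
Qed.

Lemma HintB (g h : R -> R) : Hintegrable g -> Hintegrable h ->
  Hint (fun y => g y - h y) = Hint g - Hint h.
Proof. by move=> ig ih; exact: RintegralB. Qed.

Lemma Hint_ae_ge0 (g : R -> R) : Hintegrable g ->
  {ae mu, forall y, `[0, +oo[%classic y -> 0 <= g y} -> 0 <= Hint g.
Proof.
move=> ig g0; have mg : measurable_fun (`[0, +oo[ : set R) (EFin \o g) by case/integrableP: ig.
rewrite /Hint /Rintegral fine_ge0//.
have ae : {ae mu, forall y, `[0, +oo[%classic y -> (g y)%:E = `|(g y)%:E|%E}.
  by apply: (@filterS _ _ (ae_filter_ringOfSetsType mu) _ _ _ g0) => y gy Dy; rewrite /= ger0_norm// gy.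
have -> : (\int[mu]_(y in `[0%R, +oo[) (g y)%:E = \int[mu]_(y in `[0%R, +oo[) `|(g y)%:E|)%E; last exact: integral_ge0.
apply: ae_eq_integral => //.
exact: measurableT_comp.
Qed.

End CriticalLineSubstitution.

Section CriticalLine.
Context {R : realType}.
Variables (D : R -> R -> Prop) (f f1 f2 : R -> R -> cplx R).
Implicit Types (a t y e : R).
Local Notation mu := (@lebesgue_measure R).
Local Notation U := (reglog f f1 f2).
Local Notation en := (fun n : nat => (n.+1%:R^-1 : R)).
Local Notation w := (fun y : R => (ch y ^+ 2)^-1).

Lemma continuous_recip_ch2 y : {for y, continuous w}.
Proof.
have c0 := ch_gt0 y.
apply: der_continuous; apply: derV; first by rewrite expf_neq0// gt_eqF.
by apply: derX; exact: der_ch.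
Qed.

Lemma reglog_recip_ch2_integrable (F : strip_fun D f f1 f2) e : 0 < e <= 1 ->
  Hintegrable (fun y => j0 (U e) 0 y * (ch y ^+ 2)^-1).
Proof.
move=> e01; have [e0 e1] : 0 < e /\ e <= 1 by apply/andP.
have p := @pi_gt0 R; have i0 : 0 <= (0 : R) <= pi by apply/andP; split; lra.
have half01 : 0 < (2^-1 : R) < 1 by apply/andP; split; lra.
have [C HC] := edge_abs F e01 half01.
have [||//] := @half_line_cvg R (fun y => j0 (U e) 0 y * (ch y ^+ 2)^-1) (2 * C).
- move=> y _; apply: continuousM; last exact: continuous_recip_ch2.
  by apply: (contI_reglog F e0 i0 (a := y) (b := y)); rewrite lexx.
- move=> y _; rewrite -[leRHS]mulrA; apply: le_trans (_ : 2 * `|j0 (U e) 0 y * edge_weight 2^-1 y| <= _); last first.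
    by rewrite ler_pM2l.
  rewrite !(normrM (j0 _ _ _)) (mulrCA 2); apply: ler_wpM2l; first exact: normr_ge0.
  have c1 := ch_ge1 y; have c2 : 0 < ch y ^+ 2 by rewrite exprn_gt0// ch_gt0.
  have /andP[w0 _] := edge_weight_le y half01.
  rewrite (gtr0_norm w0) gtr0_norm ?invr_gt0// /edge_weight divff// !mul1r.
  rewrite -[leRHS]invrK lef_pV2 ?posrE ?invr_gt0 ?divr_gt0//; last lra.
  rewrite invf_div; nra.
Qed.

Lemma ge_lnabs_reglog e y : 0 < cnorm2 (f 0 y) -> 0 < e -> lnabs f 0 y <= j0 (U e) 0 y.
Proof.
move=> N0 e0; rewrite /lnabs /= ler_pM2l// ler_ln ?posrE//.
  by rewrite lerDl mulr_ge0 ?sqr_ge0// exprn_ge0// ltW// ch_gt0.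
have E0 : 0 < e ^+ 2 * ch y ^+ 6 by apply: mulr_gt0; rewrite exprn_gt0// ch_gt0.
by apply: lt_le_trans E0 _; rewrite lerDr ltW.
Qed.

(** [lnabs f 0] may be discontinuous at zeros on the line, so the substitution is made for the
    continuous regularised logarithms, and [regularised_ln_cvg] in both variables identifies the
    limits. *)
Lemma critical_line_substitution (F : strip_fun D f f1 f2) a : 0 < a ->
  let g t := lnabs f 0 (asinh (t / a)) * ((ch (asinh (t / a)) ^+ 2)^-1 * asinh_jac a t) in
  Hintegrable g /\ Hint g = Hint (fun y => lnabs f 0 y * (ch y ^+ 2)^-1).
Proof.
move=> a0 g; have p := @pi_gt0 R; have i0 : 0 <= (0 : R) <= pi by apply/andP; split; lra.
have half01 : 0 < (2^-1 : R) < 1 by apply/andP; split; lra.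
have [aeN _ _] := edge_ln_cvg F half01; have [iL _ _] := bdry_ln_cvg F.
pose u n y := j0 (U (en n)) 0 y * (ch y ^+ 2)^-1.
have iu n : Hintegrable (u n) by exact: (reglog_recip_ch2_integrable F (harmonic01 n)).
have cu n y : {for y, continuous (u n)}.
  apply: continuousM; last exact: continuous_recip_ch2.
  have /andP[e0 _] := @harmonic01 R n.
  by apply: (contI_reglog F e0 i0 (a := y) (b := y)); rewrite lexx.
(* The regularised logarithms lie above [lnabs] almost everywhere, so its integral bounds theirs
   from below. *)
pose C := - Hint (fun y => lnabs f 0 y * (ch y ^+ 2)^-1).
have uC n : - C <= Hint (u n).
  rewrite opprK -subr_ge0 -HintB//; apply: Hint_ae_ge0; first exact: HintegrableB.
  have /andP[e0 _] := @harmonic01 R n.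
  apply: (@filterS _ _ (ae_filter_ringOfSetsType mu) _ _ _ aeN) => y Ny Dy; rewrite subr_ge0 /u ler_pM2r ?invr_gt0 ?exprn_gt0 ?ch_gt0//.
  exact: ge_lnabs_reglog (Ny Dy) e0.
have mE : measurable_fun (`[0, +oo[ : set R) (fun y : R => ch y ^+ 6).
  apply: continuous_measurable_half => y.
  by apply: (@der_continuous _ _ _ (6%:R * ch y ^+ 5 * sh y)); der_auto.
have cphi t : {for t, continuous (fun t => asinh (t / a))}.
  by apply: continuous_comp; [exact: continuous_scale|exact: continuous_asinh].
have cN y : {for y, continuous (fun y => cnorm2 (f 0 y))} by exact: (continuous_cnorm2 F).
have cch6 y : {for y, continuous (fun y : R => ch y ^+ 6)}.
  by apply: (@der_continuous _ _ _ (6%:R * ch y ^+ 5 * sh y)); der_auto.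
have cw y : {for y, continuous w} by exact: continuous_recip_ch2.
have w0 y : 0 < (ch y ^+ 2)^-1 by rewrite invr_gt0 exprn_gt0 ?ch_gt0.
have [||||||||_ _ l1] := @regularised_ln_cvg _ _ R mu `[0, +oo[ (fun y => cnorm2 (f 0 y))
  (fun y => ch y ^+ 6) w C (measurable_itv _).
- exact: continuous_measurable_half.
- exact: mE.
- exact: continuous_measurable_half.
- by move=> y _; exact: cnorm2_ge0.
- by move=> y _; rewrite exprn_gt0 ?ch_gt0.
- by move=> y _; exact: w0.
- exact: iu.
- exact: uC.
have ju n : Hintegrable (fun t => u n (asinh (t / a)) * asinh_jac a t) by exact: asinh_integrable.
have eu n : Hint (fun t => u n (asinh (t / a)) * asinh_jac a t) = Hint (u n).
  by rewrite /Hint /Rintegral -asinh_substitution.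
have Eu n : (fun t => u n (asinh (t / a)) * asinh_jac a t) =
    (fun t => j0 (U (en n)) 0 (asinh (t / a)) * ((ch (asinh (t / a)) ^+ 2)^-1 * asinh_jac a t)).
  by apply/funext => t; rewrite /u mulrA.
have [||||||||_ i2 l2] := @regularised_ln_cvg _ _ R mu `[0, +oo[ (fun t => cnorm2 (f 0 (asinh (t / a))))
  (fun t => ch (asinh (t / a)) ^+ 6) (fun t => (ch (asinh (t / a)) ^+ 2)^-1 * asinh_jac a t) C (measurable_itv _).
- apply: continuous_measurable_half => t.
  by apply: (@continuous_comp _ _ _ (fun t => asinh (t / a)) (fun y => cnorm2 (f 0 y))); [exact: cphi|exact: cN].
- apply: continuous_measurable_half => t.
  by apply: (@continuous_comp _ _ _ (fun t => asinh (t / a)) (fun y => ch y ^+ 6)); [exact: cphi|exact: cch6].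
- apply: continuous_measurable_half => t; apply: continuousM; last exact: continuous_asinh_jac.
  by apply: (@continuous_comp _ _ _ (fun t => asinh (t / a)) w); [exact: cphi|exact: cw].
- by move=> t _; exact: cnorm2_ge0.
- by move=> t _; rewrite exprn_gt0 ?ch_gt0.
- by move=> t _; rewrite mulr_gt0// asinh_jac_gt0.
- by move=> n; have := ju n; rewrite Eu.
- by move=> n; have := uC n; rewrite -(eu n) Eu.
split; first exact: i2.
have l3 : Hint (fun t => j0 (U (en n)) 0 (asinh (t / a)) * ((ch (asinh (t / a)) ^+ 2)^-1 * asinh_jac a t))
    @[n --> \oo] --> Hint (fun y => lnabs f 0 y * (ch y ^+ 2)^-1).
  rewrite [X in X @ _](_ : _ = (fun n => Hint (u n))); first exact: l1.
  by apply/funext => n; rewrite -(eu n) Eu.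
exact: (cvg_unique _ l2 l3).
Qed.

End CriticalLine.

Section RealAxisSubstitution.
Context {R : realType}.
Implicit Types (a s y : R).
Local Notation mu := (@lebesgue_measure R).

(** The value of [ch y] at the point [s = 1 - a + a * ch y] of the slit. *)
Definition axis_coord a s := (s - (1 - a)) / a.

Definition acosh_jac a s := (a * Num.sqrt (axis_coord a s ^+ 2 - 1))^-1.

Lemma axis_coord_gt1 a s : 0 < a -> 1 < s -> 1 < axis_coord a s.
Proof. by move=> a0 s1; rewrite ltr_pdivlMr//; lra. Qed.

Lemma der_axis_coord a s : der (axis_coord a) s a^-1.
Proof. by rewrite /axis_coord; der_auto; ring. Qed.

Lemma acosh_homo s y : 1 < s -> s <= y -> acosh s <= acosh y.
Proof.
move=> s1 sy; have y1 : 1 < y by exact: lt_le_trans sy.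
have [_ _ ps] := acosh_root s1; have [_ _ py] := acosh_root y1.
rewrite /acosh ler_ln ?posrE//; apply: lerD => //; apply: ler_wsqrtr.
by rewrite lerD2r; apply: lerXn2r => //; rewrite nnegrE; lra.
Qed.

Lemma acosh_jac_gt0 a s : 0 < a -> 1 < s -> 0 < acosh_jac a s.
Proof.
move=> a0 s1; have [q _ _] := acosh_root (axis_coord_gt1 a0 s1).
by rewrite invr_gt0 mulr_gt0.
Qed.

Lemma der_acosh_coord a s : 0 < a -> 1 < s -> der (fun s => acosh (axis_coord a s)) s (acosh_jac a s).
Proof.
move=> a0 s1; apply: der_eq (der_comp (der_axis_coord a s) (der_acosh (axis_coord_gt1 a0 s1))) _.
by rewrite /acosh_jac invfM.
Qed.

Lemma continuous_acosh_jac a s : 0 < a -> 1 < s -> {for s, continuous (acosh_jac a)}.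
Proof.
move=> a0 s1; have u1 := axis_coord_gt1 a0 s1; have [q0 q2 _] := acosh_root u1.
have d : der (fun s => axis_coord a s ^+ 2 - 1) s (2%:R * axis_coord a s ^+ 1 * a^-1 + - 0).
  by apply: derD; [apply: derX; exact: der_axis_coord|exact: derN (derC _ _)].
apply: der_continuous; apply: derV; first by rewrite mulf_neq0// gt_eqF.
by apply: derM; [exact: derC|apply: der_sqrt d; nra].
Qed.

Lemma continuous_measurable_ray a (g : R -> R) : (forall s, a <= s -> {for s, continuous g}) ->
  measurable_fun (`[a, +oo[ : set R) g.
Proof.
move=> cg; apply: subspace_continuous_measurable_fun => //; apply: continuous_in_subspaceT => s.
by rewrite inE/= in_itv/= andbT; exact: cg.
Qed.

Lemma acosh_ray_substitution a r (G : R -> R) : 0 < a -> 1 < r -> (forall y, 0 < y -> {for y, continuous G}) ->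
  (\int[mu]_(y in `[acosh (axis_coord a r), +oo[) (G y)%:E =
   \int[mu]_(s in `[r, +oo[) (G (acosh (axis_coord a s)) * acosh_jac a s)%:E)%E.
Proof.
move=> a0 r1 cG; have rs s : r <= s -> 1 < s by exact: lt_le_trans.
have ge s A : 1 + a * A <= s -> A <= axis_coord a s.
  by move=> h; rewrite ler_pdivlMr//; lra.
apply: (@half_line_substitution _ (fun s => acosh (axis_coord a s)) (acosh_jac a) G r 0).
- by move=> s /rs; exact: der_acosh_coord.
- by move=> s /rs; exact: acosh_jac_gt0.
- by move=> s /rs; exact: continuous_acosh_jac.
- apply/cvgrPdist_le => e e0; near=> s.
  have h1 : 1 + a * 2 <= s by near: s; apply: nbhs_pinfty_ge; rewrite num_real.
  have h2 : 1 + a * (2 / (a * e)) <= s by near: s; apply: nbhs_pinfty_ge; rewrite num_real.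
  have s1 : 1 < s by lra.
  have {}h1 := ge _ _ h1; have {}h2 := ge _ _ h2; have [q0 q2 _] := acosh_root (axis_coord_gt1 a0 s1).
  rewrite sub0r normrN gtr0_norm ?acosh_jac_gt0// -[leRHS]invrK.
  rewrite lef_pV2 ?posrE ?invr_gt0 ?mulr_gt0//.
  have ae : 0 < a * e by rewrite mulr_gt0.
  rewrite -ler_pdivrMl// -invfM.
  rewrite ler_pdivrMr// in h2; rewrite -[(a * e)^-1]mul1r ler_pdivrMr//.
  move: q0 q2 h1 h2 ae; move: (axis_coord a s) (Num.sqrt _) (a * e); clear => u q z q0 q2 h1 h2 z0.
  have : u <= 2 * q by nra.
  nra.
- apply/cvgryPge => A; near=> s.
  have h1 : 1 + a * 2 <= s by near: s; apply: nbhs_pinfty_ge; rewrite num_real.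
  have h2 : 1 + a * expR A <= s by near: s; apply: nbhs_pinfty_ge; rewrite num_real.
  have s1 : 1 < s by lra.
  have {}h2 := ge _ _ h2; have [q0 q2 p0] := acosh_root (axis_coord_gt1 a0 s1).
  rewrite -[A]expRK /acosh ler_ln ?posrE ?expR_gt0//; lra.
- move=> y hy; apply: cG; apply: lt_le_trans hy; apply: acosh_gt0; exact: axis_coord_gt1.
Unshelve. all: end_near. Qed.

(** The jacobian is singular at [s = 1]; the rays from [1 + 1 / (n + 1)] exhaust the open half-line,
    and nonnegativity of [G] gives convergence along them. *)
Lemma acosh_substitution a (G : R -> R) : 0 < a -> (forall y, 0 < y -> {for y, continuous G}) ->
  (forall y, 0 <= G y) ->
  (\int[mu]_(y in `]0%R, +oo[) (G y)%:E =
   \int[mu]_(s in `]1%R, +oo[) (G (acosh (axis_coord a s)) * acosh_jac a s)%:E)%E.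
Proof.
move=> a0 cG G0; pose r n : R := 1 + n.+1%:R^-1.
have r1 n : 1 < r n by rewrite ltrDl; have /andP[] := @harmonic01 R n.
have rn m n : (m <= n)%N -> r n <= r m.
  by move=> mn; rewrite lerD2l lef_pV2 ?posrE// ler_nat.
have rE e : 1 < e -> exists n, r n <= e.
  move=> e1; have [N _ /(_ N (leqnn N))/= h] : \forall n \near \oo, n.+1%:R^-1 <= e - 1.
    by apply: harmonic_near; lra.
  by exists N; rewrite /r addrC -lerBrDr.
pose y_ n := acosh (axis_coord a (r n)).
have y0 n : 0 < y_ n by apply: acosh_gt0; exact: axis_coord_gt1.
have U1 : \bigcup_n `[r n, +oo[%classic = (`]1, +oo[ : set R).
  apply/seteqP; split => s /=.
    by move=> [n _]; rewrite /= !in_itv/= !andbT; exact: lt_le_trans.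
  by rewrite in_itv/= andbT => /rE[n h]; exists n; rewrite //= in_itv/= andbT.
have U0 : \bigcup_n `[y_ n, +oo[%classic = (`]0, +oo[ : set R).
  apply/seteqP; split => y /=.
    by move=> [n _]; rewrite /= !in_itv/= !andbT; exact: lt_le_trans.
  rewrite in_itv/= andbT => yp; have c1 : 1 < ch y.
    by have := chE y; have := sh_gt0 yp; have := ch_gt0 y; nra.
  (* The point of the slit with coordinate [y]; it exceeds 1 because [y > 0]. *)
  have [n h] := @rE (1 - a + a * ch y) ltac:(nra); exists n; rewrite //= in_itv/= andbT.
  rewrite -(acosh_ch yp); apply: acosh_homo; first exact: axis_coord_gt1.
  by rewrite ler_pdivrMr//; lra.
have mono (z : R^nat) : (forall m n, (m <= n)%N -> z n <= z m) ->
    nondecreasing_seq (fun n => `[z n, +oo[%classic : set R).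
  move=> zn m n mn; rewrite subsetEset => s; rewrite /= !in_itv/= !andbT.
  exact: le_trans (zn _ _ mn).
have c1 := @ge0_nondecreasing_set_cvg_integral _ (measurableTypeR R) R (fun n => `[y_ n, +oo[%classic) (fun y => (G y)%:E) [the {measure set (measurableTypeR R) -> \bar R} of mu].
have c2 := @ge0_nondecreasing_set_cvg_integral _ (measurableTypeR R) R (fun n => `[r n, +oo[%classic)
  (fun s => (G (acosh (axis_coord a s)) * acosh_jac a s)%:E) [the {measure set (measurableTypeR R) -> \bar R} of mu].
rewrite U0 in c1; rewrite U1 in c2.
have {}c1 : (\int[mu]_(y in `[y_ n, +oo[) (G y)%:E)%E @[n --> \oo] --> (\int[mu]_(y in `]0%R, +oo[) (G y)%:E)%E.
  apply: c1.
  - apply: (mono y_) => m n mn; apply: acosh_homo; first exact: axis_coord_gt1.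
  by rewrite ler_pM2r ?invr_gt0// lerD2r rn.
  - by move=> n; exact: measurable_itv.
  - move=> n; apply/measurable_EFinP; apply: continuous_measurable_ray => y hy.
  by apply: cG; exact: lt_le_trans hy.
  - by move=> n y _; rewrite lee_fin.
have {}c2 : (\int[mu]_(s in `[r n, +oo[) (G (acosh (axis_coord a s)) * acosh_jac a s)%:E)%E @[n --> \oo] -->
    (\int[mu]_(s in `]1%R, +oo[) (G (acosh (axis_coord a s)) * acosh_jac a s)%:E)%E.
  apply: c2.
  - exact: (mono r).
  - by move=> n; exact: measurable_itv.
  - move=> n; apply/measurable_EFinP; apply: continuous_measurable_ray => s hs.
    have s1 : 1 < s by exact: lt_le_trans hs.
    apply: continuousM; last exact: continuous_acosh_jac.
    apply: (@continuous_comp _ _ _ (fun s => acosh (axis_coord a s)) G).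
      exact: der_continuous (der_acosh_coord a0 s1).
    by apply: cG; apply: acosh_gt0; exact: axis_coord_gt1.
  - move=> n s; rewrite /= in_itv/= andbT => hs; rewrite lee_fin mulr_ge0// ltW// acosh_jac_gt0//.
    exact: lt_le_trans hs.
have E : (fun n => \int[mu]_(y in `[y_ n, +oo[) (G y)%:E)%E =
    (fun n => \int[mu]_(s in `[r n, +oo[) (G (acosh (axis_coord a s)) * acosh_jac a s)%:E)%E.
  by apply/funext => n; exact: acosh_ray_substitution.
rewrite E in c1; apply: (cvg_unique _ c1 c2); exact: ereal_hausdorff.
Qed.

Variables (D : R -> R -> Prop) (f f1 f2 : R -> R -> cplx R).

(** Nonnegativity of [ln |f|] on the slit permits [acosh_substitution]; the factor [k], later
    [a ^- 2], is carried along inside the integral. *)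
Lemma real_axis_substitution (F : strip_fun D f f1 f2) a k : 0 < a -> 0 <= k ->
  (\int[mu]_(s in `]1%R, +oo[)
     (k * (lnabs f (pi / 2) (acosh (axis_coord a s)) * (sh (acosh (axis_coord a s)) ^+ 2)^-1 *
       acosh_jac a s))%:E)%E
  = (k * Hint (fun y => lnabs f (pi / 2) y * (sh y ^+ 2)^-1))%:E.
Proof.
move=> a0 k0; have [_ iL _] := bdry_ln_cvg F; have p := @pi_gt0 R.
have i1 : 0 <= (pi / 2 : R) <= pi by apply/andP; split; lra.
have ikL := HintegrableZ k iL.
transitivity (\int[mu]_(y in `]0%R, +oo[) (k * (lnabs f (pi / 2) y * (sh y ^+ 2)^-1))%:E)%E.
  rewrite (@acosh_substitution a (fun y => k * (lnabs f (pi / 2) y * (sh y ^+ 2)^-1)))//.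
  - by apply: eq_integral => s _; rewrite mulrA.
  - move=> y y0; have [h1 _] := sf_axis F y; have /andP[h2 _] := sf_axis_bounds F y.
  apply: continuousM; first exact: cst_continuous.
  apply: continuousM.
    apply: continuousM; first exact: cst_continuous.
    apply: (@continuous_comp _ _ _ (fun y => cnorm2 (f (pi / 2) y)) (@ln R)).
      exact: (continuous_cnorm2 F).
    by apply: continuous_ln; rewrite /cnorm2 h1; nra.
  apply: der_continuous; apply: derV; first by rewrite expf_neq0// gt_eqF// sh_gt0.
  by apply: derX; exact: der_sh.
  - by move=> y; have /andP[h _] := axis_ln_bounds F y; rewrite mulr_ge0// mulr_ge0// invr_ge0 sqr_ge0.
rewrite integral_itv_obnd_cbnd; last first.
  by case/integrableP : ikL => + _; apply: measurable_funS => // y; rewrite /= !in_itv/= !andbT; exact: ltW.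
rewrite RintegralNE//; congr (_%:E); exact: RintegralZl.
Qed.

End RealAxisSubstitution.

(** * Zeros and integrands of the theorem in strip coordinates *)

Section ZetaStrip.
Context {R : realType}.
Implicit Types (a s t u v x y : R).
Local Notation mu := (@lebesgue_measure R).

Lemma cnorm2_eq0 (z : cplx R) : cnorm2 z = 0 -> z = Cplx 0 0.
Proof. by case: z => p q /sqrD_eq0/=[-> ->]. Qed.

(* Elliptic coordinates: the distances of [u + iv] to the foci [-1] and [1] are
   [ch y + sin x] and [ch y - sin x]. *)
Lemma sin_surj u v : 0 < u -> ~ (v = 0 /\ 1 <= u) ->
  exists x y, [/\ 0 < x < pi / 2, sin x * ch y = u & cos x * sh y = v].
Proof.
move=> u0 uv; pose p := Num.sqrt ((u + 1) ^+ 2 + v ^+ 2); pose q := Num.sqrt ((u - 1) ^+ 2 + v ^+ 2).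
have v2 := sqr_ge0 v; have um2 := sqr_ge0 (u - 1).
have p2 : p ^+ 2 = (u + 1) ^+ 2 + v ^+ 2 by rewrite sqr_sqrtr//; nra.
have q2 : q ^+ 2 = (u - 1) ^+ 2 + v ^+ 2 by rewrite sqr_sqrtr//; nra.
have p0 : 0 <= p by exact: sqrtr_ge0.
have q0 : 0 <= q by exact: sqrtr_ge0.
(* [q] is the distance to the focus 1 and equals [u - 1] only on the excluded slit. The strict
   inequality gives [sin x < 1]. *)
have qu : u - 1 < q.
  rewrite ltNge; apply/negP => qu; apply: uv; have v0 : v ^+ 2 <= 0 by nra.
  have /eqP : v ^+ 2 = 0 by lra.
  by rewrite sqrf_eq0 => /eqP ->; split=> //; lra.
pose S := (p - q) / 2; pose C := (p + q) / 2.
have SC : S * C = u.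
  rewrite (_ : S * C = (p ^+ 2 - q ^+ 2) / 4); last by rewrite /S /C; field.
  by rewrite p2 q2; field.
have SC2 : S ^+ 2 + C ^+ 2 = u ^+ 2 + v ^+ 2 + 1.
  rewrite (_ : S ^+ 2 + C ^+ 2 = (p ^+ 2 + q ^+ 2) / 2); last by rewrite /S /C; field.
  by rewrite p2 q2; field.
have C0 : 0 <= C by rewrite /C; lra.
have S1 : S < 1 by rewrite /S; nra.
have S0 : 0 < S by nra.
have S11 : -1 <= S <= 1 by apply/andP; split; lra.
have [xI sx] := asin_def S11; have pi0 := @pi_gt0 R.
have x2 : asin S < pi / 2 by apply: asin_ltpi2; apply/andP; split; lra.
have x0 : 0 < asin S.
  rewrite ltNge; apply/negP => x0; have : 0 <= sin (- asin S).
    by apply: sin_ge0_pi; apply/andP; split; case/andP: xI => ? ?; lra.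
  by rewrite sinN sx; lra.
have c0 : 0 < cos (asin S) by apply: cos_gt0_pihalf; apply/andP; split; lra.
have c2 : cos (asin S) ^+ 2 = 1 - S ^+ 2 by have := cos2Dsin2 (asin S); rewrite sx; lra.
exists (asin S), (asinh (v / cos (asin S))); split.
- by apply/andP.
- rewrite sx -[RHS]SC ch_asinh; congr (_ * _).
  rewrite -[RHS](ger0_norm C0) -sqrtr_sqr; congr Num.sqrt.
  have n0 : 1 - S ^+ 2 != 0 by rewrite gt_eqF//; nra.
  rewrite exprMn exprVn c2; apply: (mulIf n0); rewrite mulrDl mul1r divfK//.
  have E : S ^+ 2 * C ^+ 2 = u ^+ 2 by rewrite -exprMn SC.
  rewrite mulrBr mulr1 [C ^+ 2 * _]mulrC E; lra.
- by rewrite sh_asinh mulrC divfK// gt_eqF.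
Qed.

Lemma re_strip_pt_gt a x y : 0 < a -> 0 < x < pi / 2 -> 1 - a < re (strip_pt a x y).
Proof.
move=> a0 /andP[x0 x1]; rewrite /strip_pt/= ltrDl; apply: mulr_gt0; last exact: ch_gt0.
by apply: mulr_gt0 => //; apply: sin_gt0_pi; have := @pi_gt0 R; lra.
Qed.

Lemma strip_pt_neq1 a x y : 0 < a -> 0 < x < pi / 2 -> ~ (re (strip_pt a x y) = 1 /\ im (strip_pt a x y) = 0).
Proof.
move=> a0 /andP[x0 x1]; rewrite /strip_pt/= => -[h1 h2]; have pi0 := @pi_gt0 R.
have c0 : 0 < cos x by apply: cos_gt0_pihalf; apply/andP; split; lra.
have ac : a * cos x != 0 by rewrite gt_eqF// mulr_gt0.
have sy : sh y = 0 by move/eqP: h2; rewrite mulf_eq0 (negbTE ac)/= => /eqP.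
have cy : ch y = 1 by have := chE y; rewrite sy; have := ch_gt0 y; nra.
have := cos2Dsin2 x; have : sin x = 1 by move: h1; rewrite cy mulr1; nra.
by move=> ->; nra.
Qed.

(** In the open strip [s] differs from 1, so zeros of [f] and of zeta correspond. The slit
    [sigma > 1] is not covered by the open strip; there [zstrip_axis_bounds] excludes zeros. *)
Lemma zstrip_zeros a : 0 < a -> a <= 1 / 2 ->
  (forall x y, 0 < x < pi / 2 -> cnorm2 (zstrip a x y) != 0) <->
  (forall s t, 1 - a < s -> ~ (s = 1 /\ t = 0) -> ~ (zeta (Cplx s t) = Cplx 0 0)).
Proof.
move=> a0 a1; have F := strip_fun_zeta a0 a1; have pi0 := @pi_gt0 R; split; last first.
  move=> nz x y xI; have h1 := re_strip_pt_gt y a0 xI; have h2 := strip_pt_neq1 (y := y) a0 xI.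
  have s0 : 0 < re (strip_pt a x y) by lra.
  rewrite /zstrip -(zeta_gfun s0 h2) cnorm2M mulf_neq0//; apply/eqP.
    by move=> /cnorm2_eq0; move: h1 h2; case: (strip_pt a x y) => s t/=; exact: nz.
  rewrite /cnorm2 /csub /cone; move: (strip_pt a x y) h2 => [p q]/= h2; rewrite subr0 => /sqrD_eq0[h3 h4]; apply: h2; split=> //; move: h3; lra.
move=> nz s t st st1 z0.
have g0 : gfun (Cplx s t) = Cplx 0 0.
  by rewrite -zeta_gfun ?z0//=; [rewrite /cmul/= !mul0r subr0 addr0|lra].
have [[t0 s1]|h] := pselect (t = 0 /\ 1 <= s).
  have s1' : 1 < s by rewrite lt_neqAle s1 andbT; apply/eqP => e; apply: st1.
  have := zstrip_axis_bounds a0 a1 (acosh (axis_coord a s)).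
  rewrite /zstrip (_ : strip_pt _ _ _ = Cplx s t) ?g0/= ?ler10//.
  rewrite /strip_pt t0 cos_pihalf sin_pihalf mulr0 mul0r mulr1 ch_acosh ?axis_coord_gt1//.
  by congr Cplx; rewrite /axis_coord; field; lra.
have u0 : 0 < axis_coord a s by rewrite divr_gt0//; lra.
have uv : ~ (t / a = 0 /\ 1 <= axis_coord a s).
  move=> [ta u1]; apply: h; split.
    by move/eqP: ta; rewrite mulf_eq0 invr_eq0 (gt_eqF a0) orbF => /eqP.
  by move: u1; rewrite ler_pdivlMr//; lra.
have [x [y [xI E1 E2]]] := sin_surj u0 uv.
have /eqP := nz x y xI; apply; rewrite /zstrip (_ : strip_pt a x y = Cplx s t).
  by rewrite g0 /cnorm2/= expr0n addr0.
rewrite /strip_pt -!mulrA E1 E2; congr Cplx; rewrite /axis_coord; field; lra.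
Qed.

Lemma powR32 u : 0 <= u -> u `^ (3 / 2) = Num.sqrt u ^+ 3.
Proof.
by move=> u0; rewrite (mulrC 3) powRrM powR12_sqrt// powR_mulrn// sqrtr_ge0.
Qed.

Lemma ln_sqrt_half u : 0 <= u -> ln (Num.sqrt u) = 2^-1 * ln u.
Proof.
rewrite le_eqVlt => /predU1P[<-|u0]; first by rewrite sqrtr0 ln0// mulr0.
have s0 : 0 < Num.sqrt u by rewrite sqrtr_gt0.
by rewrite -[in RHS](sqr_sqrtr (ltW u0)) (lnXn 2 s0) -[ln _ *+ 2]mulr_natl mulrA mulVf ?mul1r.
Qed.

(** With [t = a * sh y] one has [a ^+ 2 + t ^+ 2 = (a * ch y) ^+ 2]: the power [3 / 2] gives
    [(a * ch y) ^+ 3], one factor of which is the jacobian. *)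
Lemma critical_line_integrand a t : 0 < a -> a <= 1 / 2 ->
  ln (cabs (cmul (zeta (Cplx (1 - a) t)) (Cplx (- a) t))) / ((a ^+ 2 + t ^+ 2) `^ (3 / 2)) =
  a ^- 2 * (lnabs (zstrip a) 0 (asinh (t / a)) * ((ch (asinh (t / a)) ^+ 2)^-1 * asinh_jac a t)).
Proof.
move=> a0 a1; have -> : Cplx (- a) t = csub (Cplx (1 - a) t) (cone R).
  by rewrite /csub/= subr0; congr Cplx; ring.
rewrite zeta_gfun/=; [|lra|by move=> [h _]; lra].
have -> : Cplx (1 - a) t = strip_pt a 0 (asinh (t / a)).
  by rewrite /strip_pt sin0 cos0 mulr0 mul0r addr0 mulr1 sh_asinh mulrC divfK// gt_eqF.
rewrite -/(zstrip a 0 _) /cabs ln_sqrt_half ?cnorm2_ge0// -/(lnabs (zstrip a) 0 _).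
rewrite ch_asinh /asinh_jac; have [s0 s2 _] := asinh_root (t / a).
set s := Num.sqrt _ in s0 s2 *.
have e : a ^+ 2 + t ^+ 2 = (a * s) ^+ 2.
  by rewrite exprMn s2; field; rewrite gt_eqF.
have as0 : 0 < a * s by rewrite mulr_gt0.
rewrite e powR32 ?sqr_ge0// sqrtr_sqr gtr0_norm//.
by field; rewrite !gt_eqF.
Qed.

(** Here [s - 1 = a * (ch y - 1)] and [s - 1 + 2 * a = a * (ch y + 1)], with product
    [(a * sh y) ^+ 2]; one of the three factors [a * sh y] is the jacobian. *)
Lemma real_axis_integrand a s : 0 < a -> a <= 1 / 2 -> 1 < s ->
  ln (re (zeta (Cplx s 0)) * (s - 1)) / ((s - 1) `^ (3 / 2) * (s - 1 + 2 * a) `^ (3 / 2)) =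
  a ^- 2 * (lnabs (zstrip a) (pi / 2) (acosh (axis_coord a s)) *
    (sh (acosh (axis_coord a s)) ^+ 2)^-1 * acosh_jac a s).
Proof.
move=> a0 a1 s1; have u1 := axis_coord_gt1 a0 s1; have [q0 q2 _] := acosh_root u1.
have es : Cplx s 0 = strip_pt a (pi / 2) (acosh (axis_coord a s)).
  rewrite /strip_pt cos_pihalf sin_pihalf mulr0 mul0r mulr1 ch_acosh//.
  by congr Cplx; rewrite /axis_coord; field; rewrite gt_eqF.
have er : re (zeta (Cplx s 0)) * (s - 1) = re (zstrip a (pi / 2) (acosh (axis_coord a s))).
  rewrite /zstrip -es -zeta_gfun/= ?subr0 ?mulr0 ?subr0//; first by lra.
  by move=> [h _]; lra.
have [h1 _] := zstrip_axis a (acosh (axis_coord a s)).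
have /andP[h2 _] := zstrip_axis_bounds a0 a1 (acosh (axis_coord a s)).
have -> : ln (re (zeta (Cplx s 0)) * (s - 1)) = lnabs (zstrip a) (pi / 2) (acosh (axis_coord a s)).
  rewrite er /lnabs /cnorm2 h1 expr0n addr0 -ln_sqrt_half ?sqr_ge0// sqrtr_sqr ger0_norm//; lra.
rewrite sh_acosh// /acosh_jac -powRM; [|lra|lra].
set q := Num.sqrt _ in q0 q2 *.
have e : (s - 1) * (s - 1 + 2 * a) = (a * q) ^+ 2.
  by rewrite exprMn q2 /axis_coord; field; rewrite gt_eqF.
have aq0 : 0 < a * q by rewrite mulr_gt0.
rewrite e powR32 ?sqr_ge0// sqrtr_sqr gtr0_norm//.
by field; rewrite !gt_eqF.
Qed.

End ZetaStrip.

Theorem theorem6 (R : realType) (alpha : R) :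
  0 <= alpha -> alpha < 2^-1 ->
  ((\int[lebesgue_measure]_(t in `[0%R, +oo[)
      (ln (cabs (cmul (zeta (Cplx (2^-1 + alpha) t))
                      (Cplx (- 2^-1 + alpha) t)))
       / (((2^-1 - alpha) ^+ 2 + t ^+ 2) `^ (3 / 2)))%:E)%E
   =
   (- \int[lebesgue_measure]_(sigma in `]1%R, +oo[)
      (ln (re (zeta (Cplx sigma 0)) * (sigma - 1))
       / ((sigma - 1) `^ (3 / 2) * (sigma - 2 * alpha) `^ (3 / 2)))%:E)%E)
  <->
  (forall sigma t : R, 2^-1 + alpha < sigma -> ~ (sigma = 1 /\ t = 0) ->
     ~ (zeta (Cplx sigma t) = Cplx 0 0)).
Proof.
move=> al0 al1; pose a := 2^-1 - alpha.
have a0 : 0 < a by rewrite /a; lra.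
have a1 : a <= 1 / 2 by rewrite /a; lra.
have -> : 2^-1 + alpha = 1 - a by rewrite /a; field.
have -> : - 2^-1 + alpha = - a by rewrite /a; ring.
have F := strip_fun_zeta a0 a1.
have [iL EL] := critical_line_substitution F a0.
have a2 : a ^- 2 != 0 by rewrite invr_eq0 expf_neq0// gt_eqF.
pose I0 := Hint (fun y => lnabs (zstrip a) 0 y * (ch y ^+ 2)^-1).
set g := (fun t => _) in iL EL; rewrite -/I0 in EL.
set I1 := Hint (fun y => lnabs (zstrip a) (pi / 2) y * (sh y ^+ 2)^-1).
(* Both integrals are finite, so the equality of extended reals becomes one of reals. *)
have -> : (\int[lebesgue_measure]_(t in `[0%R, +oo[)
    (ln (cabs (cmul (zeta (Cplx (1 - a) t)) (Cplx (- a) t))) / ((a ^+ 2 + t ^+ 2) `^ (3 / 2)))%:E)%E =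
    (a ^- 2 * I0)%:E.
  transitivity (\int[lebesgue_measure]_(t in `[0%R, +oo[) ((a ^- 2)%:E * (EFin \o g) t))%E.
    by apply: eq_integral => t _; rewrite critical_line_integrand.
  by rewrite integralZl// RintegralNE// EFinM -EL.
have -> : (\int[lebesgue_measure]_(sigma in `]1%R, +oo[)
    (ln (re (zeta (Cplx sigma 0)) * (sigma - 1))
       / ((sigma - 1) `^ (3 / 2) * (sigma - 2 * alpha) `^ (3 / 2)))%:E)%E = (a ^- 2 * I1)%:E.
  rewrite -(real_axis_substitution F a0); last by rewrite invr_ge0 sqr_ge0.
  apply: eq_integral => s; rewrite inE/= in_itv/= andbT => s1.
  (* [sigma - 2 * alpha] is [sigma - 1 + 2 * a]. *)
  by rewrite -real_axis_integrand// /a; congr (_ / (_ * _ `^ _))%:E; field.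
rewrite -(zstrip_zeros a0 a1) -(bdry_identity_iff F) -/I0 -/I1 -EFinN; split.
  move=> -[]; rewrite -mulrN => /(mulfI a2) E.
  by rewrite E addNr.
by move=> h; rewrite -mulrN (_ : I0 = - I1)//; apply/eqP; rewrite -addr_eq0 h.
Qed.
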